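(* Let $\mathcal{G}=(G,\lambda)$ be a multilabel temporal graph. The following assertions are equivalent: (i) $\mathcal{G}$ admits an MTTO (multilabel temporal transitive orientation); (ii) $\mathcal{G}$ admits an AMTTO (almost multilabel temporal transitive orientation); (iii) $\mathrm{Ness}(\mathcal{G})$, the set of necessary arcs of $\mathcal{G}$, induces an acyclic digraph (no directed cycle, directed 2-cycles included). Furthermore, there is an $O(nm+\min\{kn,m^2\})$-time algorithm that decides whether $\mathcal{G}$ is a comparability multilabel temporal graph (i.e. admits an MTTO) and constructs an MTTO if the answer is YES, where $n$ is the number of vertices, $m$ the number of edges, and $k$ the number of monolabel triangles with a singleton time-label set associated to their edges.
   Context: A multilabel temporal graph $\mathcal{G}=(G,\lambda)$ consists of a finite simple undirected graph $G=(V,E)$ and a function $\lambda$ assigning to each edge a finite nonempty set of time-labels $\lambda(e)\subset\mathbb{N}$. For the algorithmic statement, label sets are given as ordered sets, so that the minimum and maximum of each are directly available. For sets $S_1,S_2\subseteq\mathbb{N}$: $S_1\preceq S_2$ (resp. $S_1\prec S_2$) if there exist $x\in S_1$, $y\in S_2$ with $x\le y$ (resp. $x<y$); $\not\preceq$ and $\not\prec$ denote the negations. Let $AP(G)=\{(u,v):uv\in E\}$ (both directions of each edge). An orientation $O\subseteq AP(G)$ contains exactly one of $(a,b),(b,a)$ for each edge $ab$. An orientation $O$ is an MTTO if whenever $(a,b),(b,c)\in O$ with $\lambda(ab)\preceq\lambda(bc)$, then $(a,c)\in O$ and $\lambda(ac)\not\prec\lambda(bc)$. The implication digraph $\mathrm{Imp}(\mathcal{G})$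 has vertex set $AP(G)$ and, for all distinct $a,b,c$ with $ab,bc\in E$, $\lambda(ab)\preceq\lambda(bc)$ and ($ac\notin E$ or $\lambda(ac)\prec\lambda(bc)$), an arc from $(a,b)$ to $(c,b)$ and an arc from $(b,c)$ to $(b,a)$. A quadruple of distinct vertices $(a,b,c,d)$ forms a correlated monolabel triangle if there is a singleton $T\subset\mathbb{N}$ such that $ab,bc,ac\in E$ with $\lambda(ab)=\lambda(bc)=\lambda(ac)=T$; $bd\in E$ with $\lambda(bd)\preceq T$; $cd\in E$ with $\lambda(cd)\not\preceq T$; and if $ad\in E$ then $\lambda(ad)\prec T$. The augmented implication digraph $\mathrm{Aug}(\mathcal{G})$ is obtained from $\mathrm{Imp}(\mathcal{G})$ by adding, for every correlated monolabel triangle $(a,b,c,d)$, the arcs $((b,c),(a,c))$ and $((c,a),(c,b))$. An arc $(x,y)$ forces $(u,v)$ if there is a directed path (possibly of length $0$) from $(x,y)$ to $(u,v)$ in $\mathrm{Aug}(\mathcal{G})$. For $O\subseteq AP(G)$, $O^+$ is the set of elements of $AP(G)$ forced by some arc of $O$. An orientation $O$ is an AMTTO if $O^+=O$. An arc $(x,y)\in AP(G)$ is necessary if $(y,x)$ forces $(x,y)$; $\mathrm{Ness}(\mathcal{G})$ is the set of necessary arcs. *)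

(* Defs.v *)
From mathcomp Require Import all_boot finmap.

Set Implicit Arguments.
Unset Strict Implicit.
Unset Printing Implicit Defensive.

(* [lab] is only meaningful on pairs [(u, v)] with [adj u v]; it assigns one
   label set to the undirected edge because of [lab_sym]. *)
Record mtgraph (V : finType) := MTGraph {
  adj : rel V;
  lab : V -> V -> {fset nat};
  adj_sym : symmetric adj;
  adj_irr : irreflexive adj;
  lab_sym : forall u v, adj u v -> lab u v = lab v u;
  lab_neq0 : forall u v, adj u v -> lab u v != fset0
}.

Definition preceq (S1 S2 : {fset nat}) : bool :=
  [exists x : S1, exists y : S2, val x <= val y].

Definition prec (S1 S2 : {fset nat}) : bool :=
  [exists x : S1, exists y : S2, val x < val y].

Section Digraphs.
Variables (V : finType) (G : mtgraph V).
Implicit Types (a b c d : V) (p q : V * V) (O : {set V * V}).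

Definition AP : {set V * V} := [set p | adj G p.1 p.2].

Definition edges : {set {set V}} := [set [set p.1; p.2] | p in AP].

Definition orientation O : bool :=
  (O \subset AP) &&
  [forall a, forall b, adj G a b ==> (((a, b) \in O) (+) ((b, a) \in O))].

Definition mtto O : bool :=
  orientation O &&
  [forall a, forall b, forall c,
     [&& (a, b) \in O, (b, c) \in O & preceq (lab G a b) (lab G b c)] ==>
     ((a, c) \in O) && ~~ prec (lab G a c) (lab G b c)].

Definition imp_arc p q : bool :=
  [exists a, exists b, exists c,
     [&& uniq [:: a; b; c], adj G a b, adj G b c,
         preceq (lab G a b) (lab G b c),
         ~~ adj G a c || prec (lab G a c) (lab G b c)
       & ((p == (a, b)) && (q == (c, b))) ||
         ((p == (b, c)) && (q == (b, a)))]].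

Definition mono_triangle a b c : bool :=
  [&& adj G a b, adj G b c, adj G a c,
      lab G b c == lab G a b, lab G a c == lab G a b & #|` lab G a b| == 1].

Definition correlated a b c d : bool :=
  let T := lab G a b in
  [&& uniq [:: a; b; c; d], mono_triangle a b c,
      adj G b d, preceq (lab G b d) T,
      adj G c d, ~~ preceq (lab G c d) T
    & adj G a d ==> prec (lab G a d) T].

Definition aug_arc p q : bool :=
  imp_arc p q ||
  [exists a, exists b, exists c, exists d,
     correlated a b c d &&
     (((p == (b, c)) && (q == (a, c))) || ((p == (c, a)) && (q == (c, b))))].

Definition forces p q : bool := connect aug_arc p q.

Definition forced_closure O : {set V * V} :=
  [set q in AP | [exists p in O, forces p q]].

Definition amtto O : bool := orientation O && (forced_closure O == O).

Definition necessary p : bool := forces (p.2, p.1) p.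

Definition Ness : {set V * V} := [set p in AP | necessary p].

(* [ucycle] holds of the empty sequence, and of [[:: a; b]] when both
   [(a, b)] and [(b, a)] are arcs with [a != b]. *)
Definition acyclic (D : {set V * V}) : Prop :=
  forall s : seq V, ucycle (fun u v => (u, v) \in D) s -> s = [::].

(* A triangle is counted once, as its set of vertices. *)
Definition mono_triangles : {set {set V}} :=
  [set S | [exists a, exists b, exists c,
              (S == [set a; b; c]) && mono_triangle a b c]].

End Digraphs.

(* Model of computation: structured programs for a unit-cost random access
   machine over the natural numbers, with finitely many registers and arrays
   occurring in each program.  There is neither multiplication nor division;
   [Sub] is truncated and [Leq] has value 0 or 1.  Every operator, constant,
   register access, array access and command costs one unit. *)
Inductive expr :=
  | Const of nat
  | Reg of nat
  | Get of nat & expr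
  | Add of expr & expr
  | Sub of expr & expr
  | Leq of expr & expr.

Inductive cmd :=
  | Skip
  | Assign of nat & expr
  | Store of nat & expr & expr
  | Seq of cmd & cmd
  | If of expr & cmd & cmd
  | While of expr & cmd.

Record state := State {
  regs : nat -> nat;
  arrays : nat -> nat -> nat
}.

Definition set_reg (s : state) (x v : nat) : state :=
  State (fun y => if y == x then v else regs s y) (arrays s).

Definition set_cell (s : state) (a i v : nat) : state :=
  State (regs s)
        (fun b j => if (b == a) && (j == i) then v else arrays s b j).

Fixpoint eval (s : state) (e : expr) : nat :=
  match e with
  | Const k => k
  | Reg x => regs s x
  | Get a e1 => arrays s a (eval s e1)
  | Add e1 e2 => eval s e1 + eval s e2
  | Sub e1 e2 => eval s e1 - eval s e2
  | Leq e1 e2 => eval s e1 <= eval s e2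
  end.

Fixpoint ecost (e : expr) : nat :=
  match e with
  | Const _ | Reg _ => 1
  | Get _ e1 => (ecost e1).+1
  | Add e1 e2 | Sub e1 e2 | Leq e1 e2 => (ecost e1 + ecost e2).+1
  end.

(* [exec c s s' t]: started in [s], [c] halts in [s'] after [t] time units.
   A guard is true when its value is nonzero. *)
Inductive exec : cmd -> state -> state -> nat -> Prop :=
  | ExecSkip s : exec Skip s s 1
  | ExecAssign x e s :
      exec (Assign x e) s (set_reg s x (eval s e)) (ecost e).+1
  | ExecStore a i e s :
      exec (Store a i e) s (set_cell s a (eval s i) (eval s e))
           (ecost i + ecost e).+1
  | ExecSeq c1 c2 s s1 s2 t1 t2 :
      exec c1 s s1 t1 -> exec c2 s1 s2 t2 ->
      exec (Seq c1 c2) s s2 (t1 + t2).+1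
  | ExecIfTrue e c1 c2 s s' t :
      eval s e != 0 -> exec c1 s s' t ->
      exec (If e c1 c2) s s' (ecost e + t).+1
  | ExecIfFalse e c1 c2 s s' t :
      eval s e = 0 -> exec c2 s s' t ->
      exec (If e c1 c2) s s' (ecost e + t).+1
  | ExecWhileFalse e c s :
      eval s e = 0 -> exec (While e c) s s (ecost e).+1
  | ExecWhileTrue e c s s1 s2 t1 t2 :
      eval s e != 0 -> exec c s s1 t1 -> exec (While e c) s1 s2 t2 ->
      exec (While e c) s s2 (ecost e + t1 + t2).+1.

Section InputOutput.
Variables (n : nat) (G : mtgraph 'I_n).

Definition edge_list (es : seq ('I_n * 'I_n)) : Prop :=
  uniq [seq [set e.1; e.2] | e <- es] /\
  [seq [set e.1; e.2] | e <- es] =i edges G.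

Definition label_list (e : 'I_n * 'I_n) : seq nat :=
  sort leq (enum_fset (lab G e.1 e.2)).

(* Register 0 holds [n] and register 1 the number of edges.  Arrays 0 and 1
   hold the endpoints of each edge.  Array 3 is the concatenation of the
   increasingly sorted label lists, that of the [i]-th edge occupying the
   positions from [array 2, cell i] (included) to [array 2, cell i.+1]
   (excluded).  Everything else is 0. *)
Definition input (es : seq ('I_n * 'I_n)) : state :=
  State
    (fun x => nth 0 [:: n; size es] x)
    (fun a => match a with
       | 0 => nth 0 [seq val e.1 | e <- es]
       | 1 => nth 0 [seq val e.2 | e <- es]
       | 2 => fun i => if i <= size es
                       then sumn (take i [seq size (label_list e) | e <- es])
                       else 0
       | 3 => nth 0 (flatten [seq label_list e | e <- es])
       | _ => fun=> 0
       end).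

(* The arcs written in arrays 4 (tails) and 5 (heads), one per edge. *)
Definition output_arcs (m : nat) (s : state) : {set 'I_n * 'I_n} :=
  [set p | [exists i : 'I_m, (arrays s 4 i == val p.1) &&
                             (arrays s 5 i == val p.2)]].

(* Register 0 holds the answer: 1 for YES and 0 for NO. *)
Definition correct_output (m : nat) (s : state) : Prop :=
  (regs s 0 = 1 /\ mtto G (output_arcs m s)) \/
  (regs s 0 = 0 /\ ~ exists O, mtto G O).

End InputOutput.

(* Main.v *)
(* Only the minimum [lo] and the maximum [hi] of each label set matter.  In an
   AMTTO every directed triangle is monolabel, and it can be pulled back along
   the arcs of the augmented digraph without changing its third vertex.  So no
   arc of a directed triangle is necessary.  The arcs on no directed triangle
   form an acyclic digraph, by a shortest cycle argument; hence the necessary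
   arcs are acyclic.  Conversely, take the vertices in a linear order extending
   that digraph, and orient greedily the arcs by their tail, closing under
   forcing after each choice.  No choice is ever contradictory, and a directed
   triangle of the result would be pulled back to one at an earlier vertex, and
   so on for ever: the result is an MTTO.

   The augmented digraph is an instance of 2-satisfiability with at most [2 n]
   arcs out of each of the [2 m] oriented edges.  A depth-first search followed
   by a greedy assignment in the reverse of the finishing order solves it in
   time [O(n m)].  Correlated triangles are found by running through the
   neighbours [d] of [b] for each monolabel triangle [(a, b, c)]; this takes
   [O(k n)] steps, and also [O(m^2)] since [ac] and [bd] are edges. *)
Require Import Defs.
From mathcomp Require Import all_boot finmap zify.

Set Implicit Arguments.
Unset Strict Implicit.
Unset Printing Implicit Defensive.

(** * Label sets *)

(** Pulling a triangle back along an implication arc is what the correlated triangles are designed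
    for. Let T be the common label of the triangle. The only case that the implication arcs leave
    open is an edge all of whose labels exceed T, and this edge completes a correlated monolabel
    triangle; the added arcs exclude it. Pulling back along the added arcs leads to the same
    configuration again, so no further arcs are called for. The rest relies on skew symmetry: an arc
    from p to q comes with an arc from the reverse of q to the reverse of p. Hence choosing an
    undecided p, with all that it forces, contradicts the earlier choices only if p forces its own
    reverse. The order in which arcs are offered is then the only freedom, and the three uses of
    greed differ in it: necessary arcs in front, reverse finishing order, tails along a linear
    extension. Closing under forcing is itself a depth-first search that stops at marked nodes,
    because the marked set is closed. So one search program yields the finishing order, the
    assignment and the final orientation, and all the choices of one run together cost a single
    traversal. *)

Definition lo (S : {fset nat}) : nat := head 0 (sort leq (enum_fset S)).
Definition hi (S : {fset nat}) : nat := last 0 (sort leq (enum_fset S)).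

Section LabelBounds.
Implicit Types S : {fset nat}.

Lemma lo_le S x : x \in S -> lo S <= x.
Proof.
rewrite /lo => xS; have: x \in sort leq (enum_fset S) by rewrite mem_sort.
have := sort_sorted leq_total (enum_fset S).
case: (sort _ _) => //= y s /(order_path_min leq_trans)/allP ys.
by rewrite inE => /orP[/eqP->|/ys].
Qed.

Lemma hi_ge S x : x \in S -> x <= hi S.
Proof.
rewrite /hi => xS; have: x \in sort leq (enum_fset S) by rewrite mem_sort.
have := sort_sorted leq_total (enum_fset S).
case/lastP: (sort _ _) => // s y; rewrite last_rcons -(revK (rcons s y)) rev_sorted.
rewrite rev_rcons /= => /(order_path_min (rev_trans leq_trans))/allP ys.
by rewrite mem_rev inE => /orP[/eqP->|/ys].
Qed.

Lemma lo_in S : S != fset0 -> lo S \in S.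
Proof.
rewrite /lo => S0; rewrite -[_ \in S](mem_sort leq (enum_fset S)).
case E: (sort _ _) => [|y s]; last by rewrite /= mem_head.
by case/eqP: S0; apply/fsetP=> x; rewrite -[x \in S](mem_sort leq (enum_fset S)) E !inE.
Qed.

Lemma hi_in S : S != fset0 -> hi S \in S.
Proof.
rewrite /hi => S0; rewrite -[_ \in S](mem_sort leq (enum_fset S)).
case E: (sort _ _) => [|y s]; last by rewrite /= mem_last.
by case/eqP: S0; apply/fsetP=> x; rewrite -[x \in S](mem_sort leq (enum_fset S)) E !inE.
Qed.

Lemma preceqE S1 S2 : S1 != fset0 -> S2 != fset0 -> preceq S1 S2 = (lo S1 <= hi S2).
Proof.
move=> n1 n2; apply/existsP/idP => [[x /existsP[y xy]]|le12].
  by apply: leq_trans (leq_trans (lo_le (valP x)) xy) (hi_ge (valP y)).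
by exists [` lo_in n1]%fset; apply/existsP; exists [` hi_in n2]%fset.
Qed.

Lemma precE S1 S2 : S1 != fset0 -> S2 != fset0 -> prec S1 S2 = (lo S1 < hi S2).
Proof.
move=> n1 n2; apply/existsP/idP => [[x /existsP[y xy]]|le12].
  by apply: leq_trans (leq_ltn_trans (lo_le (valP x)) xy) (hi_ge (valP y)).
by exists [` lo_in n1]%fset; apply/existsP; exists [` hi_in n2]%fset.
Qed.

Lemma lo_hi S : S != fset0 -> lo S <= hi S.
Proof. by move/lo_in/hi_ge. Qed.

Lemma lo_fset1 x : lo [fset x]%fset = x.
Proof. by have /lo_in : [fset x]%fset != fset0 :> {fset nat}; [apply/fset0Pn; exists x; rewrite inE | rewrite inE => /eqP]. Qed.

Lemma hi_fset1 x : hi [fset x]%fset = x.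
Proof. by have /hi_in : [fset x]%fset != fset0 :> {fset nat}; [apply/fset0Pn; exists x; rewrite inE | rewrite inE => /eqP]. Qed.

Lemma lo_hi_eq S T : S != fset0 -> lo S = T -> hi S = T -> S = [fset T]%fset.
Proof.
move=> S0 loS hiS; apply/fsetP=> x; rewrite inE; apply/idP/eqP => [xS|->].
  by have := lo_le xS; have := hi_ge xS; lia.
by rewrite -loS lo_in.
Qed.

Lemma card1_lo_hi S : #|` S| == 1 -> lo S = hi S.
Proof. by case/cardfs1P=> x ->; rewrite lo_fset1 hi_fset1. Qed.

End LabelBounds.

(** * Consecutive entries of cyclic sequences *)

Lemma nth_rot (T : Type) (x0 : T) (s : seq T) i j : i < size s -> j < size s ->
  nth x0 (rot i s) j = nth x0 s ((i + j) %% size s).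
Proof.
move=> lti ltj; rewrite /rot nth_cat size_drop nth_drop ltn_subRL.
case: ltnP => le1; first by rewrite modn_small.
rewrite nth_take; last by lia.
rewrite -(subnK le1) modnDr modn_small; last by lia.
by congr (nth _ _ _); lia.
Qed.

Lemma cycle_nth (T : Type) (e : rel T) x0 s i : cycle e s -> i < size s ->
  e (nth x0 s i) (nth x0 s (i.+1 %% size s)).
Proof.
move=> cy lti; have := cy; rewrite -(rot_cycle i).
have := @nth_rot _ x0 s i; move: (size_rot i s).
case: (rot i s) => [|a [|b t]] //= sz nr.
- by rewrite -sz ltn0 in lti.
- have i0 : i = 0 by lia.
  by move: (nr 0 lti); rewrite andbT -sz !modn1 i0 => <-.
have gt1 : 1 < size s by rewrite -sz.
have := nr 0 lti (ltnW gt1); have := nr 1 lti gt1; rewrite /= addn0 addn1 (modn_small lti).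
by move=> <- <- /andP[].
Qed.

(** * Directed triangles in almost transitive orientations *)

Definition swap {T : Type} (p : T * T) : T * T := (p.2, p.1).

Lemma swapK (T : Type) : involutive (@swap T).
Proof. by case. Qed.

Section Orientations.
Variables (V : finType) (G : mtgraph V).
Implicit Types (a b c d w : V) (p q : V * V) (O : {set V * V}).

Local Notation l a b := (lo (lab G a b)).
Local Notation h a b := (hi (lab G a b)).

Lemma lC a b : adj G a b -> l a b = l b a.
Proof. by move/lab_sym->. Qed.

Lemma hC a b : adj G a b -> h a b = h b a.
Proof. by move/lab_sym->. Qed.

Lemma lh a b : adj G a b -> l a b <= h a b.
Proof. by move/lab_neq0/lo_hi. Qed.

Lemma adj_neq a b : adj G a b -> a != b.
Proof. by apply: contraTneq => ->; rewrite adj_irr. Qed.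

Lemma adjC a b : adj G a b = adj G b a.
Proof. exact: adj_sym. Qed.

Lemma preceq_lab a b c d : adj G a b -> adj G c d ->
  preceq (lab G a b) (lab G c d) = (l a b <= h c d).
Proof. by move=> /lab_neq0 ? /lab_neq0 ?; rewrite preceqE. Qed.

Lemma prec_lab a b c d : adj G a b -> adj G c d ->
  prec (lab G a b) (lab G c d) = (l a b < h c d).
Proof. by move=> /lab_neq0 ? /lab_neq0 ?; rewrite precE. Qed.

(** A nonempty label set is the singleton of T exactly when both its extrema are T. Monolabel
    conditions thus become linear constraints. *)
Definition mono_edge a b T := [/\ adj G a b, l a b = T & h a b = T].

Lemma mono_triangleP a b c :
  reflect (exists T, [/\ mono_edge a b T, mono_edge b c T & mono_edge a c T])
          (mono_triangle G a b c).
Proof.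
apply: (iffP idP) => [/and5P[ab bc ac /eqP ebc /andP[/eqP eac /card1_lo_hi E]]|].
  by exists (l a b); rewrite /mono_edge ebc eac.
case=> T [[ab l1 h1] [bc l2 h2] [ac l3 h3]]; rewrite /mono_triangle ab bc ac.
rewrite (lo_hi_eq (lab_neq0 ab) l1 h1) (lo_hi_eq (lab_neq0 bc) l2 h2).
by rewrite (lo_hi_eq (lab_neq0 ac) l3 h3) cardfs1 !eqxx.
Qed.

(** The vertices a and c may coincide, and [imp_cond a b a] holds on every edge; distinctness is
    demanded separately where an arc of the digraph is meant. *)
Definition imp_cond a b c : bool :=
  [&& adj G a b, adj G b c, l a b <= h b c & ~~ adj G a c || (l a c < h b c)].

Definition corr_cond a b c d T : Prop :=
  [/\ mono_edge a b T, mono_edge b c T & mono_edge a c T] /\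
  [/\ adj G b d, l b d <= T, adj G c d, T < l c d & adj G a d -> l a d < T].

Lemma imp_condP a b c :
  [&& adj G a b, adj G b c, preceq (lab G a b) (lab G b c)
    & ~~ adj G a c || prec (lab G a c) (lab G b c)] = imp_cond a b c.
Proof.
rewrite /imp_cond; case ab: (adj G a b) => //; case bc: (adj G b c) => //=.
by rewrite preceq_lab //; case ac: (adj G a c); rewrite //= prec_lab.
Qed.

Lemma corr_condP a b c d : reflect (exists T, corr_cond a b c d T) (correlated G a b c d).
Proof.
apply: (iffP idP).
  case/and5P=> _ /mono_triangleP[T [ab bc ac]] bd bdT /and3P[cd cdT ad].
  have [ab1 l1 h1] := ab; exists T; do 2?split=> //.
  - by rewrite preceq_lab // h1 in bdT.
  - by rewrite preceq_lab // h1 -ltnNge in cdT.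
  by move=> ad1; move: ad; rewrite ad1 prec_lab // h1.
case=> T [[ab bc ac] [bd bdT cd cdT ad]].
have [ab1 l1 h1] := ab; have [bc1 l2 h2] := bc; have [ac1 l3 h3] := ac.
apply/and5P; split=> //.
- rewrite /= !inE !negb_or (adj_neq ab1) (adj_neq bc1) (adj_neq ac1) (adj_neq bd) (adj_neq cd).
  (* The other five pairs are adjacent. The vertices a and d differ because the minimum is T on ac
     and above T on cd. *)
  rewrite !andbT /=; apply/eqP=> ead; move: cdT; rewrite -ead -(lC ac1); lia.
- by apply/mono_triangleP; exists T.
- by rewrite preceq_lab // h1.
apply/and3P; split=> //; first by rewrite preceq_lab // h1 -ltnNge.
by apply/implyP=> ad1; rewrite prec_lab // h1 ad.
Qed.

(** Every arc of the digraph keeps one endpoint in its role, the head or the tail as the constructor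
    says. The last step of [triangle_not_necessary] and the layout of the successor table depend on
    this. *)
Inductive aug_spec : V * V -> V * V -> Prop :=
  | AugImpHead a b c of a != c & imp_cond a b c : aug_spec (a, b) (c, b)
  | AugImpTail a b c of a != c & imp_cond a b c : aug_spec (b, c) (b, a)
  | AugCorrHead a b c d T of corr_cond a b c d T : aug_spec (b, c) (a, c)
  | AugCorrTail a b c d T of corr_cond a b c d T : aug_spec (c, a) (c, b).

Lemma aug_arcP p q : reflect (aug_spec p q) (aug_arc G p q).
Proof.
apply: (iffP orP) => [[]|].
- case/existsP=> a /existsP[b /existsP[c /and5P[u ab bc le1 /andP[le2]]]].
  have ic : imp_cond a b c by rewrite -imp_condP; apply/and4P.
  have nac : a != c by move: u; rewrite /= !inE negb_or; case/and3P=> /andP[].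
  by case/orP=> /andP[/eqP-> /eqP->]; constructor.
- case/existsP=> a /existsP[b /existsP[c /existsP[d /andP[/corr_condP[T cr]]]]].
  by case/orP=> /andP[/eqP-> /eqP->]; econstructor; exact: cr.
case=> [a b c nac ic|a b c nac ic|a b c d T cr|a b c d T cr]; [left|left|right|right].
1,2: apply/existsP; exists a; apply/existsP; exists b; apply/existsP; exists c.
1,2: have := ic; rewrite -imp_condP => /and4P[ab bc -> ->].
1,2: by rewrite ab bc /= !inE negb_or (adj_neq ab) nac (adj_neq bc) !eqxx ?orbT.
all: apply/existsP; exists a; apply/existsP; exists b; apply/existsP; exists c.
all: apply/existsP; exists d; apply/andP; split; last by rewrite !eqxx ?orbT.
all: by apply/corr_condP; exists T.
Qed.

(** Skew symmetry, the contraposition rule of 2-satisfiability: reversal exchanges the head and tail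
    constructors. *)
Lemma aug_swap p q : aug_arc G p q -> aug_arc G (swap q) (swap p).
Proof.
move/aug_arcP=> H; apply/aug_arcP; case: H => [a b c nac ic|a b c nac ic|a b c d T cr|a b c d T cr].
- exact: AugImpTail nac ic.
- exact: AugImpHead nac ic.
- exact: AugCorrTail cr.
- exact: AugCorrHead cr.
Qed.

Lemma aug_AP p q : aug_arc G p q -> q \in AP G.
Proof.
move/aug_arcP; case=> [a b c _|a b c _|a b c d T|a b c d T]; rewrite inE /=.
- by case/and4P=> _ bc _ _; rewrite adjC.
- by case/and4P=> ab _ _ _; rewrite adjC.
- by case=> [[_ _ [ac _ _]] _].
by case=> [[_ [bc _ _] _] _]; rewrite adjC.
Qed.

Lemma forces_swap p q : forces G p q -> forces G (swap q) (swap p).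
Proof.
case/connectP=> s; elim: s p q => [|r s IHs] p q /=; first by move=> _ ->; exact: connect0.
case/andP=> pr rs e; apply: connect_trans (IHs _ _ rs e) _.
exact/connect1/aug_swap.
Qed.

Lemma forces_AP p q : p \in AP G -> forces G p q -> q \in AP G.
Proof.
move=> pA /connectP[s]; elim: s p pA q => [|r s IHs] p pA q /=; first by move=> _ ->.
by case/andP=> /aug_AP rA rs e; apply: IHs rs e.
Qed.

Lemma swap_AP p : (swap p \in AP G) = (p \in AP G).
Proof. by rewrite !inE adjC. Qed.

Definition force_closed O := forall p q, p \in O -> aug_arc G p q -> q \in O.
Definition consistent O := forall p, p \in O -> swap p \notin O.

Lemma closed_forces O p q : force_closed O -> p \in O -> forces G p q -> q \in O.
Proof.
move=> clO pO /connectP[s]; elim: s p pO q => [|r s IHs] p pO q /=; first by move=> _ ->.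
by case/andP=> /(clO _ _ pO) rO rs e; apply: IHs rs e.
Qed.

Lemma orientationP O :
  reflect [/\ O \subset AP G, consistent O & forall p, p \in AP G -> (p \in O) || (swap p \in O)]
          (orientation G O).
Proof.
apply: (iffP andP) => [[sO /forallP H]|[sO co tot]]; split=> //.
- case=> a b abO; have := subsetP sO _ abO; rewrite inE /= => ab.
  by have /forallP/(_ b) := H a; rewrite ab abO /=.
- case=> a b; rewrite inE /= => ab.
  by have /forallP/(_ b) := H a; rewrite ab /= /swap /=; case: (_ \in O).
apply/forallP=> a; apply/forallP=> b; apply/implyP=> ab.
have := tot (a, b); rewrite inE /= => /(_ ab).
have := co (a, b); rewrite /swap /=; case: ((a, b) \in O) => [/(_ isT)/negbTE->//|_ /=->//].
Qed.

Lemma amttoP O : reflect (orientation G O /\ force_closed O) (amtto G O).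
Proof.
apply: (iffP andP) => [[oO /eqP fO]|[oO cO]]; split=> //.
  move=> p q pO pq; rewrite -fO inE (aug_AP pq); apply/existsP; exists p.
  by rewrite pO; exact: connect1.
apply/eqP/setP=> q; have /andP[/subsetP sO _] := oO.
rewrite inE; apply/andP/idP => [[_ /existsP[p /andP[pO]]]|qO].
  exact: closed_forces cO pO.
by split; [exact: sO | apply/existsP; exists q; rewrite qO; exact: connect0].
Qed.

Definition in_triangle O p : bool := [exists w, ((p.2, w) \in O) && ((w, p.1) \in O)].

Definition off_triangles O : {set V * V} := [set p in O | ~~ in_triangle O p].

(** * Labels and directed triangles in a fixed almost transitive orientation *)

Section Amtto.
Variable O : {set V * V}.
Hypothesis amO : amtto G O.
Local Notation "a --> b" := ((a, b) \in O) (at level 40).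

Let clO : force_closed O. Proof. by have /amttoP[] := amO. Qed.
Let oriO : orientation G O. Proof. by have /amttoP[] := amO. Qed.

Lemma O_adj a b : a --> b -> adj G a b.
Proof. by have /orientationP[/subsetP sO _ _] := oriO; move/sO; rewrite inE. Qed.

Lemma O_anti a b : a --> b -> b --> a -> False.
Proof. by have /orientationP[_ co _] := oriO; move/co; rewrite /swap /= => /negP. Qed.

Lemma O_tot a b : adj G a b -> a --> b \/ b --> a.
Proof.
have /orientationP[_ _ tot] := oriO => ab; apply/orP.
by apply: (tot (a, b)); rewrite inE.
Qed.

(** Otherwise [imp_cond a b c] holds and a -> b forces c -> b. The orientation of ac is left open,
    and this is how directed triangles can occur. *)
Lemma O_trans a b c : a --> b -> b --> c -> l a b <= h b c -> adj G a c /\ h b c <= l a c.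
Proof.
move=> ab bc le1; apply/andP; apply: contraT => nac.
have nab : a != c by apply/eqP => E; apply: (O_anti ab); rewrite E.
have: (c, b) \in O.
  apply: (clO ab); apply/aug_arcP; constructor=> //.
  rewrite /imp_cond (O_adj ab) (O_adj bc) le1 /=.
  by move: nac; rewrite negb_and -ltnNge.
by move/(O_anti bc).
Qed.

(** Labels cannot decrease strictly all the way round, so one of the three premises of [O_trans]
    holds. Each conclusion then supplies the next premise, and the six extrema are squeezed
    together. *)
Lemma triangle_mono a b c : a --> b -> b --> c -> c --> a ->
  exists T, [/\ mono_edge a b T, mono_edge b c T & mono_edge a c T].
Proof.
move=> ab bc ca; exists (l a b).
have [Aab Abc Aca] := And3 (O_adj ab) (O_adj bc) (O_adj ca).
have := O_trans ab bc; have := O_trans bc ca; have := O_trans ca ab.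
rewrite /mono_edge -(lC Aca) -(hC Aca) (adjC a c) Aca Aab Abc (adjC c b) Abc (adjC b a) Aab.
rewrite -(lC Aab) -(lC Abc).
have := lh Aab; have := lh Abc; have := lh Aca; move=> H1 H2 H3 H4 H5 H6.
have : [/\ h a b = l a b, l b c = l a b, h b c = l a b, l c a = l a b & h c a = l a b].
  by split; lia.
by case=> -> -> -> -> ->.
Qed.

Lemma triangle_monoE a b c T : a --> b -> b --> c -> c --> a -> l a b = T ->
  [/\ mono_edge a b T, mono_edge b c T & mono_edge a c T].
Proof. by move=> ab bc /(triangle_mono ab bc)[T' [m1 ? ?]] <-; have [_ -> _] := m1. Qed.

Lemma O_corr a b c d T : corr_cond a b c d T -> b --> c -> c --> a -> False.
Proof.
move=> cr bc /O_anti; apply; apply: clO bc _.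
by apply/aug_arcP; apply: AugCorrHead cr.
Qed.

(** All label reasoning is linear arithmetic on [lo] and [hi]. For each edge of the context it needs
    only the symmetry of both extrema and their order; the inner match keeps the repetition from
    looping. *)
Ltac sym2 :=
  repeat match goal with
  | H : is_true (adj G ?a ?b) |- _ =>
    lazymatch goal with
    | _ : lo (lab G a b) = lo (lab G b a) |- _ => fail
    | _ : lo (lab G b a) = lo (lab G a b) |- _ => fail
    | _ => have ? := lC H; have ? := hC H; have ? := lh H
    end
  | H : mono_edge _ _ _ |- _ => case: H => ? ? ?
  end.

Ltac labels :=
  sym2;
  repeat match goal with
  | H : is_true (adj _ _ _) |- _ => clear H
  | H : is_true (in_mem _ _) |- _ => clear H
  | H : corr_cond _ _ _ _ _ |- _ => clear H
  | H : is_true (adj _ _ _) -> _ |- _ => clear H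
  | H : is_true (aug_arc _ _ _) |- _ => clear H
  | H : is_true (_ != _) |- _ => clear H
  | H : forall x, _ |- _ => clear H
  end; try clear amO; lia.

Section Correlated.
Variables (a b c d : V) (T : nat).
Hypothesis cr : corr_cond a b c d T.

(** Three directed paths through d or its neighbours are excluded: each would yield, by [O_trans],
    an edge whose labels contradict the position of the edges at d relative to T. *)
Let bcd : ~ (b --> c /\ c --> d).
Proof.
case: cr => [[mab mbc mac] [bd bdT cd cdT ad]] [bc cd'].
by have [] := O_trans bc cd'; labels.
Qed.

Let bdc : ~ (b --> d /\ d --> c).
Proof.
case: cr => [[mab mbc mac] [bd bdT cd cdT ad]] [bd' dc].
by have [] := O_trans bd' dc; labels.
Qed.

Let dba : ~ (d --> b /\ b --> a).
Proof.
case: cr => [[mab mbc mac] [bd bdT cd cdT ad]] [db ba].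
have [] := O_trans db ba; first by labels.
by rewrite adjC => ad1; have := ad ad1; labels.
Qed.

(** The excluded paths leave d -> c, d -> b and a -> b. If b -> w held, a, b, w would be another
    directed triangle of label T; then the edge dw either makes (a, b, w, d) correlated, against
    [O_corr], or contradicts [O_trans] or [triangle_mono]. *)
Lemma move_corr_head w : a --> c -> c --> w -> w --> a -> b --> c -> w --> b.
Proof.
move=> ac cw wa bc.
have [[mab mbc mac] [bd bdT cd cdT ad]] := cr.
have [_ mcw maw] : [/\ mono_edge a c T, mono_edge c w T & mono_edge a w T].
  by apply: triangle_monoE => //; case: mac.
have ab1 : adj G a b by case: mab.
have dc : d --> c by case: (O_tot cd) => // cd'; case: bcd.
have db : d --> b by case: (O_tot bd) => // bd'; case: bdc.
have ab : a --> b by case: (O_tot ab1) => // ba; case: dba.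
have [|wb1 wbT] := O_trans wa ab; first by labels.
case: (O_tot wb1) => // bw; exfalso.
have [_ mbw _] : [/\ mono_edge a b T, mono_edge b w T & mono_edge a w T].
  by apply: triangle_monoE => //; case: mab.
have [|dw1 dwT] := O_trans db bw; first by labels.
have [gt|le] := ltnP T (l d w).
  apply: (@O_corr a b w d T) => //; split; split=> //; rewrite 1?adjC //; labels.
case: (O_tot dw1) => [dw|wd].
  have [] := O_trans dw wa; first by labels.
  by rewrite adjC => ad1; have := ad ad1; labels.
by have [T' [? ? ?]] := triangle_mono dc cw wd; labels.
Qed.

(** Assume w -> a. With b -> a, both b and c point to d, and neither orientation of wd agrees with
    its labels. With a -> b, the vertices a, b, w form a directed triangle of label T; it is
    correlated through d if wd lies above T, and [O_trans] excludes the remaining labels. *)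
Lemma move_corr_tail w : c --> b -> b --> w -> w --> c -> c --> a -> a --> w.
Proof.
move=> cb bw wc ca.
have [[mab mbc mac] [bd bdT cd cdT ad]] := cr.
have [_ mbw mcw] : [/\ mono_edge c b T, mono_edge b w T & mono_edge c w T].
  by apply: triangle_monoE => //; labels.
have ab1 : adj G a b by case: mab.
have [|wa1 waT] := O_trans wc ca; first by labels.
case: (O_tot wa1) => // wa; exfalso.
case: (O_tot ab1) => [ab|ba]; last first.
  have bd' : b --> d by case: (O_tot bd) => // db; case: dba.
  have cd' : c --> d by case: (O_tot cd) => // dc; case: bdc.
  have [|wd1 wdT] := O_trans wc cd'; first by labels.
  case: (O_tot wd1) => [wd|dw].
    by have [] := O_trans bw wd; labels.
  by have [T' [? ? ?]] := triangle_mono dw wc cd'; labels.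
have [_ _ maw] : [/\ mono_edge a b T, mono_edge b w T & mono_edge a w T].
  by apply: triangle_monoE => //; case: mab.
have noup : adj G w d -> T < l w d -> False.
  move=> wd wdT; apply: (@O_corr a b w d T) => //.
case: (O_tot cd) => [cd'|dc].
  by have [|wd1 wdT] := O_trans wc cd'; [labels | apply: noup => //; labels].
have db : d --> b by case: (O_tot bd) => // bd'; case: bdc.
have [|dw1 dwT] := O_trans db bw; first by labels.
have wd1 : adj G w d by rewrite adjC.
have [gt|le] := ltnP T (l w d); first exact: noup.
case: (O_tot dw1) => [dw|wd].
  have [] := O_trans dw wa; first by labels.
  by rewrite adjC => ad1; have := ad ad1; labels.
by have [] := O_trans wd dc; labels.
Qed.

End Correlated.

(** If a -> w held, its labels would be at least T. If they all exceed T, then (c, b, w, a) is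
    correlated and [O_corr] applies; if the minimum is T, the path a -> w -> c yields an edge ac
    with minimum at least T, against [imp_cond]. *)
Lemma move_imp_head a b c w : imp_cond a b c ->
  c --> b -> b --> w -> w --> c -> a --> b -> w --> a.
Proof.
case/and4P=> ab1 bc1 le1 le2 cb bw wc ab.
have [T [mcb mbw mcw]] := triangle_mono cb bw wc.
have [|aw1 awT] := O_trans ab bw; first by labels.
case: (O_tot aw1) => // aw; exfalso.
have nac : adj G a c -> l a c < T by move=> ac; move: le2; rewrite ac /=; labels.
have [gt|le] := ltnP T (l a w).
  apply: (@O_corr c b w a T) => //; split; split=> //; rewrite 1?adjC //; try by labels.
  by move=> ac; have := nac ac; labels.
have [|ac1] := O_trans aw wc; first by labels.
by have := nac ac1; labels.
Qed.

Lemma move_imp_tail a b c w : imp_cond a b c ->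
  b --> a -> a --> w -> w --> b -> b --> c -> c --> w.
Proof.
case/and4P=> ab1 bc1 le1 le2 ba aw wb bc.
have [T [mba maw mbw]] := triangle_mono ba aw wb.
have [|wc1 wcT] := O_trans wb bc; first by labels.
case: (O_tot wc1) => // wc; exfalso.
have [|ac1] := O_trans aw wc; first by labels.
by move: le2; rewrite ac1 /=; labels.
Qed.

(* A directed triangle can be pulled back along an arc of the augmented digraph, with the same third vertex. *)
Lemma move p q w : aug_arc G p q -> p \in O ->
  q \in O -> (q.2, w) \in O -> (w, q.1) \in O -> (p.2, w) \in O /\ (w, p.1) \in O.
Proof.
case/aug_arcP=> [a b c _ ic|a b c _ ic|a b c d T cr|a b c d T cr] /= pO qO qw wq; split=> //.
- exact: move_imp_head ic qO qw wq pO.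
- exact: move_imp_tail ic qO qw wq pO.
- exact: move_corr_head cr w qO qw wq pO.
- exact: move_corr_tail cr w qO qw wq pO.
Qed.

Lemma move_forces p q w : forces G p q -> p \in O ->
  (q.2, w) \in O -> (w, q.1) \in O -> (p.2, w) \in O /\ (w, p.1) \in O.
Proof.
case/connectP=> s; elim: s p => [|r s IHs] p /=; first by move=> _ -> _.
case/andP=> pr rs e pO qw wq; have rO := clO pO pr.
by have [] := IHs r rs e rO qw wq; exact: move pr pO rO.
Qed.

(* A path from [swap p] to [p] enters [O] along some arc [r -> r'].  The mirrored
   path gives [swap r] the same third vertex [w] as [r'], but [swap r] and [r']
   share an endpoint in opposite roles. *)
Lemma triangle_not_necessary p : p \in O -> in_triangle O p -> ~ forces G (swap p) p.
Proof.
move=> pO /existsP[w /andP[pw wp]].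
have base q : forces G (swap p) q -> q \notin O \/ ~ forces G q p.
  case/connectP=> s; elim/last_ind: s q => [|s r IHs] q.
    by move=> _ ->; left; have /orientationP[_ co _] := oriO; exact: co.
  rewrite rcons_path last_rcons => /andP[ps ar] {q}->.
  set r0 := last _ s in ar; have := IHs r0 ps erefl.
  case rO: (r \in O); last by left.
  case r0O: (r0 \in O) => /= IH; right => rp.
    by case: IH => // no; apply: no; apply: connect_trans rp; exact: connect1.
  have r0A : r0 \in AP G.
    apply: (@forces_AP (swap p)); last by apply/connectP; exists s.
    by rewrite swap_AP; have /orientationP[/subsetP sO _ _] := oriO; exact: sO.
  have r0s : swap r0 \in O by have /orientationP[_ _ /(_ _ r0A)] := oriO; rewrite r0O.
  have r0p : forces G (swap r0) p.
    by rewrite -[p]swapK; apply: forces_swap; apply/connectP; exists s.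
  have [rw wr] := move_forces rp rO pw wp.
  have [rw0 wr0] := move_forces r0p r0s pw wp.
  rewrite /= in rw0 wr0.
  have: r0.2 = r.2 \/ r0.1 = r.1 by case/aug_arcP: ar => *; [left|right|left|right].
  by case=> E; [rewrite -E in rw; exact: O_anti rw wr0|rewrite -E in wr; exact: O_anti wr rw0].
by move=> f; have [] := base p f => [|[]]; [rewrite pO | exact: connect0].
Qed.

Lemma mtto_amtto_triangle_free : (forall p, p \in O -> ~~ in_triangle O p) -> mtto G O.
Proof.
move=> nt; apply/andP; split=> //.
apply/forallP=> a; apply/forallP=> b; apply/forallP=> c; apply/implyP=> /and3P[ab bc].
rewrite (preceq_lab (O_adj ab) (O_adj bc)) => le1; have [ac leac] := O_trans ab bc le1.
rewrite (prec_lab ac (O_adj bc)) -leqNgt leac andbT; case: (O_tot ac) => // ca.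
by have /negP[] := nt _ ab; apply/existsP; exists c; rewrite bc ca.
Qed.

(** Suppose ac lies on a directed triangle of label T with third vertex w. A label below T on ab
    would make (b, c) force (a, c), and [move] would put bc on a triangle. So ab lies at or above T,
    hence w and b are adjacent, and either orientation of wb puts ab or bc on a directed
    triangle. *)
Lemma off_triangles_shortcut a b c :
  (a, b) \in off_triangles O -> (b, c) \in off_triangles O -> l a b <= h b c ->
  (a, c) \in off_triangles O.
Proof.
rewrite !inE => /andP[ab /existsPn nab] /andP[bc /existsPn nbc] le1.
have [ac1 acT] := O_trans ab bc le1.
have ac : a --> c.
  by case: (O_tot ac1) => // ca; have := nab c; rewrite /= bc ca.
rewrite ac /=; apply/existsPn => w /=; apply/negP => /andP[cw wa].
have [T [mac mcw maw]] := triangle_mono ac cw wa.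
have [Aab Abc Aac] := And3 (O_adj ab) (O_adj bc) (O_adj ac).
have nabE : a != b by exact: adj_neq.
have nbcE : b != c by exact: adj_neq.
have lab1 : T <= l a b.
  rewrite leqNgt; apply/negP => lt.
  have ar : aug_arc G (b, c) (a, c).
    apply/aug_arcP; constructor; first by rewrite eq_sym.
    by rewrite /imp_cond Abc (adjC c a) Aac (adjC b a) Aab /=; apply/andP; split; labels.
  by have /= [cw' wb] := move ar bc ac cw wa; have := nbc w; rewrite cw' wb.
have lbc1 : h a b <= l b c.
  rewrite leqNgt; apply/negP => lt.
  have ar : aug_arc G (a, b) (a, c).
    apply/aug_arcP; constructor; first by rewrite eq_sym.
    by rewrite /imp_cond Aab (adjC c a) Aac (adjC c b) Abc /=; apply/andP; split; labels.
  by have /= [bw wa'] := move ar ab ac cw wa; have := nab w; rewrite bw wa'.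
have [|wb1 wbT] := O_trans wa ab; first by labels.
case: (O_tot wb1) => [wb|bw].
  by have := nbc w; rewrite /= cw wb.
by have := nab w; rewrite /= bw wa.
Qed.

(** The induction is on closed walks, which rotations and shortcuts preserve. Two consecutive arcs
    with compatible labels allow a shortcut; if there are none, the minimum label drops at every
    step of a full turn and ends below itself. *)
Lemma off_triangles_acyclic : acyclic (off_triangles O).
Proof.
move=> s; rewrite /ucycle => /andP[+ _]; set D := off_triangles O.
set e := fun u v => _.
have eO u v : e u v -> u --> v by rewrite /e inE => /andP[].
elim: {s}(size s) {-2}s (leqnn (size s)) => [|k IHk] [|x0 s0] // sz cy; exfalso.
move: cy sz; set s := x0 :: s0 => cy sz.
pose g i := nth x0 s (i %% size s).
have eg i : e (g i) (g i.+1).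
  have lt : i %% size s < size s by rewrite ltn_mod.
  by have := cycle_nth x0 cy lt; rewrite -[(i %% _).+1]addn1 modnDml addn1.
have [/hasP[i]|/hasPn no] :=
  boolP (has (fun i => l (g i) (g i.+1) <= h (g i.+1) (g i.+2)) (iota 0 (size s))).
  rewrite mem_iota add0n => /andP[_ lti] le1.
  have : cycle e (rot i s) by rewrite rot_cycle.
  have := @nth_rot _ x0 s i; move: (size_rot i s).
  case: (rot i s) => [|a [|b [|c t]]] //= szr nr.
  - by rewrite andbT => /eO/O_adj; rewrite adj_irr.
  - by rewrite andbT => /andP[/eO ab /eO /(O_anti ab)].
  case/and3P=> ab bc ct.
  have ac : (a, c) \in D.
    apply: off_triangles_shortcut ab bc _.
    have gt2 : 2 < size s by rewrite /s /= -szr.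
    have := nr 2 lti gt2; have := nr 1 lti (ltnW gt2); have := nr 0 lti (ltnW (ltnW gt2)).
    by rewrite /= addn0 addn1 addn2 => -> -> ->.
  have eac : e a c := ac.
  suff : [:: a, c & t] = [::] by [].
  by apply: IHk; [move: sz; rewrite /= -szr; lia | rewrite /= eac].
have dec i : i < size s -> l (g i.+1) (g i.+2) < l (g i) (g i.+1).
  move=> lti; have := no i; rewrite mem_iota add0n lti -ltnNge => /(_ isT).
  by apply: leq_ltn_trans; exact/lh/O_adj/eO.
have sum i : i <= size s -> l (g i) (g i.+1) + i <= l (g 0) (g 1).
  by elim: i => [|i IHi] lti; [rewrite addn0 | have := dec i lti; have := IHi (ltnW lti); lia].
have := sum _ (leqnn _).
have -> : g (size s) = g 0 by rewrite /g modnn mod0n.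
have -> : g (size s).+1 = g 1 by rewrite /g -addn1 modnDl.
by rewrite /=; lia.
Qed.

End Amtto.
End Orientations.

(** * Greedy closures *)

Lemma cat_eq_cons (T : eqType) (A B L1 L2 : seq T) p : A ++ B = L1 ++ p :: L2 ->
  p \in A \/ exists2 L, L1 = A ++ L & B = L ++ p :: L2.
Proof.
elim: A L1 => [|a A IHA] [|b L1] /=; [by right; exists [::]|by right; exists (b :: L1)| |].
  by case=> -> _; left; rewrite mem_head.
case=> <- /IHA[pA|[L -> ->]]; first by left; rewrite inE pA orbT.
by right; exists L.
Qed.

(** * Sources and linear extensions of acyclic digraphs *)

Section Acyclic.
Variables (V : finType) (D : {set V * V}).
Hypothesis acD : acyclic D.
Local Notation e := (fun u v => (u, v) \in D).

Lemma acyclic_connect u v : connect e v u -> e u v -> False.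
Proof.
case/connectP=> p ep up; case/shortenP: ep up => q ep uq _ -> elv.
by have := acD (s := v :: q); rewrite /ucycle /cycle rcons_path ep elv uq => /(_ isT).
Qed.

(** Take a vertex with the fewest ancestors in U. A predecessor u in U would have the same ancestors
    by minimality, so v would be an ancestor of u, closing a cycle. *)
Lemma acyclic_source (U : {set V}) x : x \in U ->
  exists2 v, v \in U & forall u, u \in U -> (u, v) \notin D.
Proof.
move=> xU; pose P v := [set u in U | connect e u v].
have [v vU vmin] := @arg_minnP _ x (mem U) (fun v => #|P v|) xU.
exists v => // u uU; apply/negP => uv.
have sub : P u \subset P v.
  apply/subsetP=> z; rewrite !inE => /andP[-> zu] /=.
  exact: connect_trans zu (connect1 uv).
have /eqP E : P u == P v by rewrite eqEcard sub vmin.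
have: v \in P v by rewrite inE [v \in U]vU connect0.
by rewrite -E inE => /andP[_ /acyclic_connect]; apply.
Qed.

(** Such a list is closed under predecessors but may omit vertices. It therefore also describes a
    sort in progress, and a finished one without the isolated vertices. *)
Definition linear_extension (vs : seq V) : Prop :=
  forall vs1 v vs2, vs = vs1 ++ v :: vs2 -> forall u, (u, v) \in D -> u \in vs1.

Lemma linear_extension_nil : linear_extension [::].
Proof. by case. Qed.

Lemma linear_extension_rcons vs v : linear_extension vs ->
  (forall u, (u, v) \in D -> u \in vs) -> linear_extension (rcons vs v).
Proof.
move=> le_vs Dv vs1 x; case/lastP=> [|vs2 y].
  by rewrite cats1 => /rcons_inj[<- <-].
by rewrite -rcons_cons -rcons_cat => /rcons_inj[/le_vs].
Qed.

Lemma linear_extension_exists : exists2 vs, linear_extension vs & forall v, v \in vs.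
Proof.
suff ex k vs : linear_extension vs -> #|[set v | v \notin vs]| <= k ->
    exists2 vs, linear_extension vs & forall v, v \in vs.
  exact: ex linear_extension_nil (leqnn _).
elim: k vs => [|k IHk] vs le_vs.
  rewrite leqn0 cards_eq0 => /eqP E; exists vs => // v.
  by have /setP/(_ v) := E; rewrite !inE => /negbFE.
move=> card_k; have [E|[x xU]] := set_0Vmem [set v | v \notin vs].
  by apply: (IHk vs); rewrite // E cards0.
have [v vU vmin] := acyclic_source xU; apply: (IHk (rcons vs v)).
  apply: linear_extension_rcons => // u uv; apply: contraTT isT => nu.
  by have := vmin u; rewrite inE nu uv => /(_ isT).
apply: (@leq_trans #|[set v | v \notin vs] :\ v|).
  apply/subset_leq_card/subsetP => u; rewrite !inE mem_rcons inE negb_or.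
  by case/andP=> -> ->.
by rewrite (cardsD1 v) vU in card_k.
Qed.

End Acyclic.

Section Greedy.
Variables (V : finType) (G : mtgraph V).
Implicit Types (p q : V * V) (O : {set V * V}) (L : seq (V * V)).

(* With [chk := swap] this is a greedy assignment of the implication digraph;
   with [chk := id] it is the set of everything forced by [L]. *)
Section Check.
Variable chk : V * V -> V * V.

Definition grow O p : {set V * V} :=
  if (p \in O) || (chk p \in O) then O else O :|: [set q | forces G p q].

Definition greedy L : {set V * V} := foldl grow set0 L.

Lemma greedy_rcons L p : greedy (rcons L p) = grow (greedy L) p.
Proof. by rewrite /greedy foldl_rcons. Qed.

Lemma grow_closed O p : force_closed G O -> force_closed G (grow O p).
Proof.
move=> clO; rewrite /grow; case: ifP => // _ q r; rewrite !inE => /orP[qO|pq] qr.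
  by rewrite (clO q r qO qr).
by rewrite /forces (connect_trans pq (connect1 qr)) orbT.
Qed.

Lemma greedy_closed L : force_closed G (greedy L).
Proof.
elim/last_ind: L => [|L p IHL]; first by move=> p q; rewrite inE.
by rewrite greedy_rcons; exact: grow_closed.
Qed.

Lemma greedy_sub L : {subset L <= AP G} -> {subset greedy L <= AP G}.
Proof.
elim/last_ind: L => [|L p IHL] sL q; first by rewrite inE.
have sL' : {subset L <= AP G} by move=> x xL; apply: sL; rewrite mem_rcons inE xL orbT.
rewrite greedy_rcons /grow; case: ifP => _; first exact: IHL.
rewrite inE => /orP[/(IHL sL')//|]; rewrite inE; apply: forces_AP.
by apply: sL; rewrite mem_rcons mem_head.
Qed.

Lemma grow_sub O p : {subset O <= grow O p}.
Proof. by move=> q qO; rewrite /grow; case: ifP; rewrite // inE qO. Qed.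

Lemma greedy_mono L1 L2 : {subset greedy L1 <= greedy (L1 ++ L2)}.
Proof.
elim/last_ind: L2 => [|L2 p IHL] q qL; first by rewrite cats0.
by rewrite -rcons_cat greedy_rcons; apply/grow_sub/IHL.
Qed.

Lemma grow_cover O p : (p \in grow O p) || (chk p \in grow O p).
Proof. by rewrite /grow; case: ifP; rewrite // !inE /forces connect0 orbT. Qed.

Lemma greedy_cover L p : p \in L -> (p \in greedy L) || (chk p \in greedy L).
Proof.
case/splitPr=> L1 L2; rewrite -cat_rcons.
have := grow_cover (greedy L1) p; rewrite -greedy_rcons.
by case/orP=> /(@greedy_mono _ L2)->; rewrite ?orbT.
Qed.

(** The origin p has to lie in the result as well, since [move_forces] pulls triangles back only to
    chosen arcs. *)
Lemma greedy_origin L q : q \in greedy L ->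
  exists p, [/\ p \in L, p \in greedy L & forces G p q].
Proof.
elim/last_ind: L => [|L p IHL]; first by rewrite inE.
rewrite greedy_rcons => qL.
have [/IHL[r [rL rO rq]]|qO] := boolP (q \in greedy L).
  by exists r; rewrite mem_rcons inE rL orbT grow_sub.
exists p; rewrite mem_rcons mem_head; move: qL; rewrite /grow.
case: ifP => _; first by rewrite (negbTE qO).
by rewrite !inE (negbTE qO) /= /forces connect0 orbT.
Qed.

End Check.

(** By skew symmetry, a clash between O and a new arc would put [swap p] in O, and a clash between
    two new arcs would make p force [swap p]. *)
Lemma closed_consistentU O p : force_closed G O -> consistent O -> ~ forces G p (swap p) ->
  swap p \notin O -> consistent (O :|: [set q | forces G p q]).
Proof.
move=> clO coO npp npO q; rewrite !inE => /orP[qO|pq].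
  apply/norP; split; first exact: coO.
  apply/negP => /forces_swap; rewrite swapK => qp.
  by rewrite (closed_forces clO qO qp) in npO.
have qp : forces G (swap q) (swap p) by exact: forces_swap.
apply/norP; split; apply/negP => H.
  by rewrite (closed_forces clO H qp) in npO.
exact: npp (connect_trans H qp).
Qed.

(** Only the arcs that are really selected are constrained: a self-contradictory arc does no harm
    once it or its reverse has been decided. *)
Definition conflict_free L := forall L1 p L2, L = L1 ++ p :: L2 ->
  p \notin greedy swap L1 -> swap p \notin greedy swap L1 -> ~ forces G p (swap p).

Lemma greedy_consistent L : conflict_free L -> consistent (greedy swap L).
Proof.
elim/last_ind: L => [|L p IHL] cf; first by move=> p; rewrite inE.
have coL : consistent (greedy swap L).
  apply: IHL => L1 q L2 E; apply: (cf L1 q (rcons L2 p)).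
  by rewrite E rcons_cat rcons_cons.
rewrite greedy_rcons /grow; case: ifPn => // /norP[np nsp].
apply: closed_consistentU => //; first exact: greedy_closed.
by apply: (cf L p [::]); rewrite // cats1.
Qed.

Lemma consistent_amtto L : L =i AP G -> consistent (greedy swap L) -> amtto G (greedy swap L).
Proof.
move=> LA co; apply/amttoP; split; last exact: greedy_closed.
apply/orientationP; split=> //.
  by apply/subsetP; apply: greedy_sub => p; rewrite LA.
by move=> p; rewrite -LA; exact: greedy_cover.
Qed.

Lemma greedy_amtto L : L =i AP G -> conflict_free L -> amtto G (greedy swap L).
Proof. by move=> LA cf; apply: consistent_amtto => //; exact: greedy_consistent. Qed.

Lemma amtto_no_mutual_forcing O p : amtto G O -> p \in AP G ->
  forces G p (swap p) -> forces G (swap p) p -> False.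
Proof.
case/amttoP=> /orientationP[_ co tot] clO /tot/orP[] pO f1 f2.
  by have := co _ pO; rewrite (closed_forces clO pO f1).
by have := co _ pO; rewrite swapK (closed_forces clO pO f2).
Qed.

(** The necessary arcs are offered before all others. If a selected p forces [swap p], then [swap p]
    is necessary: either p is necessary too and the two form a directed 2-cycle, or [swap p] was
    offered before p. *)
Lemma Ness_acyclic_amtto : acyclic (Ness G) -> exists O, amtto G O.
Proof.
move=> acN; exists (greedy swap (enum (Ness G) ++ enum (AP G))); apply: greedy_amtto.
  by move=> p; rewrite mem_cat !mem_enum; apply/orP/idP => [[/setIdP[]|]|]; last right.
move=> L1 p L2 E np nsp f.
have pA : p \in AP G.
  have: p \in enum (Ness G) ++ enum (AP G) by rewrite E mem_cat mem_head orbT.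
  by rewrite mem_cat !mem_enum => /orP[/setIdP[]|].
have spN : swap p \in Ness G by apply/setIdP; rewrite swap_AP /necessary -/(swap _) swapK.
have [pN|[L L1E _]] := cat_eq_cons E.
  rewrite mem_enum in pN; case: p pN spN pA {E np nsp f} => x y pN spN; rewrite inE => xy.
  have := acN [:: x; y]; rewrite /ucycle /= pN spN inE (adj_neq xy) /=.
  by move/(_ isT).
have : swap p \in L1 by rewrite L1E mem_cat mem_enum spN.
by move/(greedy_cover swap); rewrite swapK (negbTE np) (negbTE nsp).
Qed.

Lemma amtto_Ness_acyclic O : amtto G O -> acyclic (Ness G).
Proof.
move=> amO s cy; apply: (off_triangles_acyclic amO).
move: cy; rewrite /ucycle => /andP[cy ->]; rewrite andbT.
apply: sub_cycle cy => u v /setIdP[uvA uvN]; rewrite inE.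
have /amttoP[/orientationP[_ co tot] clO] := amO.
have uvO : (u, v) \in O.
  by have /orP[//|vuO] := tot _ uvA; exact: closed_forces clO vuO uvN.
by rewrite uvO /=; apply/negP => /(triangle_not_necessary amO uvO); apply.
Qed.

(* If [p] forces [swap p], then [swap p] does not force [p], so some arc of the
   strong component of [p] comes after [swap p] in [F] and is treated before [p]. *)
Lemma postorder_conflict_free O (F : seq (V * V)) : amtto G O -> F =i AP G ->
  (forall F1 v F2, F = F1 ++ v :: F2 -> forall u, u \in AP G -> forces G u v ->
     forces G v u \/ exists2 u', u' \in F2 & forces G u u' /\ forces G u' u) ->
  conflict_free [seq swap p | p <- rev F].
Proof.
move=> amO FA post L1 p L2 E np nsp f.
have EF : F = rev [seq swap q | q <- L2] ++ swap p :: rev [seq swap q | q <- L1].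
  rewrite -[F]revK -[rev F](mapK (@swapK V)) E !map_cat /= rev_cat rev_cons.
  by rewrite cat_rcons.
have pA : p \in AP G by rewrite -swap_AP -FA EF mem_cat mem_head orbT.
have [fsp|[u' u'L [pu' u'p]]] := post _ _ _ EF p pA f.
  exact: amtto_no_mutual_forcing amO pA f fsp.
have : swap u' \in L1.
  by move: u'L; rewrite mem_rev => /mapP[q qL ->]; rewrite swapK.
move/(greedy_cover swap); rewrite swapK => /orP[] uO.
  by rewrite (closed_forces (@greedy_closed swap L1) uO (forces_swap pu')) in nsp.
by rewrite (closed_forces (@greedy_closed swap L1) uO u'p) in np.
Qed.

(** * Greedy choice by tails along a linear extension *)

Definition by_tail (A : seq (V * V)) (vs : seq V) : seq (V * V) :=
  flatten [seq [seq p <- A | p.1 == v] | v <- vs].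

Section ByTail.
Variable A : seq (V * V).
Hypothesis AA : A =i AP G.

Lemma mem_by_tail vs p : (p \in by_tail A vs) = (p \in AP G) && (p.1 \in vs).
Proof.
apply/flatten_mapP/andP => [[v vV]|[pA pV]].
  by rewrite mem_filter AA => /andP[/eqP-> ->].
by exists p.1; rewrite // mem_filter eqxx AA.
Qed.

Lemma by_tail_cat vs1 vs2 : by_tail A (vs1 ++ vs2) = by_tail A vs1 ++ by_tail A vs2.
Proof. by rewrite /by_tail map_cat flatten_cat. Qed.

Lemma by_tail_split vs L1 p L2 : by_tail A vs = L1 ++ p :: L2 ->
  exists vs1 vs2, vs = vs1 ++ p.1 :: vs2 /\ {subset by_tail A vs1 <= L1}.
Proof.
elim: vs L1 => [|v vs IHvs] L1; first by case: L1.
rewrite -cat1s by_tail_cat => /cat_eq_cons[|[L -> /IHvs[vs1 [vs2 [-> sub]]]]].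
  by rewrite mem_by_tail mem_seq1 => /andP[_ /eqP->]; exists [::], vs.
exists (v :: vs1), vs2; split=> // q; rewrite -cat1s by_tail_cat !mem_cat.
by case/orP=> [->//|/sub->]; rewrite orbT.
Qed.

Variable O : {set V * V}.
Hypothesis amO : amtto G O.
Variable vs : seq V.
Hypothesis le_vs : linear_extension (off_triangles O) vs.
Hypothesis vsA : forall p, p \in AP G -> p.1 \in vs.

(** If p forces [swap p], then [swap p] is in O and, by [triangle_not_necessary], on no directed
    triangle. So the head of p precedes its tail in [vs], and [swap p] was offered first. *)
Lemma by_tail_amtto : amtto G (greedy swap (by_tail A vs)).
Proof.
have /amttoP[/orientationP[_ co tot] clO] := amO.
apply: greedy_amtto => [p|L1 p L2 E np nsp f].
  by rewrite mem_by_tail; case pA: (p \in AP G) => //=; exact: vsA.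
have pA : p \in AP G.
  by have : p \in by_tail A vs; [rewrite E mem_cat mem_head orbT|rewrite mem_by_tail => /andP[]].
have [vs1 [vs2 [vsE sub]]] := by_tail_split E.
have /orP[pO|spO] := tot p pA.
  by have /negP[] := co p pO; exact: closed_forces clO pO f.
have [spT|spD] := boolP (in_triangle O (swap p)).
  by apply: (triangle_not_necessary amO spO spT); rewrite swapK.
have : swap p \in L1.
  apply: sub; rewrite mem_by_tail swap_AP pA /=; apply: le_vs vsE _ _.
  by rewrite inE spO.
by move/(greedy_cover swap); rewrite swapK (negbTE np) (negbTE nsp).
Qed.

(* A directed triangle at [x] is pulled back to one at a vertex preceding [x]. *)
Lemma by_tail_mtto : mtto G (greedy swap (by_tail A vs)).
Proof.
have am := by_tail_amtto; apply: mtto_amtto_triangle_free => //.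
set R := greedy swap _ in am *.
have /amttoP[/orientationP[/subsetP sR co tot] clR] := am.
suff no k x y z : index x vs <= k -> (x, y) \in R -> (y, z) \in R -> (z, x) \in R -> False.
  by case=> x y xyR; apply/existsPn=> z; apply/andP => -[/= yz zx]; exact: no (leqnn _) xyR yz zx.
elim/ltn_ind: k x y z => k IHk x y z xk xy yz zx.
have xA : (x, y) \in AP G by exact: sR.
have zxA : (z, x) \in AP G by exact: sR.
have xV : x \in vs := vsA xA.
have vsE : vs = rcons (take (index x vs) vs) x ++ drop (index x vs).+1 vs.
  by rewrite cat_rcons -[LHS](cat_take_drop (index x vs)) (drop_nth x) ?index_mem // nth_index.
(* Once the tails up to x are treated, (x, z) has been offered, so (z, x) is already chosen. The
   listed arc that forces it has a tail no later than x. *)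
set vs1 := rcons _ x in vsE; have zxR1 : (z, x) \in greedy swap (by_tail A vs1).
  have: (x, z) \in by_tail A vs1 by rewrite mem_by_tail -swap_AP zxA mem_rcons mem_head.
  case/(greedy_cover swap)/orP=> // xzR; have := co _ zx; rewrite /R vsE by_tail_cat.
  by rewrite /swap /= (greedy_mono _ xzR).
have [[x' y'] [p'L p'R p'zx]] := greedy_origin zxR1.
have p'R2 : (x', y') \in R by rewrite /R vsE by_tail_cat greedy_mono.
(* The triangle through (z, x) with third vertex y moves to (x', y'). If x' were x, the edge xy
   would be oriented both ways. *)
have /= [y'y yx'] := move_forces am p'zx p'R2 xy yz.
move: p'L; rewrite mem_by_tail mem_rcons inE /= => /andP[_ /orP[/eqP E|x'vs]].
  by have := co _ xy; rewrite /swap /= -E yx'.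
by apply: (IHk (index x' vs) _ x' y' y) => //; apply: leq_trans xk; exact: index_ltn.
Qed.

End ByTail.

Lemma amtto_mtto O : amtto G O -> exists O', mtto G O'.
Proof.
move=> amO; have [vs le_vs vsV] := linear_extension_exists (off_triangles_acyclic amO).
exists (greedy swap (by_tail (enum (AP G)) vs)); apply: (by_tail_mtto _ amO le_vs) => // p.
by rewrite mem_enum.
Qed.

(** Here transitivity also settles the orientation of ac. In a correlated triangle, b -> c -> a
    would give b -> a, hence b -> d and c -> d, and then b -> c -> d has incompatible labels. *)
Lemma mtto_amtto O : mtto G O -> amtto G O.
Proof.
case/andP=> oO /forallP tr; have /orientationP[/subsetP sO co tot] := oO.
have adjO a b : (a, b) \in O -> adj G a b by move/sO; rewrite inE.
have anti a b : (a, b) \in O -> (b, a) \in O -> False by move/co/negP.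
have trans a b c : (a, b) \in O -> (b, c) \in O -> lo (lab G a b) <= hi (lab G b c) ->
    (a, c) \in O /\ hi (lab G b c) <= lo (lab G a c).
  move=> ab bc le1; have /forallP/(_ b)/forallP/(_ c) := tr a.
  rewrite ab bc (preceq_lab (adjO _ _ ab) (adjO _ _ bc)) le1 /= => /andP[ac].
  by rewrite (prec_lab (adjO _ _ ac) (adjO _ _ bc)) -leqNgt.
have totE a b : adj G a b -> ((b, a) \in O -> False) -> (a, b) \in O.
  by move=> ab nba; have := tot (a, b); rewrite inE => /(_ ab)/orP[|/nba].
have imp a b c : imp_cond G a b c -> (a, b) \in O -> (b, c) \in O -> False.
  case/and4P=> ab bc le1 le2 abO bcO; have [acO] := trans a b c abO bcO le1.
  by move: le2; rewrite (adjO _ _ acO) /= ltnNge => /negbTE->.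
have corr a b c d T : corr_cond G a b c d T -> (b, c) \in O -> (c, a) \in O -> False.
  case=> [[mab mbc mac] [bd bdT cd cdT ad]] bcO caO.
  have [[ab1 l1 h1] [bc1 l2 h2] [ac1 l3 h3]] := And3 mab mbc mac.
  have [|baO _] := trans b c a bcO caO; first by rewrite -(hC ac1) l2 h3.
  have Thcd : T < hi (lab G c d) := leq_trans cdT (lh cd).
  have bdO : (b, d) \in O.
    apply: (totE _ _ bd) => dbO; have [|daO] := trans d b a dbO baO.
      by rewrite -(lC bd) -(hC ab1) h1.
    have da := adjO _ _ daO; rewrite -(hC ab1) h1 (lC da) leqNgt ad // adjC //.
  have cdO : (c, d) \in O.
    apply: (totE _ _ cd) => dcO; have [|_] := trans b d c bdO dcO.
      by rewrite -(hC cd) (leq_trans bdT (ltnW Thcd)).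
    by rewrite -(hC cd) l2 leqNgt Thcd.
  have [|_] := trans b c d bcO cdO; first by rewrite l2 ltnW.
  by rewrite leqNgt (leq_ltn_trans bdT).
apply/amttoP; split=> // p q pO /aug_arcP pq.
case: pq pO => [a b c _ ic|a b c _ ic|a b c d T cr|a b c d T cr] pO.
- by have /and4P[_ bc _ _] := ic; apply: totE => [|/(imp _ _ _ ic pO)//]; rewrite adjC.
- have /and4P[ab _ _ _] := ic; apply: totE => [|abO]; first by rewrite adjC.
  exact: imp ic abO pO.
- have [[_ _ [ac _ _]] _] := cr; apply: totE => // caO; exact: corr cr pO caO.
- have [[_ [bc _ _] _] _] := cr; apply: totE => [|bcO]; first by rewrite adjC.
  exact: corr cr bcO pO.
Qed.

Lemma mtto_amtto_Ness :
  ((exists O, mtto G O) <-> (exists O, amtto G O)) /\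
  ((exists O, amtto G O) <-> acyclic (Ness G)).
Proof.
split; split.
- by case=> O /mtto_amtto; exists O.
- by case=> O /amtto_mtto.
- by case=> O /amtto_Ness_acyclic.
- exact: Ness_acyclic_amtto.
Qed.

End Greedy.

(** * Depth-first search *)

(* [stk] and [fin] list the latest node first; [ptr p] is the next slot of [p] to
   be explored, and [rt] the number of roots already tried. *)
Record config := Config { rt : nat; stk : seq nat; fin : seq nat; ptr : nat -> nat }.

Section Search.
Variables (V : finType) (G : mtgraph V) (N K : nat) (arc : nat -> V * V).
Variables (cell : nat -> nat -> nat) (chk : nat -> nat) (chkP : V * V -> V * V).
Variable roots : seq nat.
Hypothesis arc_AP : forall p, p < N -> arc p \in AP G.
Hypothesis arc_surj : forall x, x \in AP G -> exists2 p, p < N & arc p = x.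
Hypothesis arc_inj : forall p q, p < N -> q < N -> arc p = arc q -> p = q.
Local Notation forc p q := (forces G (arc p) (arc q)).
Hypothesis cell_sound : forall p k q, p < N -> k < K -> cell p k = q.+1 -> q < N /\ forc p q.
Hypothesis cell_complete : forall p q, p < N -> q < N -> aug_arc G (arc p) (arc q) ->
  exists2 k, k < K & cell p k = q.+1.
Hypothesis chk_arc : forall p, p < N -> chk p < N /\ arc (chk p) = chkP (arc p).
Hypothesis size_roots : size roots = N.
Hypothesis roots_lt : forall p, p \in roots -> p < N.

Implicit Types (c : config) (p q u v : nat).

Definition visited c : seq nat := stk c ++ fin c.

Definition bump_ptr (f : nat -> nat) u := fun p => if p == u then (f u).+1 else f p.

(** A cell holds a node plus one, with 0 for an empty slot. The test on roots is that of [grow], so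
    the search from an accepted root computes one greedy closure. *)
Definition search_next c : config :=
  match stk c with
  | u :: st =>
    if ptr c u < K then
      let f := bump_ptr (ptr c) u in
      let q := cell u (ptr c u) in
      if (0 < q) && (q.-1 \notin visited c) then Config (rt c) (q.-1 :: stk c) (fin c) f
      else Config (rt c) (stk c) (fin c) f
    else Config (rt c) st (u :: fin c) (ptr c)
  | [::] =>
    let r := nth 0 roots (rt c) in
    if (r \in visited c) || (chk r \in visited c) then Config (rt c).+1 [::] (fin c) (ptr c)
    else Config (rt c).+1 [:: r] (fin c) (ptr c)
  end.

Definition active c : bool := (rt c < N) || (stk c != [::]).

(** A step tries a root, advances a slot pointer or finishes a node, and each term counts what
    remains of one kind. *)
Definition measure c : nat :=
  (N - rt c) + \sum_(p < N) (K - ptr c p) + (N - size (fin c)).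

Definition processed c := [seq arc p | p <- take (rt c) roots].

Definition mutual u v := forc u v /\ forc v u.

(** Components replace the usual discovery times. By [inv_scc], what a finished node reaches is
    finished unless the component of that node still meets the stack. By [inv_post], a node reaching
    a finished v is reached back from v, or its component contains a node that is unfinished or was
    finished after v. During a search the greedy closure may exceed the visited nodes, so
    [inv_greedy2] only asks that it be reachable from them. *)
Record search_inv c : Prop := Invariant {
  inv_uniq : uniq (visited c);
  inv_lt : forall p, p \in visited c -> p < N;
  inv_rt : rt c <= N;
  inv_chain : pairwise (fun x y => forces G (arc y) (arc x)) (stk c);
  inv_ptr : forall p, ptr c p <= K;
  inv_succ : forall p k q, p \in visited c -> k < ptr c p -> cell p k = q.+1 -> q \in visited c;
  inv_fin : forall p, p \in fin c -> ptr c p = K;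
  inv_new : forall p, p \notin visited c -> ptr c p = 0;
  inv_scc : forall u v, u \in fin c -> v < N -> forc u v ->
    v \in fin c \/ exists2 s, s \in stk c & mutual s u;
  inv_post : forall F2 v F1, fin c = F2 ++ v :: F1 -> forall u, u < N -> forc u v ->
    forc v u \/ exists u', [/\ u' < N, (u' \notin fin c) || (u' \in F2) & mutual u u'];
  inv_greedy1 : forall p, p \in visited c -> arc p \in greedy G chkP (processed c);
  inv_greedy2 : forall p, p < N -> arc p \in greedy G chkP (processed c) ->
    exists2 r, r \in visited c & forc r p
}.

Lemma forc_trans u v w : forc u v -> forc v w -> forc u w.
Proof. exact: connect_trans. Qed.

Lemma forc_refl u : forc u u.
Proof. exact: connect0. Qed.

Lemma closed_ids (A : pred nat) u v : u < N -> v < N -> A u -> forc u v ->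
  (forall p q, p < N -> q < N -> A p -> forc u p -> aug_arc G (arc p) (arc q) -> A q) -> A v.
Proof.
move=> uN vN Au /connectP[s]; elim/last_ind: s v vN => [|s x IHs] v vN.
  by move=> _ /arc_inj->.
rewrite rcons_path last_rcons => /andP[us sx] vx stepA.
have usx : forces G (arc u) (last (arc u) s) by apply/connectP; exists s.
have [p pN pE] := arc_surj (forces_AP (arc_AP uN) usx).
rewrite -pE -vx in sx usx.
exact: stepA pN vN (IHs p pN us pE stepA) usx sx.
Qed.

Lemma fin_closed c : search_inv c -> stk c = [::] ->
  forall u v, u \in fin c -> v < N -> forc u v -> v \in fin c.
Proof.
by move=> ic st0 u v uf vN uv; have [//|[s]] := inv_scc ic uf vN uv; rewrite st0.
Qed.

Lemma visited_greedy c : search_inv c -> stk c = [::] -> forall p, p < N ->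
  (p \in visited c) = (arc p \in greedy G chkP (processed c)).
Proof.
move=> ic st0 p pN; apply/idP/idP => [|/(inv_greedy2 ic pN)[r]]; first exact: inv_greedy1.
by rewrite /visited st0 => rf; apply: fin_closed rf pN.
Qed.

Lemma processedS i : i < N ->
  [seq arc p | p <- take i.+1 roots] =
  rcons [seq arc p | p <- take i roots] (arc (nth 0 roots i)).
Proof. by move=> lt; rewrite (take_nth 0) ?size_roots // map_rcons. Qed.

Lemma search_inv_root c : search_inv c -> stk c = [::] -> rt c < N -> search_inv (search_next c).
Proof.
move=> ic st0 ltN; rewrite /search_next st0; set r := nth 0 roots (rt c).
have rN : r < N by apply: roots_lt; rewrite mem_nth ?size_roots.
have [cN cE] := chk_arc rN.
have gE := visited_greedy ic st0; have PE := processedS ltN; rewrite -/r in PE.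
have fc := fin_closed ic st0.
rewrite !gE // cE; case: c st0 ic r rN cN cE gE ltN PE fc => rt0 stk0 fin0 ptr0 /= -> {stk0}.
rewrite /visited /processed /=.
case=> Iu Il Ir Ic Ip Is If In Isc Ipo Ig1 Ig2 r rN cN cE gE ltN PE fc.
rewrite /visited /processed /= in Iu Il Ir Ic Ip Is If In Isc Ipo Ig1 Ig2.
case: ifPn => grow_r.
  by split; rewrite /visited /processed /= ?PE ?greedy_rcons /grow ?grow_r.
have rfin : r \notin fin0 by move: grow_r; rewrite -gE // negb_or => /andP[].
split; rewrite /visited /processed /= ?PE ?greedy_rcons /grow ?(negbTE grow_r) ?rfin //.
- by move=> p; rewrite inE => /orP[/eqP->|/Il].
- move=> p k q; rewrite !inE => /orP[/eqP->|pf]; first by rewrite (In _ rfin).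
  by move=> kp /(Is _ _ _ pf kp)->; rewrite orbT.
- by move=> p; rewrite inE negb_or => /andP[_ /In].
- by move=> u v uf vN /(fc _ _ uf vN); left.
- move=> p; rewrite !inE => /orP[/eqP->|/Ig1->//]; apply/orP; right; exact: forc_refl.
- move=> p pN; rewrite !inE => /orP[/(Ig2 _ pN)[s sv sp]|rp].
    by exists s; rewrite // inE sv orbT.
  by exists r; rewrite // mem_head.
Qed.

Lemma search_inv_advance c u st : search_inv c -> stk c = u :: st -> ptr c u < K ->
  search_inv (search_next c).
Proof.
move=> ic stE ltK; rewrite /search_next stE ltK; move: ltK.
case: c stE ic => rt0 stk0 fin0 ptr0 /= -> {stk0}; rewrite /visited /=.
case=> Iu Il Ir Ic Ip Is If In Isc Ipo Ig1 Ig2 ltK.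
rewrite /visited /processed /= in Iu Il Ir Ic Ip Is If In Isc Ipo Ig1 Ig2.
have uv : u \in u :: st ++ fin0 by rewrite mem_head.
have ufin : u \notin fin0.
  by case/andP: Iu; rewrite mem_cat negb_or => /andP[].
have uN := Il _ uv.
have ptr_le p : bump_ptr ptr0 u p <= K by rewrite /bump_ptr; case: (p =P u) => [_|_].
have ptr_fin p : p \in fin0 -> bump_ptr ptr0 u p = K.
  by move=> pf; rewrite /bump_ptr; case: (p =P u) pf => [->|_ /If//]; rewrite (negbTE ufin).
have ptr_new p : p \notin u :: st ++ fin0 -> bump_ptr ptr0 u p = 0.
  by rewrite /bump_ptr; case: (p =P u) => [->|_ /In //]; rewrite uv.
have ptr_lt p k : k < bump_ptr ptr0 u p -> k < ptr0 p \/ p = u /\ k = ptr0 u.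
  rewrite /bump_ptr; case: (p =P u) => [->|_]; last by left.
  by rewrite ltnS leq_eqVlt => /orP[/eqP->|->]; [right|left].
case: ifPn => [/andP[]|]; last first.
  rewrite negb_and negbK -eqn0Ngt => dn.
  split; rewrite /visited /processed //= => p k q pv /ptr_lt[kp|[-> ->]] E.
    exact: Is pv kp E.
  by move: dn; rewrite E.
case E: (cell u (ptr0 u)) => [//|v] _ /= vnew.
have [vN uv'] := cell_sound uN ltK E.
have chain x : x \in u :: st -> forc x v.
  rewrite inE => /orP[/eqP->//|xst]; apply: forc_trans uv'.
  by case/andP: Ic => /allP/(_ x xst).
have uG := Ig1 _ uv.
split; rewrite /visited /processed /=.
- by rewrite vnew.
- by move=> p; rewrite inE => /orP[/eqP->|/Il].
- by [].
- by rewrite Ic (chain u) ?mem_head //= andbT; apply/allP => x xst; apply: chain; rewrite inE xst orbT.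
- exact: ptr_le.
- move=> p k q; rewrite inE => /orP[/eqP->|pv]; first by rewrite ptr_new.
  case/ptr_lt=> [kp /(Is _ _ _ pv kp) qv|[-> ->]]; first by rewrite inE qv orbT.
  by rewrite E => -[<-]; rewrite mem_head.
- exact: ptr_fin.
- by move=> p; rewrite inE negb_or => /andP[_ /ptr_new].
- move=> p w pf wN /(Isc _ _ pf wN)[|[s sst sp]]; first by left.
  by right; exists s; rewrite // inE sst orbT.
- exact: Ipo.
- move=> p; rewrite inE => /orP[/eqP->|/Ig1//].
  exact: closed_forces (@greedy_closed _ _ _ _) uG uv'.
- move=> p pN /(Ig2 _ pN)[s sv sp]; by exists s; rewrite // inE sv orbT.
Qed.

(* If no node below the top [u] of the stack is mutually reachable with [u],
   then everything reachable from [u] is finished once [u] is. *)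
Lemma finish_scc c u st : search_inv c -> stk c = u :: st -> ptr c u = K ->
  forall v, v < N -> forc u v -> v \in u :: fin c \/ exists2 s, s \in st & mutual s u.
Proof.
move=> ic stE pK v vN uv.
have [/hasP[s sst /andP[su us]]|/hasPn nos] :=
    boolP (has (fun s => forc s u && forc u s) st).
  by right; exists s.
have visE : visited c = u :: st ++ fin c by rewrite /visited stE.
have uN : u < N by apply: (inv_lt ic); rewrite visE mem_head.
left; apply: (closed_ids (A := fun x => x \in u :: fin c) uN vN _ uv); first exact: mem_head.
move=> p q pN qN pA up pq.
have [k kK E] := cell_complete pN qN pq.
have pv : p \in visited c.
  by rewrite visE; move: pA; rewrite !inE mem_cat => /orP[->|->]; rewrite ?orbT.
have kp : k < ptr c p.
  by move: pA; rewrite inE => /orP[/eqP->|/(inv_fin ic)->]; rewrite ?pK.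
have := inv_succ ic pv kp E; rewrite visE !inE mem_cat => /or3P[->//|qst|->]; last by rewrite orbT.
have uq : forc u q := connect_trans up (connect1 pq).
have qu : forc q u by have := inv_chain ic; rewrite stE => /andP[/allP/(_ q qst)].
by have := nos q qst; rewrite qu uq.
Qed.

Lemma search_inv_finish c u st : search_inv c -> stk c = u :: st -> K <= ptr c u ->
  search_inv (search_next c).
Proof.
move=> ic stE leK; rewrite /search_next stE ltnNge leK /=.
have pK : ptr c u = K by apply/eqP; rewrite eqn_leq leK (inv_ptr ic).
have fs := finish_scc ic stE pK.
case: c stE ic fs pK leK => rt0 stk0 fin0 ptr0 /= -> {stk0} + + pK _.
case=> Iu Il Ir Ic Ip Is If In Isc Ipo Ig1 Ig2 fs.
rewrite /visited /processed /= in Iu Il Ir Ic Ip Is If In Isc Ipo Ig1 Ig2 fs.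
have visE : st ++ u :: fin0 =i u :: st ++ fin0.
  by move=> x; rewrite mem_cat !inE mem_cat orbCA.
have uN : u < N by apply: Il; rewrite mem_head.
have [ust ufin] : u \notin st /\ u \notin fin0.
  by case/andP: Iu; rewrite mem_cat negb_or => /andP[].
split; rewrite /visited /processed /=.
- by rewrite -[u :: fin0]cat1s uniq_catCA.
- by move=> p; rewrite visE => /Il.
- by [].
- by case/andP: Ic.
- exact: Ip.
- by move=> p k q; rewrite !visE; exact: Is.
- by move=> p; rewrite inE => /orP[/eqP->|/If].
- by move=> p; rewrite visE => /In.
- move=> x v; rewrite inE => /orP[/eqP->|xf] vN xv; first exact: fs.
  have [vf|[s]] := Isc _ _ xf vN xv; first by left; rewrite inE vf orbT.
  rewrite inE => /orP[/eqP->|sst] [sx xs]; last by right; exists s.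
  (* Popping u removes the stack witness for the component of x. Unless v is finished, [finish_scc]
     gives another witness lower in the stack. *)
  have [|[s' s'st [s'u us']]] := fs v vN (forc_trans sx xv); first by left.
  by right; exists s' => //; split; [exact: forc_trans s'u sx | exact: forc_trans xs us'].
- move=> [|w F2] v F1 /= [].
    (* The entry in question is u itself. A finished x reaching u has a stack node in its component:
       either u, or a node below it, which is still unfinished. *)
    move=> <- _ x xN xu.
    have [xf|xnf] := boolP (x \in u :: fin0); last first.
      by right; exists x; rewrite xnf; split=> //; split; exact: forc_refl.
    move: xf; rewrite inE => /orP[/eqP->|xf]; first by left; exact: forc_refl.
    have [uf|[s]] := Isc _ _ xf uN xu; first by rewrite uf in ufin.
    rewrite inE => /orP[/eqP-> [ux _]|sst [sx xs]]; first by left.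
    right; exists s; split; [by apply: Il; rewrite inE mem_cat sst orbT| |by split].
    apply/orP; left; rewrite inE negb_or; apply/andP; split.
      by apply: contraNneq ust => <-.
    by move: Iu => /= /andP[_]; rewrite cat_uniq => /and3P[_ /hasPn nh _]; apply/negP => /nh/negP.
  move=> <- finE x xN xv.
  have [|[u' [u'N uf mu]]] := Ipo _ _ _ finE x xN xv; first by left.
  right; exists u'; split=> //; rewrite !inE negb_or.
  by case/orP: uf => [->|->]; rewrite ?orbT // andbT; case: eqP.
- by move=> p; rewrite visE; exact: Ig1.
- by move=> p pN /(Ig2 _ pN)[s sv sp]; exists s; rewrite ?visE.
Qed.

Lemma search_inv_next c : search_inv c -> active c -> search_inv (search_next c).
Proof.
rewrite /active; case stE: (stk c) => [|u st] ic; first by rewrite orbF; exact: search_inv_root.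
have [lt|ge] := ltnP (ptr c u) K => _; first exact: search_inv_advance stE lt.
exact: search_inv_finish stE ge.
Qed.

Lemma sum_bump f u : u < N -> f u < K ->
  (\sum_(p < N) (K - bump_ptr f u p)).+1 = \sum_(p < N) (K - f p).
Proof.
move=> uN fu; rewrite (bigD1 (Ordinal uN)) //= [RHS](bigD1 (Ordinal uN)) //=.
rewrite /bump_ptr eqxx -addSn; congr (_ + _); first by lia.
by apply: eq_bigr => p; rewrite -val_eqE /= => /negbTE->.
Qed.

Lemma measure_next c : search_inv c -> active c -> measure (search_next c) < measure c.
Proof.
rewrite /active /measure /search_next => ic; have Iu := inv_uniq ic; have Il := inv_lt ic.
have szN : size (visited c) <= N.
  rewrite -(size_iota 0 N); apply: uniq_leq_size => // p /Il.
  by rewrite mem_iota add0n.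
rewrite /visited in Iu Il szN.
case: (stk c) Iu Il szN => [|u st] Iu Il szN; first by rewrite orbF; case: ifP => _ /=; lia.
move=> _; have uN : u < N by apply: Il; rewrite mem_head.
have [lt|ge] := ltnP (ptr c u) K; last first.
  by move: szN; rewrite /= size_cat; move: (size (fin c)) => sz; lia.
by have := sum_bump uN lt; case: ifP => _ /=; lia.
Qed.

Definition start := Config 0 [::] [::] (fun=> 0).

Lemma search_inv_start : search_inv start.
Proof.
split; rewrite /visited /processed ?take0 //=; first by case.
by move=> p _; rewrite inE.
Qed.

Lemma search_visited c : search_inv c -> ~~ active c -> forall p, p < N ->
  (p \in fin c) = (arc p \in greedy G chkP [seq arc p | p <- roots]).
Proof.
move=> ic; rewrite /active negb_or negbK -leqNgt => /andP[rtN /eqP st0] p pN.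
have := visited_greedy ic st0 pN; rewrite /visited /processed st0 /= take_oversize //.
by rewrite size_roots.
Qed.

Lemma search_postorder c : search_inv c -> ~~ active c -> (forall p, p < N -> p \in fin c) ->
  forall F2 v F1, fin c = F2 ++ v :: F1 -> forall u, u < N -> forc u v ->
    forc v u \/ exists2 u', u' \in F2 & mutual u u'.
Proof.
move=> ic _ full F2 v F1 E u uN uv.
have [|[u' [u'N uf mu]]] := inv_post ic E uN uv; first by left.
by right; exists u' => //; move: uf; rewrite full.
Qed.

End Search.

(** * Running times of programs *)

(** Truncated subtraction negates any value as a truth value, so numbers such as [eid] serve
    directly as guards. The conjunction is De Morgan's. *)
Definition ENot (e : expr) : expr := Defs.Sub (Const 1) e.
Definition EAnd (e1 e2 : expr) : expr := Defs.Sub (Const 1) (Add (ENot e1) (ENot e2)).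
Definition EOr (e1 e2 : expr) : expr := Leq (Const 1) (Add e1 e2).
Definition ELt (e1 e2 : expr) : expr := Leq (Add e1 (Const 1)) e2.
Definition EEq (e1 e2 : expr) : expr := EAnd (Leq e1 e2) (Leq e2 e1).

Lemma truth_not s e : (eval s (ENot e) != 0) = (eval s e == 0).
Proof. by rewrite /=; case: (eval s e). Qed.

Lemma truth_and s e1 e2 : (eval s (EAnd e1 e2) != 0) = (eval s e1 != 0) && (eval s e2 != 0).
Proof. by rewrite /=; case: (eval s e1); case: (eval s e2). Qed.

Lemma truth_or s e1 e2 : (eval s (EOr e1 e2) != 0) = (eval s e1 != 0) || (eval s e2 != 0).
Proof. by rewrite /=; case: (eval s e1); case: (eval s e2). Qed.

Lemma truth_leq s e1 e2 : (eval s (Leq e1 e2) != 0) = (eval s e1 <= eval s e2).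
Proof. by rewrite /=; case: leqP. Qed.

Lemma truth_lt s e1 e2 : (eval s (ELt e1 e2) != 0) = (eval s e1 < eval s e2).
Proof. by rewrite truth_leq /= addn1. Qed.

Lemma truth_eq s e1 e2 : (eval s (EEq e1 e2) != 0) = (eval s e1 == eval s e2).
Proof. by rewrite truth_and !truth_leq eqn_leq. Qed.

Definition truthE := (truth_not, truth_and, truth_or, truth_lt, truth_eq, truth_leq).

(* Keeps the guards folded under simplification, so that [truthE] applies. *)
#[global] Opaque ENot EAnd EOr ELt EEq.

(** On loop-free commands execution is the function [run], so proof obligations reduce by
    computation. The values of [run] and [max_cost] on loops are defaults that [straight] rules
    out. *)
Fixpoint straight (c : cmd) : bool :=
  match c with
  | Seq c1 c2 | If _ c1 c2 => straight c1 && straight c2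
  | While _ _ => false
  | _ => true
  end.

Fixpoint run (c : cmd) (s : state) : state :=
  match c with
  | Skip | While _ _ => s
  | Assign x e => set_reg s x (eval s e)
  | Store a i e => set_cell s a (eval s i) (eval s e)
  | Seq c1 c2 => run c2 (run c1 s)
  | If e c1 c2 => if eval s e != 0 then run c1 s else run c2 s
  end.

(* The cost of a conditional counts both branches. *)
Fixpoint max_cost (c : cmd) : nat :=
  match c with
  | Skip | While _ _ => 1
  | Assign _ e => (ecost e).+1
  | Store _ i e => (ecost i + ecost e).+1
  | Seq c1 c2 => (max_cost c1 + max_cost c2).+1
  | If e c1 c2 => (ecost e + (max_cost c1 + max_cost c2)).+1
  end.

Fixpoint wregs (c : cmd) : seq nat :=
  match c with
  | Assign x _ => [:: x]
  | Seq c1 c2 | If _ c1 c2 => wregs c1 ++ wregs c2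
  | While _ c1 => wregs c1
  | _ => [::]
  end.

Fixpoint warrs (c : cmd) : seq nat :=
  match c with
  | Store a _ _ => [:: a]
  | Seq c1 c2 | If _ c1 c2 => warrs c1 ++ warrs c2
  | While _ c1 => warrs c1
  | _ => [::]
  end.

Definition frame c s s' : Prop :=
  (forall x, x \notin wregs c -> regs s' x = regs s x) /\
  (forall a, a \notin warrs c -> arrays s' a =1 arrays s a).

Lemma exec_frame c s s' t : exec c s s' t -> frame c s s'.
Proof.
rewrite /frame.
elim=> {c s s' t} //=.
- by move=> x e s; split=> // y; rewrite inE => /negbTE->.
- by move=> a i e s; split=> // b; rewrite inE => /negbTE ba j; rewrite ba.
- move=> c1 c2 s s1 s2 _ _ _ [r1 a1] _ [r2 a2].
  split=> x; rewrite mem_cat negb_or => /andP[n1 n2]; first by rewrite r2 ?r1.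
  by move=> j; rewrite a2 ?a1.
- move=> e c1 c2 s s1 _ _ _ [r1 a1].
  by split=> x; rewrite mem_cat negb_or => /andP[n1 _]; [exact: r1|exact: a1].
- move=> e c1 c2 s s1 _ _ _ [r1 a1].
  by split=> x; rewrite mem_cat negb_or => /andP[_ n1]; [exact: r1|exact: a1].
- move=> e c s s1 s2 _ _ _ _ [r1 a1] _ [r2 a2].
  by split=> x nx; [rewrite r2 // r1|move=> j; rewrite a2 // a1].
Qed.

Lemma frame_trans c c' s s1 s2 : {subset wregs c' <= wregs c} -> {subset warrs c' <= warrs c} ->
  frame c s s1 -> frame c' s1 s2 -> frame c s s2.
Proof.
move=> sr sa [r1 a1] [r2 a2]; split=> x nx; first by rewrite r2 ?r1 //; apply: contra nx; exact: sr.
by move=> j; rewrite a2 ?a1 //; apply: contra nx; exact: sa.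
Qed.

(** Total correctness within a time budget. Budgets are upper bounds, so they can be rounded
    freely. *)
Definition wp c s t (Q : state -> Prop) : Prop := exists s' t', [/\ exec c s s' t', t' <= t & Q s'].

Lemma wp_weaken c s t t' (Q Q' : state -> Prop) :
  wp c s t Q -> t <= t' -> (forall s', Q s' -> Q' s') -> wp c s t' Q'.
Proof.
case=> s' [t1 [ex le1 q]] le2 QQ; exists s', t1; split=> //; last exact: QQ.
exact: leq_trans le1 le2.
Qed.

Lemma wp_le c s t t' Q : wp c s t Q -> t <= t' -> wp c s t' Q.
Proof. by move=> w le; apply: wp_weaken w le _. Qed.

Lemma wp_frame c s t Q : wp c s t Q -> wp c s t (fun s' => Q s' /\ frame c s s').
Proof. by case=> s' [t1 [ex le1 q]]; exists s', t1; split=> //; split=> //; exact: exec_frame ex. Qed.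

Lemma wp_seq c1 c2 s t1 t2 Q :
  wp c1 s t1 (fun s1 => wp c2 s1 t2 Q) -> wp (Seq c1 c2) s (t1 + t2).+1 Q.
Proof.
case=> s1 [u1 [ex1 le1 [s2 [u2 [ex2 le2 q]]]]]; exists s2, (u1 + u2).+1; split=> //.
  exact: ExecSeq ex1 ex2.
by rewrite ltnS leq_add.
Qed.

Lemma wp_if e c1 c2 s t Q :
  (eval s e != 0 -> wp c1 s t Q) -> (eval s e == 0 -> wp c2 s t Q) ->
  wp (If e c1 c2) s (ecost e + t).+1 Q.
Proof.
move=> H1 H2; have [e0|e0] := eqVneq (eval s e) 0.
  have [|s' [u [ex le q]]] := H2; first by rewrite e0.
  by exists s', (ecost e + u).+1; rewrite ltnS leq_add2l; split=> //; exact: ExecIfFalse.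
have [s' [u [ex le q]]] := H1 e0.
by exists s', (ecost e + u).+1; rewrite ltnS leq_add2l; split=> //; exact: ExecIfTrue.
Qed.

Lemma wp_run c s t (Q : state -> Prop) : straight c -> max_cost c <= t -> Q (run c s) -> wp c s t Q.
Proof.
move=> st le q; suff [u ex lu] : exists2 u, exec c s (run c s) u & u <= max_cost c.
  by exists (run c s), u; split=> //; exact: leq_trans lu le.
elim: c {t Q q le} s st => //=.
- by move=> s _; exists 1 => //; constructor.
- by move=> x e s _; exists (ecost e).+1 => //; constructor.
- by move=> a i e s _; exists (ecost i + ecost e).+1 => //; constructor.
- move=> c1 IH1 c2 IH2 s /andP[/(IH1 s)[u1 ex1 le1] /(IH2 (run c1 s))[u2 ex2 le2]].
  by exists (u1 + u2).+1; [exact: ExecSeq ex1 ex2|rewrite ltnS leq_add].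
move=> e c1 IH1 c2 IH2 s /andP[/(IH1 s)[u1 ex1 le1] /(IH2 s)[u2 ex2 le2]].
case: eqP => [e0|/eqP e0] /=.
  exists (ecost e + u2).+1; first exact: ExecIfFalse.
  by rewrite ltnS leq_add2l (leq_trans le2) // leq_addl.
exists (ecost e + u1).+1; first exact: ExecIfTrue.
by rewrite ltnS leq_add2l (leq_trans le1) // leq_addr.
Qed.

Lemma frame_run c s : straight c -> frame c s (run c s).
Proof.
move=> st; have [s' [t [ex _ <-]]] : wp c s (max_cost c) (fun s' => s' = run c s) by exact: wp_run.
exact: exec_frame ex.
Qed.

Lemma wp_while e c s t k (I : nat -> state -> Prop) (Q : state -> Prop) : I k s ->
  (forall k s, I k s -> eval s e != 0 -> wp c s t (fun s' => exists2 k', k' < k & I k' s')) ->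
  (forall k s, I k s -> eval s e == 0 -> Q s) ->
  wp (While e c) s (k * (t + ecost e + 1) + ecost e + 1) Q.
Proof.
move=> Iks body out; elim/ltn_ind: k s Iks => k IHk s Iks.
have [e0|e0] := eqVneq (eval s e) 0.
  exists s, (ecost e).+1; split; [exact: ExecWhileFalse|lia|].
  by apply: out Iks _; rewrite e0.
have [s1 [u1 [ex1 le1 [k' ltk Ik']]]] := body k s Iks e0.
have [s2 [u2 [ex2 le2 q]]] := IHk k' ltk s1 Ik'.
exists s2, (ecost e + u1 + u2).+1; split=> //; first exact: ExecWhileTrue ex1 ex2.
have : k'.+1 * (t + ecost e + 1) <= k * (t + ecost e + 1) by rewrite leq_mul2r ltk orbT.
by rewrite mulSn; lia.
Qed.

Definition For (x b : nat) (c : cmd) : cmd :=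
  Seq (Assign x (Const 0))
      (While (ELt (Reg x) (Reg b)) (Seq c (Assign x (Add (Reg x) (Const 1))))).

(** A turn adds 5 for the guard, 4 for the increment and one each for the sequence and the loop. The
    final 9 pays for the initial assignment, its sequence and the failing test. *)
Lemma wp_for_frameless x b c n (t : nat -> nat) (I : nat -> state -> Prop) s (Q : state -> Prop) :
  [&& x \notin wregs c, b \notin wregs c & x != b] -> regs s b = n ->
  I 0 (set_reg s x 0) ->
  (forall i s1, i < n -> regs s1 x = i -> regs s1 b = n -> I i s1 ->
     wp c s1 (t i) (fun s2 => I i.+1 (set_reg s2 x i.+1))) ->
  (forall s1, regs s1 x = n -> I n s1 -> Q s1) ->
  wp (For x b c) s (\sum_(i < n) (t i + 11) + 9) Q.
Proof.
case/and3P=> xc bc xb sb I0 body out.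
have loop j s1 : j <= n -> regs s1 x = n - j -> regs s1 b = n -> I (n - j) s1 ->
    wp (While (ELt (Reg x) (Reg b)) (Seq c (Assign x (Add (Reg x) (Const 1))))) s1
       (\sum_(n - j <= i < n) (t i + 11) + 6) Q.
  elim: j s1 => [|j IHj] s1 jn s1x s1b Ij.
    exists s1, 6; split; [|lia|]; last by apply: out; rewrite ?s1x subn0 in Ij *.
    apply: (@ExecWhileFalse (ELt (Reg x) (Reg b))); apply/eqP; rewrite -[_ == _]negbK truth_lt /=.
    by rewrite s1x s1b subn0 ltnn.
  have lt : n - j.+1 < n by lia.
  have nS : (n - j.+1).+1 = n - j by lia.
  have [s2 [u [ex le [Ij' [fr fa]]]]] := wp_frame (body _ s1 lt s1x s1b Ij).
  have [||||s3 [u' [ex' le' q]]] := IHj (set_reg s2 x (n - j)); first lia.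
  - by rewrite /= eqxx.
  - by rewrite /= eq_sym (negbTE xb) fr.
  - by rewrite -nS.
  exists s3, (5 + (u + 4).+1 + u').+1; split=> //.
    apply: (@ExecWhileTrue (ELt (Reg x) (Reg b))) ex'.
      by rewrite truth_lt /= s1x s1b.
    apply: ExecSeq ex _; rewrite (_ : n - j = eval s2 (Add (Reg x) (Const 1))).
      exact: ExecAssign.
    by rewrite /= fr // s1x; lia.
  by rewrite big_ltn // nS; lia.
have [|||s1 [u [ex le q]]] := loop n (set_reg s x 0) (leqnn n).
- by rewrite /= eqxx subnn.
- by rewrite /= eq_sym (negbTE xb).
- by rewrite subnn.
exists s1, (2 + u).+1; split=> //; first by apply: ExecSeq ex; exact: (@ExecAssign x (Const 0)).
by rewrite subnn big_mkord in le; lia.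
Qed.

(** Carrying the frame of the whole loop beside the invariant keeps untouched registers and arrays
    out of the latter. *)
Lemma wp_for x b c n (t : nat -> nat) (I : nat -> state -> Prop) s (Q : state -> Prop) :
  [&& x \notin wregs c, b \notin wregs c & x != b] -> regs s b = n ->
  I 0 (set_reg s x 0) ->
  (forall i s1, i < n -> regs s1 x = i -> regs s1 b = n -> frame (For x b c) s s1 -> I i s1 ->
     wp c s1 (t i) (fun s2 => I i.+1 (set_reg s2 x i.+1))) ->
  (forall s1, regs s1 x = n -> frame (For x b c) s s1 -> I n s1 -> Q s1) ->
  wp (For x b c) s (\sum_(i < n) (t i + 11) + 9) Q.
Proof.
move=> xbc sb I0 body out.
have fr_set v s1 : frame (For x b c) s s1 -> frame (For x b c) s (set_reg s1 x v).
  case=> r1 a1; split=> // y /=; rewrite inE negb_or => /andP[/[dup] yx /negbTE-> ny].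
  by apply: r1; rewrite inE negb_or yx.
apply: (@wp_for_frameless x b c n t (fun i s1 => I i s1 /\ frame (For x b c) s s1)) => //.
- by split=> //; exact: fr_set.
- move=> i s1 lt s1x s1b [Ii fs1].
  apply: wp_weaken (wp_frame (body i s1 lt s1x s1b fs1 Ii)) (leqnn _) _ => s2 [Ii' fs2].
  split=> //; apply: fr_set; apply: frame_trans fs1 fs2 => y yc /=.
    by rewrite inE mem_cat yc orbT.
  by rewrite cats0.
- by move=> s1 s1x [In fs1]; exact: out.
Qed.

Lemma wp_for_const x b c n t T (I : nat -> state -> Prop) s (Q : state -> Prop) :
  [&& x \notin wregs c, b \notin wregs c & x != b] -> regs s b = n ->
  I 0 (set_reg s x 0) ->
  (forall i s1, i < n -> regs s1 x = i -> regs s1 b = n -> frame (For x b c) s s1 -> I i s1 ->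
     wp c s1 t (fun s2 => I i.+1 (set_reg s2 x i.+1))) ->
  (forall s1, regs s1 x = n -> frame (For x b c) s s1 -> I n s1 -> Q s1) ->
  n * (t + 11) + 9 <= T ->
  wp (For x b c) s T Q.
Proof.
move=> h1 h2 h3 h4 h5 le; apply: wp_weaken (wp_for h1 h2 h3 h4 h5) _ _ => //.
by rewrite sum_nat_const card_ord.
Qed.

Lemma wp_seq_frame c1 c2 s t1 t2 Q1 Q : wp c1 s t1 Q1 ->
  (forall s1, Q1 s1 -> frame c1 s s1 -> wp c2 s1 t2 Q) -> wp (Seq c1 c2) s (t1 + t2).+1 Q.
Proof.
move=> w1 w2; apply: wp_seq; apply: wp_weaken (wp_frame w1) (leqnn _) _ => s1 [q f].
exact: w2.
Qed.

Lemma wp_while_frame e c s t k (I : nat -> state -> Prop) (Q : state -> Prop) : I k s ->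
  (forall k s1, frame c s s1 -> I k s1 -> eval s1 e != 0 ->
     wp c s1 t (fun s' => exists2 k', k' < k & I k' s')) ->
  (forall k s1, I k s1 -> eval s1 e == 0 -> Q s1) ->
  wp (While e c) s (k * (t + ecost e + 1) + ecost e + 1) Q.
Proof.
move=> Iks body out.
apply: (@wp_while e c s t k (fun k s1 => I k s1 /\ frame c s s1)) => [|k1 s1 [Ik fs] e1|k1 s1 [Ik _]].
- by split.
- apply: wp_weaken (wp_frame (body k1 s1 fs Ik e1)) (leqnn _) _ => s2 [[k' lt Ik'] fs2].
  exists k' => //; split=> //; apply: frame_trans fs fs2 => x //.
- exact: out Ik.
Qed.

Local Notation "c1 ;; c2" := (Seq c1 c2) (at level 100, right associativity).

(** The machine cannot multiply, so the row offsets of the two-dimensional tables are tabulated by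
    repeated addition. *)
Definition multiples (a b k : nat) : cmd :=
  Assign 7 (Const 0) ;; For 4 b (Store a (Reg 4) (Reg 7) ;; Assign 7 (Add (Reg 7) (Reg k))).

Lemma wp_multiples a b k s n v : (4 < b) || (b < 4) -> regs s b = n -> b != 7 -> k != 7 -> k != 4 ->
  regs s k = v ->
  wp (multiples a b k) s (n * 20 + 20) (fun s' => forall i, i < n -> arrays s' a i = i * v).
Proof.
move=> b4 sb b7 k7 k4 sk.
apply: wp_weaken.
- apply: wp_seq_frame; first by apply: (@wp_run _ _ 2 (fun s' => regs s' 7 = 0 /\ regs s' k = v)); rewrite //= (negbTE k7).
  move=> s1 [s17 s1k] [fr fa].
  apply: (@wp_for_const 4 b _ n 9 (n * 20 + 9) (fun i s' => [/\ regs s' 7 = i * v, regs s' k = v & forall j, j < i -> arrays s' a j = j * v]) _ (fun s' => forall i, i < n -> arrays s' a i = i * v)).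
  + by rewrite /= !inE; lia.
  + by rewrite fr //= inE; lia.
  + by rewrite /= (negbTE k4); split.
  + move=> i s2 lt s24 s2b _ [s27 s2k sa].
    apply: wp_run => //=; rewrite (negbTE k7) (negbTE k4) s27 s2k s24 mulSn addnC.
    split=> // j; rewrite ltnS leq_eqVlt eqxx /= => /orP[/eqP->|ji]; first by rewrite eqxx.
    by case: eqP => [->//|_]; exact: sa.
  + by move=> s2 _ _ [_ _ sa]; exact: sa.
  + lia.
- lia.
- by [].
Qed.

(** * Numbering the arcs *)

Lemma set2_inj (T : finType) (a b c d : T) : [set a; b] = [set c; d] ->
  (a = c /\ b = d) \/ (a = d /\ b = c).
Proof.
move=> E; have := set21 a b; have := set22 a b; have := set21 c d; have := set22 c d.
rewrite -{1 2}E {3 4}E !inE.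
by do 4![case/orP=> /eqP ?]; subst; auto.
Qed.

Lemma nth_flatten_at (T : Type) (x : T) (ss : seq (seq T)) i j :
  i < size ss -> j < size (nth [::] ss i) ->
  nth x (flatten ss) (sumn (take i [seq size s | s <- ss]) + j) = nth x (nth [::] ss i) j.
Proof.
elim: ss i => [|s ss IHs] [|i] //= lti ltj; first by rewrite nth_cat ltj.
rewrite nth_cat -addnA; case: ltnP => [|_]; first by lia.
by rewrite addKn IHs.
Qed.

Lemma map_uniq_inj (T1 T2 : eqType) (f : T1 -> T2) s : uniq (map f s) -> {in s &, injective f}.
Proof.
elim: s => //= a s IHs /andP[fa us] x y; rewrite !inE.
case/predU1P=> [->|xs] /predU1P[->|ys] // E; last exact: IHs.
  by case/negP: fa; rewrite E map_f.
by case/negP: fa; rewrite -E map_f.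
Qed.

Section Instance.
Variables (n : nat) (G : mtgraph 'I_n) (es : seq ('I_n * 'I_n)).
Hypothesis esG : edge_list G es.
Variable x0 : 'I_n * 'I_n.

Notation m := (size es).
Notation N := (m + m).
Implicit Types (u v : 'I_n) (p q : nat).

(** Listing the reversed edges after the edges makes m + i the reverse of arc i, so consistency can
    be tested by comparing the marks of i and m + i for i < m. *)
Definition arcs : seq ('I_n * 'I_n) := es ++ [seq swap e | e <- es].
Definition arcn p : 'I_n * 'I_n := nth x0 arcs p.
Definition neg p : nat := if p < m then m + p else p - m.
Definition tl p : nat := (arcn p).1.
Definition hd p : nat := (arcn p).2.
Definition low p : nat := lo (lab G (arcn p).1 (arcn p).2).
Definition high p : nat := hi (lab G (arcn p).1 (arcn p).2).
(* [0] when [u] and [v] are not adjacent, and otherwise the number of the arc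
   [(u, v)] plus one. *)
Definition eid u v : nat := if (u, v) \in arcs then (index (u, v) arcs).+1 else 0.

Lemma size_arcs : size arcs = N.
Proof. by rewrite size_cat size_map. Qed.

Lemma mem_es_adj e : e \in es -> adj G e.1 e.2.
Proof.
have [_ esE] := esG => eE; have: [set e.1; e.2] \in edges G by rewrite -esE; apply/mapP; exists e.
case/imsetP=> p; rewrite inE => pA /set2_inj[[-> ->]//|[-> ->]]; by rewrite adj_sym.
Qed.

Lemma arcs_AP : arcs =i AP G.
Proof.
have [_ esE] := esG; move=> [u v]; rewrite mem_cat inE /=; apply/orP/idP => [[|/mapP[e eE]]|uv].
- exact: mem_es_adj.
- by case=> -> ->; rewrite adj_sym mem_es_adj.
have: [set u; v] \in edges G by apply/imsetP; exists (u, v); rewrite ?inE.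
rewrite -esE => /mapP[[a b] eE /= /set2_inj[[-> ->]|[-> ->]]]; first by left.
by right; apply/mapP; exists (a, b).
Qed.

Lemma uniq_arcs : uniq arcs.
Proof.
have [/[dup] uE /map_uniq ues _] := esG.
rewrite cat_uniq ues (map_inj_uniq (inv_inj (@swapK _))) ues andbT.
apply/hasPn => _ /mapP[e eE ->]; apply/negP => sE.
have E : swap e = e by apply: (map_uniq_inj uE) => //=; rewrite setUC.
by have := mem_es_adj eE; rewrite -{1}E adj_irr.
Qed.

Lemma size_es_edges : m = #|edges G|.
Proof.
have [uE esE] := esG; rewrite -(size_map (fun e => [set e.1; e.2])) -(card_uniqP uE).
exact: eq_card.
Qed.

Lemma arcn_in p : p < N -> arcn p \in arcs.
Proof. by rewrite -size_arcs => lt; rewrite mem_nth. Qed.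

Lemma arcn_AP p : p < N -> arcn p \in AP G.
Proof. by rewrite -arcs_AP; exact: arcn_in. Qed.

Lemma arcn_adj p : p < N -> adj G (arcn p).1 (arcn p).2.
Proof. by move/arcn_AP; rewrite inE. Qed.

Lemma arcn_inj p q : p < N -> q < N -> arcn p = arcn q -> p = q.
Proof. by rewrite -size_arcs => pN qN /eqP; rewrite nth_uniq ?uniq_arcs // => /eqP. Qed.

Lemma arcn_surj x : x \in AP G -> exists2 p, p < N & arcn p = x.
Proof. by rewrite -arcs_AP => xA; exists (index x arcs); [rewrite -size_arcs index_mem|exact: nth_index]. Qed.

Lemma arcn_low p : p < m -> arcn p = nth x0 es p.
Proof. by move=> lt; rewrite /arcn nth_cat lt. Qed.

Lemma arcn_high p : p < m -> arcn (m + p) = swap (nth x0 es p).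
Proof.
move=> lt; rewrite /arcn nth_cat ltnNge leq_addr /= addKn.
by rewrite (nth_map x0).
Qed.

Lemma neg_lt p : p < N -> neg p < N.
Proof. by rewrite /neg; case: ifP; lia. Qed.

Lemma arcn_neg p : p < N -> arcn (neg p) = swap (arcn p).
Proof.
rewrite /neg => pN; case: ltnP => pm; first by rewrite arcn_high // arcn_low.
rewrite arcn_low; last by lia.
by rewrite -{2}(subnKC pm) arcn_high ?swapK //; lia.
Qed.

Lemma eid_gt0 u v : (0 < eid u v) = adj G u v.
Proof. by rewrite /eid arcs_AP inE /=; case: ifP. Qed.

Lemma eid_eq0 u v : (eid u v == 0) = ~~ adj G u v.
Proof. by rewrite -eid_gt0 lt0n negbK. Qed.

Lemma eid_spec u v : adj G u v -> exists2 p, p < N & eid u v = p.+1 /\ arcn p = (u, v).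
Proof.
move=> uv; have uvA : (u, v) \in arcs by rewrite arcs_AP inE.
exists (index (u, v) arcs); first by rewrite -size_arcs index_mem.
by rewrite /eid uvA /arcn nth_index.
Qed.

Lemma eid_arcn p : p < N -> eid (arcn p).1 (arcn p).2 = p.+1.
Proof.
move=> pN; have [q qN [-> E]] := eid_spec (arcn_adj pN).
by rewrite (@arcn_inj q p) // E -surjective_pairing.
Qed.

Lemma low_eid u v : adj G u v -> low (eid u v).-1 = lo (lab G u v).
Proof. by move/eid_spec=> [p _ [-> E]]; rewrite /low E. Qed.

Lemma high_eid u v : adj G u v -> high (eid u v).-1 = hi (lab G u v).
Proof. by move/eid_spec=> [p _ [-> E]]; rewrite /high E. Qed.

Lemma neg_eid u v : adj G u v -> (neg (eid u v).-1).+1 = eid v u.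
Proof.
move/eid_spec=> [p pN [-> E]] /=; rewrite -eid_arcn ?neg_lt //.
by rewrite arcn_neg // E.
Qed.

Lemma eid_lt u v : adj G u v -> (eid u v).-1 < N.
Proof. by move/eid_spec=> [p pN [->]]. Qed.

Lemma arcn_eid u v : adj G u v -> arcn (eid u v).-1 = (u, v).
Proof. by move/eid_spec=> [p pN [->]]. Qed.

Lemma low_swap p : p < N -> low (neg p) = low p.
Proof. by move=> pN; rewrite /low arcn_neg //= -lab_sym // arcn_adj. Qed.

Lemma high_swap p : p < N -> high (neg p) = high p.
Proof. by move=> pN; rewrite /high arcn_neg //= -lab_sym // arcn_adj. Qed.

End Instance.

Lemma row_inj k a b x y : x < k -> y < k -> a * k + x = b * k + y -> a = b /\ x = y.
Proof.
move=> xk yk E; have k0 : 0 < k by case: k xk {yk E}.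
have := congr1 (divn^~ k) E; rewrite !divnMDl // !divn_small // !addn0 => ab.
by split=> //; move: E; rewrite ab => /addnI.
Qed.

(* Registers 2 and 3 hold [N = 2 m] and [K = 2 n].  The arrays are, for an arc
   [p < N] and vertices [u], [v]:
     6, 7   tail and head of [p];         8, 9   extreme labels of [p];
     10     number of the reverse of [p];
     11     [u] |-> [u * n];              12     [p] |-> [p * K];
     13     [u * n + v] |-> [eid u v];
     14, 15 degree of [u], and list of the arcs out of [u] from [u * n] on;
     16     successors of [p] in the augmented digraph, from [p * K] on,
            each one increased by 1;
     17, 18 roots of the search, and node to be compared with each root;
     19, 20 visited nodes, and next slot to be explored;
     21, 22 stack, and finished nodes;
     23     arcs on no directed triangle;
     24, 25 vertices already sorted, and vertices that must wait. *)
Definition arc_tables : cmd :=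
  For 4 1
    (Store 6 (Reg 4) (Get 0 (Reg 4)) ;; Store 6 (Add (Reg 1) (Reg 4)) (Get 1 (Reg 4)) ;;
     Store 7 (Reg 4) (Get 1 (Reg 4)) ;; Store 7 (Add (Reg 1) (Reg 4)) (Get 0 (Reg 4)) ;;
     Store 8 (Reg 4) (Get 3 (Get 2 (Reg 4))) ;; Store 8 (Add (Reg 1) (Reg 4)) (Get 3 (Get 2 (Reg 4))) ;;
     Store 9 (Reg 4) (Get 3 (Defs.Sub (Get 2 (Add (Reg 4) (Const 1))) (Const 1))) ;;
     Store 9 (Add (Reg 1) (Reg 4)) (Get 3 (Defs.Sub (Get 2 (Add (Reg 4) (Const 1))) (Const 1))) ;;
     Store 10 (Reg 4) (Add (Reg 1) (Reg 4)) ;; Store 10 (Add (Reg 1) (Reg 4)) (Reg 4)).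

Definition id_tables : cmd :=
  For 4 2
    (Assign 7 (Get 6 (Reg 4)) ;; Assign 8 (Get 14 (Reg 7)) ;;
     Store 13 (Add (Get 11 (Reg 7)) (Get 7 (Reg 4))) (Add (Reg 4) (Const 1)) ;;
     Store 15 (Add (Get 11 (Reg 7)) (Reg 8)) (Reg 4) ;;
     Store 14 (Reg 7) (Add (Reg 8) (Const 1)) ;;
     Store 17 (Reg 4) (Reg 4) ;; Store 18 (Reg 4) (Reg 4)).

Definition tables : cmd :=
  Assign 2 (Add (Reg 1) (Reg 1)) ;; Assign 3 (Add (Reg 0) (Reg 0)) ;;
  multiples 11 0 0 ;; multiples 12 2 3 ;; arc_tables ;; id_tables.

Section Tables.
Variables (n : nat) (G : mtgraph 'I_n) (es : seq ('I_n * 'I_n)).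
Hypothesis esG : edge_list G es.
Variable x0 : 'I_n * 'I_n.

Notation m := (size es).
Notation N := (m + m).
Notation K := (n + n).
Notation arcn := (arcn es x0).
Notation tl := (tl es x0).
Notation hd := (hd es x0).
Notation low := (low G es x0).
Notation high := (high G es x0).
Notation neg := (neg es).
Notation eid := (eid es).

Definition nbrs (u : 'I_n) i : seq nat := [seq p <- iota 0 i | tl p == u].

Record arc_facts s p : Prop := ArcFacts {
  fTL : arrays s 6 p = tl p;
  fHD : arrays s 7 p = hd p;
  fLO : arrays s 8 p = low p;
  fHI : arrays s 9 p = high p;
  fNEG : arrays s 10 p = neg p }.

(** What the later phases read and never overwrite; [base_frame] carries it across each of them. *)
Record base s : Prop := Base {
  r0 : regs s 0 = n;
  r1 : regs s 1 = m;
  r2 : regs s 2 = N;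
  r3 : regs s 3 = K;
  aAF : forall p, p < N -> arc_facts s p;
  aRB : forall u, u < n -> arrays s 11 u = u * n;
  aR2 : forall p, p < N -> arrays s 12 p = p * K;
  aID : forall u v : 'I_n, arrays s 13 (u * n + v) = eid u v;
  aNB : forall u : 'I_n, mkseq (fun j => arrays s 15 (u * n + j)) (arrays s 14 u) = nbrs u N }.

Lemma base_frame c s s' :
  all (fun x => x \notin wregs c) (iota 0 4) -> all (fun a => a \notin warrs c) (iota 6 10) ->
  frame c s s' -> base s -> base s'.
Proof.
move=> /allP rc /allP ac [fr fa] [b0 b1 b2 b3 af rb rr bid nb].
have fr' x : x \in iota 0 4 -> regs s' x = regs s x by move/rc/fr.
have fa' a : a \in iota 6 10 -> arrays s' a =1 arrays s a by move/ac/fa.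
split; rewrite ?fr' //.
- by move=> p /af[? ? ? ? ?]; split; rewrite fa'.
- by move=> u /rb; rewrite fa'.
- by move=> u /rr; rewrite fa'.
- by move=> u v; rewrite fa'.
- by move=> u; rewrite -nb fa' //; apply: eq_map => j; rewrite fa'.
Qed.

(** The block of an edge is sorted and nonempty, so its two ends are the extrema; nonemptiness also
    makes the subtraction of 1 exact. *)
Lemma input_labels p : p < m -> let s := input G es in
  arrays s 3 (arrays s 2 p) = low p /\ arrays s 3 (arrays s 2 p.+1 - 1) = high p.
Proof.
move=> pm; rewrite /= (ltnW pm) pm.
set ll := [seq label_list G e | e <- es].
have -> : [seq size (label_list G e) | e <- es] = [seq size l | l <- ll].
  by rewrite /ll -map_comp.
have szl : p < size ll by rewrite size_map.
have nl : nth [::] ll p = sort leq (enum_fset (lab G (arcn p).1 (arcn p).2)).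
  by rewrite (nth_map x0) // arcn_low.
have pN : p < N by lia.
have sz0 : 0 < size (nth [::] ll p).
  by rewrite nl size_sort cardfs_gt0 lab_neq0 // (arcn_adj esG).
split; first by rewrite -[sumn _]addn0 nth_flatten_at // nl nth0.
have szm : p < size [seq size l | l <- ll] by rewrite size_map.
rewrite (take_nth 0) // sumn_rcons (nth_map [::]) // -addnBA //.
by rewrite nth_flatten_at // ?subn1 ?ltn_predL // nth_last nl.
Qed.

Lemma wp_arc_tables s : regs s 1 = m -> (forall a, a < 4 -> arrays s a =1 arrays (input G es) a) ->
  wp arc_tables s (m * 100 + 9) (fun s' => forall p, p < N -> arc_facts s' p).
Proof.
move=> s1 sin.
have labE p : p < m -> [/\ arrays s 0 p = tl p, arrays s 1 p = hd p,
    arrays s 3 (arrays s 2 p) = low p & arrays s 3 (arrays s 2 p.+1 - 1) = high p].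
  move=> pm; have [l1 l2] := input_labels pm; rewrite !sin //; split=> //.
    by rewrite /= (nth_map x0) // /tl arcn_low.
  by rewrite /= (nth_map x0) // /hd arcn_low.
apply: (@wp_for_const 4 1 _ m 89 _ (fun i s' => forall p, p < i -> arc_facts s' p /\ arc_facts s' (m + p))) => //.
  + move=> i s2 lt s2i s21 [fr fa] inv.
    have [E0 E1 E2 E3] := labE i lt.
    have [F0 F1 F2 F3] : [/\ arrays s2 0 =1 arrays s 0, arrays s2 1 =1 arrays s 1,
      arrays s2 2 =1 arrays s 2 & arrays s2 3 =1 arrays s 3] by split; apply: fa.
    have iN : i < N by lia.
    have miE : m + i = neg i by rewrite /neg lt.
    apply: wp_run => // p; rewrite ltnS leq_eqVlt => /orP[/eqP->|pi].
      have ne : (i == m + i) = false by apply/eqP; lia.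
      have nmi : neg (m + i) = i by rewrite /neg ltnNge leq_addr addKn.
      have [M0 M1 M2 M3] : [/\ tl (m + i) = hd i, hd (m + i) = tl i,
          low (m + i) = low i & high (m + i) = high i].
        by rewrite miE /tl /hd (arcn_neg x0 iN) (low_swap esG x0 iN) (high_swap esG x0 iN).
      by split; split; rewrite /= ?s2i ?s21 ?ne ?eqxx ?addn1 ?F3 ?F2 ?F1 ?F0 ?M0 ?M1 ?M2 ?M3 -?miE ?nmi //=.
    have [[? ? ? ? ?] [? ? ? ? ?]] := inv p pi.
    have ne1 : (p == i) = false by apply/eqP; lia.
    have ne2 : (p == m + i) = false by apply/eqP; lia.
    have ne3 : (m + p == i) = false by apply/eqP; lia.
    have ne4 : (m + p == m + i) = false by apply/eqP; lia.
    by split; split; rewrite /= s2i s21 ?ne1 ?ne2 ?ne3 ?ne4.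
  + move=> s2 _ _ inv p pN.
    have [pm|pm] := ltnP p m; first by case: (inv p pm).
    by have [|_] := inv (p - m); rewrite ?subnKC //; lia.
Qed.

Lemma nbrsS u i : nbrs u i.+1 = if tl i == u then rcons (nbrs u i) i else nbrs u i.
Proof. by rewrite /nbrs -addn1 iotaD add0n filter_cat /=; case: ifP; rewrite ?cats1 ?cats0. Qed.

Lemma size_nbrs u i : i <= N -> size (nbrs u i) <= n.
Proof.
move=> iN; rewrite -[leqRHS]card_ord -(size_map (fun p => (arcn p).2)).
have uq : uniq [seq (arcn p).2 | p <- nbrs u i].
  rewrite map_inj_in_uniq ?filter_uniq ?iota_uniq // => p q.
  rewrite !mem_filter !mem_iota !add0n => /andP[/eqP pu pi] /andP[/eqP qu qi] E2.
  apply: (arcn_inj esG (x0 := x0)); [exact: leq_trans pi iN|exact: leq_trans qi iN|].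
  rewrite [LHS]surjective_pairing [RHS]surjective_pairing E2; congr pair.
  by apply: val_inj; exact: etrans pu (esym qu).
by rewrite -(card_uniqP uq) max_card.
Qed.

Definition eid_upto i (u v : 'I_n) : nat :=
  if (u, v) \in take i (arcs es) then (index (u, v) (arcs es)).+1 else 0.

Lemma eid_uptoS i u v : i < N ->
  eid_upto i.+1 u v = if (arcn i) == (u, v) then i.+1 else eid_upto i u v.
Proof.
rewrite -size_arcs => iN; rewrite /eid_upto (take_nth x0) // mem_rcons inE eq_sym.
rewrite -/(arcn i); case: eqP => //= <-.
by rewrite index_uniq // (uniq_arcs esG).
Qed.

Lemma wp_id_tables s : regs s 2 = N -> (forall p, p < N -> arc_facts s p) ->
  (forall u, u < n -> arrays s 11 u = u * n) -> arrays s 13 =1 (fun=> 0) -> arrays s 14 =1 (fun=> 0) ->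
  wp id_tables s (N * 100 + 9) (fun s' =>
   [/\ forall u v : 'I_n, arrays s' 13 (u * n + v) = eid u v,
      forall u : 'I_n, mkseq (fun j => arrays s' 15 (u * n + j)) (arrays s' 14 u) = nbrs u N &
      forall p, p < N -> arrays s' 17 p = p /\ arrays s' 18 p = p]).
Proof.
move=> s2 af rb z13 z14.
apply: (@wp_for_const 4 2 _ N 89 _ (fun i s' =>
  [/\ forall u v : 'I_n, arrays s' 13 (u * n + v) = eid_upto i u v,
      forall u : 'I_n, mkseq (fun j => arrays s' 15 (u * n + j)) (arrays s' 14 u) = nbrs u i &
      forall p, p < i -> arrays s' 17 p = p /\ arrays s' 18 p = p])) => //.
- split=> //= u; first by move=> v; rewrite /eid_upto take0 in_nil z13.
  by rewrite z14.
- move=> i t lt ti _ [fr fa] [i13 i15 i17].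
  have [tTL tHD _ _ _] := af i lt.
  have t6 : arrays t 6 i = tl i by rewrite fa.
  have t7 : arrays t 7 i = hd i by rewrite fa.
  have t11 : arrays t 11 (tl i) = tl i * n by rewrite fa // rb /tl.
  apply: wp_run => //=; rewrite ti t6 t7 t11 !addn1.
  set a := (arcn i).1; set d := arrays t 14 (tl i).
  have tlE : tl i = a by [].
  have dE : d = size (nbrs a i) by rewrite -i15 size_mkseq.
  (* Neighbours are distinct, so an arc not yet listed leaves room: the write stays within the row
     of its tail. *)
  have dn : d < n.
    have := @size_nbrs a i.+1 lt; rewrite nbrsS tlE eqxx size_rcons.
    by rewrite -dE.
  split.
  + move=> u v; rewrite eid_uptoS // i13; case: eqP => [E|ne].
      have [ua va] : a = u :> nat /\ hd i = v.
        by have [] := row_inj (ltn_ord v) (ltn_ord (arcn i).2) E; rewrite /hd.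
      case: eqP => // -[]; rewrite [arcn i]surjective_pairing.
      by congr pair; apply: val_inj.
    case: eqP => // E; case: ne.
    by rewrite /hd tlE /a E.
  + move=> u; rewrite nbrsS tlE; case: eqP => [E|ne].
      rewrite (_ : u = a); last by apply: val_inj.
      rewrite eqxx; rewrite /mkseq -[d.+1]addn1 iotaD map_cat /= eqxx cats1; congr rcons.
      rewrite -i15 /mkseq -/d; apply/eq_in_map => j; rewrite mem_iota add0n /= => jd.
      by case: eqP => // /addnI E'; rewrite -E' ltnn in jd.
    have -> : (nat_of_ord a == u) = false by apply/eqP => E; apply: ne.
    rewrite -i15 /mkseq; apply/eq_in_map => j; rewrite mem_iota add0n /= => ju.
    case: eqP => // E; case: ne.
    have jn : j < n.
      apply: leq_trans ju _; have := congr1 size (i15 u); rewrite size_mkseq => ->.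
      by apply: size_nbrs; exact: ltnW.
    by have [] := row_inj jn dn E.
  + move=> p; rewrite ltnS leq_eqVlt; case: eqP => [->//|_ /=]; exact: i17.
move=> t _ _ [i13 i15 i17]; split=> // u v; rewrite i13 /eid_upto take_oversize //.
by rewrite size_arcs.
Qed.

Lemma wp_tables : wp tables (input G es) (n * 20 + m * 400 + 200) (fun s =>
  [/\ base s, forall p, p < N -> arrays s 17 p = p /\ arrays s 18 p = p &
      forall a, 15 < a -> a != 17 -> a != 18 -> arrays s a =1 (fun=> 0)]).
Proof.
apply: wp_le.
- apply: wp_seq_frame.
    by apply: (@wp_run _ _ 4 (fun s => regs s 2 = N)).
  move=> s1 e1 f1; apply: wp_seq_frame.
    apply: (@wp_run _ _ 4 (fun s => regs s 3 = K)) => //=.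
    by rewrite f1.1.
  move=> s2 e2 f2; apply: wp_seq_frame.
    by apply: (@wp_multiples _ _ _ _ n n); rewrite ?f2.1 ?f1.1.
  move=> s3 e3 f3; apply: wp_seq_frame.
    by apply: (@wp_multiples _ _ _ _ N K); rewrite ?f3.1 ?e2 ?f2.1 ?e1.
  move=> s4 e4 f4; apply: wp_seq_frame.
    apply: wp_arc_tables; first by rewrite f4.1 ?f3.1 ?f2.1 ?f1.1.
    by move=> a a4 j; rewrite f4.2 ?f3.2 ?f2.2 ?f1.2 //= ?inE; lia.
  move=> s5 e5 f5; apply: wp_weaken _ (leqnn _) _.
    apply: wp_frame; apply: wp_id_tables => //.
    + by rewrite f5.1 ?f4.1 ?f3.1 ?f2.1.
    + by move=> u un; rewrite f5.2 ?f4.2 // e3.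
    + by move=> j; rewrite f5.2 ?f4.2 ?f3.2 ?f2.2 ?f1.2.
    + by move=> j; rewrite f5.2 ?f4.2 ?f3.2 ?f2.2 ?f1.2.
  move=> s6 [[i13 i15 i17] f6]; split=> //.
    split=> //.
    + by rewrite f6.1 ?f5.1 ?f4.1 ?f3.1 ?f2.1 ?f1.1.
    + by rewrite f6.1 ?f5.1 ?f4.1 ?f3.1 ?f2.1 ?f1.1.
    + by rewrite f6.1 ?f5.1 ?f4.1 ?f3.1 ?f2.1 ?e1.
    + by rewrite f6.1 ?f5.1 ?f4.1 ?f3.1 ?e2.
    + by move=> p /e5[*]; split; rewrite f6.2.
    + by move=> u un; rewrite f6.2 ?f5.2 ?f4.2 // e3.
    + by move=> p pN; rewrite f6.2 ?f5.2 // e4.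
  move=> [|[|[|[|a]]]] // a15 a17 a18 j.
  by rewrite f6.2 ?f5.2 ?f4.2 ?f3.2 ?f2.2 ?f1.2 //= !inE; lia.
- lia.
Qed.

End Tables.

(** * The augmented digraph *)

Local Notation pred_of e := (Defs.Sub e (Const 1)).

(** For p = (x, y) and a vertex z, registers 9 and 10 hold [eid y z] and [eid x z]. Guards do not
    short-circuit: for a missing edge the lookups return the data of arc 0, which the tests on
    registers 9 and 10 mask. *)
Definition imp_cells : cmd :=
  (Assign 9 (Get 13 (Add (Get 11 (Reg 8)) (Reg 5))) ;;
   Assign 10 (Get 13 (Add (Get 11 (Reg 7)) (Reg 5))) ;;
   If (EAnd (Reg 9) (EAnd (Leq (Get 8 (Reg 4)) (Get 9 (pred_of (Reg 9))))
        (EOr (ENot (Reg 10)) (ELt (Get 8 (pred_of (Reg 10))) (Get 9 (pred_of (Reg 9)))))))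
     (Store 16 (Add (Get 12 (Reg 4)) (Reg 5)) (Add (Get 10 (pred_of (Reg 9))) (Const 1))) Skip ;;
   If (EAnd (Reg 10) (EAnd (Leq (Get 8 (pred_of (Reg 10))) (Get 9 (Reg 4)))
        (EOr (ENot (Reg 9)) (ELt (Get 8 (pred_of (Reg 9))) (Get 9 (Reg 4))))))
     (Store 16 (Add (Add (Get 12 (Reg 4)) (Reg 0)) (Reg 5)) (Reg 10)) Skip).

Definition imp_rows : cmd :=
  For 4 2 ((Assign 7 (Get 6 (Reg 4)) ;; Assign 8 (Get 7 (Reg 4))) ;; For 5 0 imp_cells).

(** Here p = (b, c), and d runs through the neighbours of b. The second arc leaves (c, a), so it is
    written in the row of that arc and not in the row of p. *)
Definition corr_cells : cmd :=
  Assign 13 (Get 15 (Add (Get 11 (Reg 7)) (Reg 6))) ;;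
  Assign 14 (Get 7 (Reg 13)) ;;
  Assign 15 (Get 13 (Add (Get 11 (Reg 8)) (Reg 14))) ;;
  Assign 16 (Get 13 (Add (Get 11 (Reg 5)) (Reg 14))) ;;
  If (EAnd (Leq (Get 8 (Reg 13)) (Reg 11)) (EAnd (Reg 15) (EAnd (ELt (Reg 11) (Get 8 (pred_of (Reg 15))))
       (EOr (ENot (Reg 16)) (ELt (Get 8 (pred_of (Reg 16))) (Reg 11))))))
    (Store 16 (Add (Get 12 (Reg 4)) (Reg 5)) (Reg 10) ;;
     Store 16 (Add (Add (Get 12 (Get 10 (pred_of (Reg 10)))) (Reg 0)) (Reg 7)) (Add (Get 10 (Reg 4)) (Const 1)))
    Skip.

Definition mono_test : expr :=
  EAnd (Reg 9) (EAnd (Reg 10) (EAnd (EEq (Get 9 (Reg 4)) (Reg 11))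
       (EAnd (EEq (Get 8 (pred_of (Reg 9))) (Reg 11)) (EAnd (EEq (Get 9 (pred_of (Reg 9))) (Reg 11))
       (EAnd (EEq (Get 8 (pred_of (Reg 10))) (Reg 11)) (EEq (Get 9 (pred_of (Reg 10))) (Reg 11))))))).

Definition corr_row : cmd :=
  (Assign 9 (Get 13 (Add (Get 11 (Reg 5)) (Reg 7))) ;;
   Assign 10 (Get 13 (Add (Get 11 (Reg 5)) (Reg 8))) ;;
   Assign 11 (Get 8 (Reg 4)) ;;
   Assign 12 (Get 14 (Reg 7))) ;;
  If mono_test (For 6 12 corr_cells) Skip.

Definition corr_rows : cmd :=
  For 4 2 ((Assign 7 (Get 6 (Reg 4)) ;; Assign 8 (Get 7 (Reg 4))) ;; For 5 0 corr_row).

Section Successors.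
Variables (n : nat) (G : mtgraph 'I_n) (es : seq ('I_n * 'I_n)).
Hypothesis esG : edge_list G es.
Variable x0 : 'I_n * 'I_n.

Notation m := (size es).
Notation N := (m + m).
Notation K := (n + n).
Notation arcn := (arcn es x0).
Notation tl := (tl es x0).
Notation hd := (hd es x0).
Notation low := (low G es x0).
Notation high := (high G es x0).
Notation eid := (eid es).
Notation base := (base G es x0).

(* Slot [k < n] of row [p] is for the arc with tail [k] and the head of [p];
   slot [n + k] is for the arc with the tail of [p] and head [k]. *)
Definition slot p k q : bool :=
  if k < n then (tl q == k) && (hd q == hd p) else (tl q == tl p) && (hd q == k - n).

(** The case p = q arises when the vertex tried is an endpoint of p, where [imp_cond] holds on a
    degenerate triple. Such a loop is harmless because forcing is reflexive. *)
Definition sound_cells (A : nat -> nat) : Prop := forall p k, p < N -> k < K ->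
  A (p * K + k) = 0 \/ exists q, [/\ q < N, A (p * K + k) = q.+1, slot p k q &
                               aug_arc G (arcn p) (arcn q) \/ p = q].

Definition upd (A : nat -> nat) i v := fun j => if j == i then v else A j.

Lemma sound_upd A p k q : sound_cells A -> p < N -> k < K -> q < N -> slot p k q ->
  aug_arc G (arcn p) (arcn q) \/ p = q -> sound_cells (upd A (p * K + k) q.+1).
Proof.
move=> so pN kK qN sl st p' k' p'N k'K; rewrite /upd; case: eqP => [E|_]; last exact: so.
by right; have [<- <-] := row_inj kK k'K (esym E); exists q.
Qed.

(** A slot determines its arc. For completeness it thus suffices that a cell be nonzero, and a sound
    rewrite cannot spoil it. *)
Lemma slot_inj p k q q' : q < N -> q' < N -> slot p k q -> slot p k q' -> q = q'.
Proof.
move=> qN q'N; rewrite /slot => s1 s2; apply: (arcn_inj esG qN q'N (x0 := x0)).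
rewrite [LHS]surjective_pairing [RHS]surjective_pairing.
by move: s1 s2; case: ifP => _ /andP[/eqP t1 /eqP h1] /andP[/eqP t2 /eqP h2];
  congr pair; apply: val_inj; [exact: etrans t1 (esym t2)|exact: etrans h1 (esym h2)|exact: etrans t1 (esym t2)|exact: etrans h1 (esym h2)].
Qed.

Definition imp_filled (A : nat -> nat) p (z : 'I_n) : Prop :=
  (imp_cond G (arcn p).1 (arcn p).2 z -> A (p * K + z) != 0) /\
  (imp_cond G z (arcn p).1 (arcn p).2 -> A (p * K + (n + z)) != 0).

Lemma upd_neq0 A v j i : v != 0 -> A j != 0 -> upd A i v j != 0.
Proof. by rewrite /upd; case: (j == i). Qed.

Lemma upd_eq A i v : upd A i v i = v.
Proof. by rewrite /upd eqxx. Qed.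

Lemma eid_fields s : base s -> forall u v, adj G u v ->
  [/\ eid u v != 0, arrays s 8 (eid u v - 1) = lo (lab G u v),
    arrays s 9 (eid u v - 1) = hi (lab G u v) & arrays s 10 (eid u v - 1) + 1 = eid v u].
Proof.
move=> bs u v uv; rewrite -lt0n (eid_gt0 esG) uv subn1 addn1.
have [_ _ -> -> ->] := aAF bs (eid_lt esG x0 uv).
by rewrite (low_eid esG) // (high_eid esG) // (neg_eid esG).
Qed.

Lemma imp_cells_run s i (z : 'I_n) : base s -> i < N -> regs s 4 = i -> regs s 5 = z ->
  regs s 7 = tl i -> regs s 8 = hd i -> sound_cells (arrays s 16) ->
  let A := arrays s 16 in let A' := arrays (run imp_cells s) 16 in
  [/\ sound_cells A', imp_filled A' i z & forall j, A j != 0 -> A' j != 0].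
Proof.
move=> bs iN s4 s5 s7 s8 so.
set x := (arcn i).1; set y := (arcn i).2.
have xy : adj G x y by exact: arcn_adj.
have [fTL fHD fLO fHI fNEG] := aAF bs iN.
have rowx : arrays s 11 (tl i) = x * n by rewrite (aRB bs) /tl.
have rowy : arrays s 11 (hd i) = y * n by rewrite (aRB bs) /hd.
have row2 : arrays s 12 i = i * K by exact: aR2 bs _ iN.
have fE := eid_fields bs.
have e0 u v : adj G u v = false -> eid u v = 0.
  by move=> uv; apply/eqP; rewrite (eid_eq0 esG) uv.
rewrite /imp_cells /= !truthE /= s4 s5 s7 s8 rowx rowy !(aID bs) fLO row2.
have C1 : [&& eid y z != 0, low i <= arrays s 9 (eid y z - 1) & (eid x z == 0)
    || (arrays s 8 (eid x z - 1) < arrays s 9 (eid y z - 1))] = imp_cond G x y z.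
  rewrite /imp_cond xy /=; case yz: (adj G y z); last by rewrite (e0 _ _ yz).
  have [-> _ -> _] := fE _ _ yz; rewrite (eid_eq0 esG).
  by case xz: (adj G x z) => //=; have [_ -> _ _] := fE _ _ xz.
have C2 : [&& eid x z != 0, arrays s 8 (eid x z - 1) <= high i & (eid y z == 0)
    || (arrays s 8 (eid y z - 1) < high i)] = imp_cond G z x y.
  rewrite /imp_cond xy /= [adj G z x]adj_sym [adj G z y]adj_sym.
  case xz: (adj G x z); last by rewrite (e0 _ _ xz).
  have [-> -> _ _] := fE _ _ xz; rewrite (eid_eq0 esG) (lC xz) /=.
  by case yz: (adj G y z) => //=; have [_ -> _ _] := fE _ _ yz; rewrite (lC yz).
have ad1 : imp_cond G x y z -> adj G y z by case/and4P.
have ad2 : imp_cond G z x y -> adj G x z by rewrite adj_sym => /and4P[].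
have st1 A : imp_cond G x y z -> sound_cells A -> sound_cells (upd A (i * K + z) (eid z y)).
  move=> c1 soA; have zy : adj G z y by rewrite adj_sym ad1.
  have [q qN [-> qE]] := eid_spec esG x0 zy; apply: sound_upd => //.
  - by rewrite ltn_addr.
  - by rewrite /slot ltn_ord /tl /hd qE !eqxx.
  have [xz|xz] := eqVneq x z.
    by right; apply: (arcn_inj esG iN qN (x0 := x0)); rewrite qE [LHS]surjective_pairing -/x -/y xz.
  by left; rewrite qE [arcn i]surjective_pairing; apply/aug_arcP; exact: AugImpHead.
have st2 A : imp_cond G z x y -> sound_cells A -> sound_cells (upd A (i * K + (n + z)) (eid x z)).
  move=> c2 soA; have [q qN [-> qE]] := eid_spec esG x0 (ad2 c2); apply: sound_upd => //.
  - by rewrite ltn_add2l.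
  - by rewrite /slot ltnNge leq_addr addKn /tl /hd qE !eqxx.
  have [yz|yz] := eqVneq z y.
    by right; apply: (arcn_inj esG iN qN (x0 := x0)); rewrite qE [LHS]surjective_pairing -/x -/y yz.
  by left; rewrite qE [arcn i]surjective_pairing; apply/aug_arcP; exact: AugImpTail.
have g1 : imp_cond G x y z -> eid z y != 0.
  by move/ad1; rewrite adj_sym -(eid_gt0 esG) lt0n.
have g2 : imp_cond G z x y -> eid x z != 0.
  by move/ad2; rewrite -(eid_gt0 esG) lt0n.
rewrite C1; case c1: (imp_cond G x y z) => /=; rewrite ?truthE /= s4 s5 fHI C2 row2;
  case c2: (imp_cond G z x y) => /=; rewrite ?s4 ?s5 ?(r0 bs) ?row2 -?addnA.
- have [_ _ _ ->] := fE _ _ (ad1 c1).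
  rewrite -[fun j => _]/(upd (upd (arrays s 16) (i * K + z) (eid z y)) (i * K + (n + z)) (eid x z)).
  split; [by apply: st2 => //; apply: st1| |by move=> j Aj; exact: (upd_neq0 (i * K + (n + z)) (g2 c2) (upd_neq0 (i * K + z) (g1 c1) Aj))].
  split=> _; last by rewrite upd_eq g2.
  by apply: upd_neq0; [exact: g2|rewrite upd_eq g1].
- have [_ _ _ ->] := fE _ _ (ad1 c1).
  rewrite -[fun j => _]/(upd (arrays s 16) (i * K + z) (eid z y)).
  split; [exact: st1| |by move=> j Aj; exact: (upd_neq0 (i * K + z) (g1 c1) Aj)].
  by split; rewrite ?c2 // upd_eq g1.
- rewrite -[fun j => _]/(upd (arrays s 16) (i * K + (n + z)) (eid x z)).
  split; [exact: st2| |by move=> j Aj; exact: (upd_neq0 (i * K + (n + z)) (g2 c2) Aj)].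
  by split; rewrite ?c1 // upd_eq g2.
- by split=> //; split; rewrite ?c1 ?c2.
Qed.

Definition imp_table (A : nat -> nat) i : Prop :=
  sound_cells A /\ forall p, p < i -> forall z, imp_filled A p z.

Lemma imp_filled_mono A A' p z : (forall j, A j != 0 -> A' j != 0) ->
  imp_filled A p z -> imp_filled A' p z.
Proof. by move=> AA [f1 f2]; split=> c; apply: AA; [exact: f1|exact: f2]. Qed.

Lemma wp_imp_rows s : base s -> arrays s 16 =1 (fun=> 0) ->
  wp imp_rows s (N * (n * 200 + 100) + 9) (fun s' => imp_table (arrays s' 16) N).
Proof.
move=> bs z16.
apply: (@wp_for_const 4 2 _ N (n * 200 + 80) _ (fun i s' => imp_table (arrays s' 16) i)) => //.
- exact: r2 bs.
- by split=> // p k _ _; left; exact: z16.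
- move=> i s1 iN s1i _ f1 [so1 im1].
  have bs1 : base s1 by apply: base_frame f1 bs.
  have [fTL fHD _ _ _] := aAF bs1 iN.
  apply: wp_le.
    apply: wp_seq_frame.
      apply: (@wp_run _ _ 7 (fun s2 => [/\ regs s2 7 = tl i, regs s2 8 = hd i, regs s2 4 = i &
         arrays s2 16 = arrays s1 16])) => //=.
      by rewrite s1i fTL fHD.
    move=> s2 [s2x s2y s2i s2A] f2.
    have bs2 : base s2 by apply: base_frame f2 bs1.
    apply: (@wp_for_const 5 0 _ n 180 _ (fun j s' => [/\ sound_cells (arrays s' 16),
        forall p, p < i -> forall z, imp_filled (arrays s' 16) p z &
        forall z : 'I_n, z < j -> imp_filled (arrays s' 16) i z])) => //.
    + exact: r0 bs2.
    + by rewrite /= s2A; split.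
    + move=> j s3 jn s3j _ f3 [so3 im3 iz3].
      have bs3 : base s3 by apply: base_frame f3 bs2.
      have [] := @imp_cells_run s3 i (Ordinal jn) bs3 iN _ s3j _ _ so3; rewrite ?f3.1 //.
      move=> so4 fi4 mono4; apply: wp_run; [by []|by vm_compute|].
      split=> // [p pi z|z]; first by apply: imp_filled_mono (im3 p pi z).
      rewrite ltnS leq_eqVlt => /orP[/eqP zj|zj]; last by apply: imp_filled_mono (iz3 z zj).
      by rewrite (_ : z = Ordinal jn) //; apply: val_inj.
    + move=> s3 _ _ [so3 im3 iz3]; split=> //= p; rewrite ltnS leq_eqVlt => /orP[/eqP-> z|/im3//].
      exact: iz3.
  lia.
- lia.
Qed.

End Successors.

(** * Arcs given by correlated monolabel triangles *)

Section Correlations.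
Variables (n : nat) (G : mtgraph 'I_n) (es : seq ('I_n * 'I_n)).
Hypothesis esG : edge_list G es.
Variable x0 : 'I_n * 'I_n.

Notation m := (size es).
Notation N := (m + m).
Notation K := (n + n).
Notation arcn := (arcn es x0).
Notation tl := (tl es x0).
Notation hd := (hd es x0).
Notation low := (low G es x0).
Notation high := (high G es x0).
Notation eid := (eid es).
Notation base := (base G es x0).
Notation nbrs := (nbrs es x0).
Notation sound_cells := (sound_cells G es x0).
Notation slot := (slot es x0).

Definition corr_slots (A : nat -> nat) i (a : 'I_n) : Prop :=
  A (i * K + a) != 0 /\ A ((eid (arcn i).2 a).-1 * K + (n + (arcn i).1)) != 0.

Definition corr_filled (A : nat -> nat) i (a : 'I_n) : Prop :=
  forall d T, corr_cond G a (arcn i).1 (arcn i).2 d T -> corr_slots A i a.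

Definition grows (A A' : nat -> nat) : Prop :=
  (sound_cells A -> sound_cells A') /\ forall j, A j != 0 -> A' j != 0.

Lemma grows_trans A A' A'' : grows A A' -> grows A' A'' -> grows A A''.
Proof.
by move=> [h1 h2] [h3 h4]; split=> [so|j Aj]; [apply/h3/h1|apply/h4/h2].
Qed.

Lemma corr_cells_run s i (a d : 'I_n) q j T : base s -> i < N ->
  mono_edge G a (arcn i).1 T -> mono_edge G (arcn i).1 (arcn i).2 T -> mono_edge G a (arcn i).2 T ->
  regs s 4 = i -> regs s 5 = a -> regs s 6 = j -> regs s 7 = tl i -> regs s 8 = hd i ->
  regs s 10 = eid a (arcn i).2 -> regs s 11 = T ->
  q < N -> arcn q = ((arcn i).1, d) -> arrays s 15 (tl i * n + j) = q ->
  let A := arrays s 16 in let A' := arrays (run corr_cells s) 16 in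
  grows A A' /\ (corr_cond G a (arcn i).1 (arcn i).2 d T -> corr_slots A' i a).
Proof.
move=> bs iN; set b := (arcn i).1; set c := (arcn i).2.
move=> mab mbc mac s4 s5 s6 s7 s8 s10 s11 qN qE qj.
have F := eid_fields esG bs.
have [fTL fHD fLO fHI fNEG] := aAF bs iN.
have [gTL gHD gLO gHI gNEG] := aAF bs qN.
have rowb : arrays s 11 (tl i) = tl i * n by rewrite (aRB bs) /tl.
have rowc : arrays s 11 (hd i) = c * n by rewrite (aRB bs) /hd.
have rowa : arrays s 11 a = a * n by rewrite (aRB bs).
have row2 : arrays s 12 i = i * K by exact: aR2 bs _ iN.
have dE : hd q = d by rewrite /hd qE.
have lowE : low q = lo (lab G b d) by rewrite /low qE.
have bd : adj G b d by have := arcn_adj esG x0 qN; rewrite qE.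
have [ac lac hac] := mac; have [bc lbc hbc] := mbc.
have ca : adj G c a by rewrite adj_sym.
have [eac _ _ nac'] := F _ _ ac.
have nac : arrays s 10 (eid a c - 1) = (eid c a).-1 by rewrite -nac' addn1.
have cN : (eid c a).-1 < N by exact: (eid_lt esG x0 ca).
have row2' : arrays s 12 (eid c a).-1 = (eid c a).-1 * K by exact: aR2 bs _ cN.
have iE : i = (eid b c).-1 by rewrite /b /c (eid_arcn esG x0 iN).
have negi : arrays s 10 i + 1 = eid c b.
  by rewrite -(neg_eid esG x0 bc) -iE fNEG addn1.
have C0 : [&& low q <= T, eid c d != 0, T < arrays s 8 (eid c d - 1)
    & (eid a d == 0) || (arrays s 8 (eid a d - 1) < T)] <-> corr_cond G a b c d T.
  rewrite lowE; split.
    case/and4P=> bdT cd0 cdT ad0; have cd : adj G c d by rewrite -(eid_gt0 esG) lt0n.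
    split=> //; split=> //; first by have [_ <- _ _] := F _ _ cd.
    by move=> ad; move: ad0; have [/negbTE-> -> _ _] := F _ _ ad.
  case=> _ [_ -> cd cdT ad]; have [-> -> _ _] := F _ _ cd; rewrite cdT /=.
  rewrite (eid_eq0 esG); case adE: (adj G a d) => //=; have [_ -> _ _] := F _ _ adE.
  exact: ad.
rewrite /corr_cells /= !truthE /= s4 s5 s6 s7 s8 s10 s11 rowb qj gHD dE rowc rowa !(aID bs) gLO.
case: ifP => [/C0 cr|nC]; last first.
  split; first by split.
  by move/C0; rewrite nC.
rewrite nac row2 row2' (r0 bs) negi -addnA -[tl i]/(nat_of_ord b).
have [p1 p1N [p1E q1E]] := eid_spec esG x0 ac.
have cb : adj G c b by rewrite adj_sym.
have [p2 p2N [p2E q2E]] := eid_spec esG x0 cb.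
have e0 : eid a c != 0 by rewrite p1E.
have e1 : eid c b != 0 by rewrite p2E.
pose A' := upd (upd (arrays s 16) (i * K + a) (eid a c)) ((eid c a).-1 * K + (n + b)) (eid c b).
rewrite -/A'; suff : grows (arrays s 16) A' /\ (corr_cond G a b c d T -> corr_slots A' i a) by [].
split; last first.
  by move=> _; rewrite /corr_slots /A' upd_eq; split=> //; apply: upd_neq0; rewrite ?upd_eq.
split; last by move=> j' Aj'; exact: (upd_neq0 _ e1 (upd_neq0 _ e0 Aj')).
move=> so; rewrite /A' p2E; apply: sound_upd => //.
- rewrite p1E; apply: sound_upd => //; first by rewrite ltn_addr.
    by rewrite /slot ltn_ord /tl /hd q1E !eqxx.
  left; rewrite q1E [arcn i]surjective_pairing; apply/aug_arcP.
  exact: AugCorrHead cr.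
- by rewrite ltn_add2l.
- by rewrite /slot ltnNge leq_addr addKn /tl /hd q2E (arcn_eid esG x0 ca) !eqxx.
- by left; rewrite q2E (arcn_eid esG x0 ca); apply/aug_arcP; exact: AugCorrTail cr.
Qed.

(* Number of iterations of [corr_cells] for the [i]-th arc and the vertex [k]. *)
Definition weight i (k : nat) : nat :=
  oapp (fun a : 'I_n => mono_triangle G a (arcn i).1 (arcn i).2 * size (nbrs (arcn i).1 N)) 0 (insub k).

Lemma nbrs_size s : base s -> forall u : 'I_n, arrays s 14 u = size (nbrs u N).
Proof. by move=> bs u; rewrite -(aNB bs u) size_mkseq. Qed.

Lemma nbrs_nth s : base s -> forall (u : 'I_n) j, j < size (nbrs u N) ->
  arrays s 15 (u * n + j) = nth 0 (nbrs u N) j.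
Proof. by move=> bs u j lt; rewrite -(aNB bs u) nth_mkseq // nbrs_size. Qed.

Lemma mem_nbrs (u : 'I_n) q : (q \in nbrs u N) = (q < N) && (tl q == u).
Proof. by rewrite mem_filter mem_iota add0n andbC. Qed.

Lemma wp_corr_row s i (a : 'I_n) : base s -> i < N -> regs s 4 = i -> regs s 5 = a ->
  regs s 7 = tl i -> regs s 8 = hd i ->
  wp corr_row s (weight i a * 200 + 200) (fun s' =>
    grows (arrays s 16) (arrays s' 16) /\ corr_filled (arrays s' 16) i a).
Proof.
move=> bs iN s4 s5 s7 s8.
set b := (arcn i).1; set c := (arcn i).2.
have [fTL fHD fLO fHI fNEG] := aAF bs iN.
have rowa : arrays s 11 a = a * n by rewrite (aRB bs).
have F := eid_fields esG bs.
have bc : adj G b c by exact: arcn_adj.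
have C0 : reflect (exists T, [/\ mono_edge G a b T, mono_edge G b c T & mono_edge G a c T])
  [&& eid a b != 0, eid a c != 0, high i == low i, arrays s 8 (eid a b - 1) == low i,
      arrays s 9 (eid a b - 1) == low i, arrays s 8 (eid a c - 1) == low i &
      arrays s 9 (eid a c - 1) == low i].
  apply: (iffP idP) => [/and5P[ab0 ac0 /eqP hl /eqP lab1 /and3P[/eqP hab /eqP lac /eqP hac]]|].
    have ab : adj G a b by rewrite -(eid_gt0 esG) lt0n.
    have ac : adj G a c by rewrite -(eid_gt0 esG) lt0n.
    have [_ E1 E2 _] := F _ _ ab; have [_ E3 E4 _] := F _ _ ac.
    by exists (low i); split; split; rewrite // -?E1 -?E2 -?E3 -?E4.
  case=> T [[ab l1 h1] [_ l2 h2] [ac l3 h3]].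
  have [-> -> -> _] := F _ _ ab; have [-> -> -> _] := F _ _ ac.
  have lT : low i = T by [].
  have hT : high i = T by [].
  by rewrite l1 h1 l3 h3 lT hT !eqxx.
have wE : weight i a = mono_triangle G a b c * size (nbrs b N) by rewrite /weight valK.
apply: wp_le.
  apply: wp_seq_frame.
    apply: (@wp_run _ _ 30 (fun s2 => [/\ regs s2 9 = eid a b, regs s2 10 = eid a c,
      regs s2 11 = low i, regs s2 12 = size (nbrs b N) & arrays s2 = arrays s])) => //=.
    rewrite s4 s5 s7 s8 rowa -[tl i]/(nat_of_ord b) -[hd i]/(nat_of_ord c).
    by rewrite !(aID bs) fLO -(nbrs_size bs).
  move=> s2 [s29 s210 s211 s212 s2A] f2.
  have bs2 : base s2 by apply: base_frame f2 bs.
  have test2 : (eval s2 mono_test != 0) = mono_triangle G a b c.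
    rewrite /mono_test !truthE /= (f2.1 4) // s4 s29 s210 s211 s2A fHI.
    by apply/C0/mono_triangleP.
  apply: (@wp_if _ _ _ _ (weight i a * 111 + 10)); last first.
    rewrite -[_ == 0]negbK test2 => nc; apply: wp_run => //; first by rewrite /= addn_gt0 orbT.
    rewrite /= s2A; split; first by split.
    by move=> d T [mo _]; case/mono_triangleP: nc; exists T.
  rewrite test2 => mono; have exT := mono_triangleP _ _ _ _ mono.
  have [T [mab mbc mac]] := exT.
    have lT : low i = T by case: mbc.
    apply: (@wp_for_const 6 12 _ (size (nbrs b N)) 100 _ (fun j s' => grows (arrays s2 16) (arrays s' 16) /\
        forall q, q \in take j (nbrs b N) -> forall d, arcn q = (b, d) ->
        corr_cond G a b c d T -> corr_slots (arrays s' 16) i a)) => //.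
    - by split; [split|rewrite take0].
    - move=> j s3 lt s3j _ f3 [g3 c3].
      have bs3 : base s3 by apply: base_frame f3 bs2.
      set q := nth 0 (nbrs b N) j.
      have qin : q \in nbrs b N by rewrite mem_nth.
      have [qN qb] : q < N /\ (arcn q).1 = b.
        by move: qin; rewrite mem_nbrs => /andP[-> /eqP/val_inj].
      have qE : arcn q = (b, (arcn q).2) by rewrite -qb -surjective_pairing.
      have qj : arrays s3 15 (tl i * n + j) = q by rewrite -[tl i]/(nat_of_ord b) nbrs_nth.
      have [] := @corr_cells_run s3 i a _ q j T bs3 iN mab mbc mac _ _ s3j _ _ _ _ qN qE qj;
        try by rewrite f3.1 // ?s210 ?s211 ?lT ?f2.1.
      move=> g4 c4; apply: wp_run; [by []|by vm_compute|].
      split; first exact: grows_trans g3 g4.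
      move=> q'; rewrite (take_nth 0) // mem_rcons inE -/q => /orP[/eqP->|q'in] d dE cr.
        by apply: c4; rewrite dE.
      by have [h1 h2] := c3 q' q'in d dE cr; split; apply: (proj2 g4).
    - move=> s3 _ _ [g3 c3]; split; first by rewrite -[arrays s]s2A.
      move=> d T' cr; have ET : T' = T.
        by case: cr => [[[_ <- _] _ _] _]; case: mab.
      rewrite ET in cr; have bd : adj G b d by case: cr => _ [].
      have [q qN [_ qE]] := eid_spec esG x0 bd.
      apply: (c3 q _ d qE cr); rewrite take_size mem_nbrs qN /tl qE eqxx //.
    - by rewrite wE mono mul1n; lia.
have -> : ecost mono_test = 135 by vm_compute.
lia.
Qed.

End Correlations.

(** * Counting the correlated triangles tried, and completeness of the table *)

Section Correlations.
Variables (n : nat) (G : mtgraph 'I_n) (es : seq ('I_n * 'I_n)).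
Hypothesis esG : edge_list G es.
Variable x0 : 'I_n * 'I_n.

Notation m := (size es).
Notation N := (m + m).
Notation K := (n + n).
Notation arcn := (arcn es x0).
Notation tl := (tl es x0).
Notation hd := (hd es x0).
Notation eid := (eid es).
Notation base := (base G es x0).
Notation nbrs := (nbrs es x0).
Notation sound_cells := (sound_cells G es x0).
Notation slot := (slot es x0).
Notation imp_filled := (imp_filled G es x0).
Notation grows := (grows G es x0).
Notation corr_filled := (corr_filled G es x0).
Notation weight := (weight G es x0).

Lemma corr_filled_grows A A' i a : grows A A' -> corr_filled A i a -> corr_filled A' i a.
Proof. by move=> [_ AA] cA d T /cA[h1 h2]; split; apply: AA. Qed.

Definition total_weight : nat := \sum_(i < N) \sum_(a < n) weight i a.

Lemma wp_corr_rows s : base s ->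
  wp corr_rows s (total_weight * 200 + N * n * 220 + N * 100 + 9) (fun s' =>
    grows (arrays s 16) (arrays s' 16) /\ forall i, i < N -> forall a, corr_filled (arrays s' 16) i a).
Proof.
move=> bs; apply: wp_le.
  apply: (@wp_for 4 2 _ N (fun i => \sum_(a < n) (weight i a * 200 + 211) + 30)
    (fun i s' => grows (arrays s 16) (arrays s' 16) /\
       forall p, p < i -> forall a, corr_filled (arrays s' 16) p a)) => //.
  - exact: r2 bs.
  - move=> i s1 iN s1i _ f1 [g1 c1].
    have bs1 : base s1 by apply: base_frame f1 bs.
    have [fTL fHD _ _ _] := aAF bs1 iN.
    apply: wp_le.
      apply: wp_seq_frame.
        apply: (@wp_run _ _ 7 (fun s2 => [/\ regs s2 7 = tl i, regs s2 8 = hd i, regs s2 4 = i &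
           arrays s2 16 = arrays s1 16])) => //=.
        by rewrite s1i fTL fHD.
      move=> s2 [s2x s2y s2i s2A] f2.
      have bs2 : base s2 by apply: base_frame f2 bs1.
      apply: (@wp_for 5 0 _ n (fun a => weight i a * 200 + 200) (fun j s' =>
         [/\ grows (arrays s 16) (arrays s' 16),
             forall p, p < i -> forall a, corr_filled (arrays s' 16) p a &
             forall a : 'I_n, a < j -> corr_filled (arrays s' 16) i a])) => //.
      + exact: r0 bs2.
      + by rewrite /= s2A; split.
      + move=> j s3 jn s3j _ f3 [g3 c3 d3].
        have bs3 : base s3 by apply: base_frame f3 bs2.
        apply: (wp_weaken (@wp_corr_row n G es esG x0 s3 i (Ordinal jn) bs3 iN _ s3j _ _));
          rewrite ?f3.1 // => s4 [g4 c4]; split.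
        * exact: grows_trans g3 g4.
        * by move=> p pi a; apply: corr_filled_grows g4 (c3 p pi a).
        * move=> a; rewrite ltnS leq_eqVlt => /orP[/eqP aj|aj].
            by rewrite (_ : a = Ordinal jn) //; apply: val_inj.
          exact: corr_filled_grows g4 (d3 a aj).
      + move=> s3 _ _ [g3 c3 d3]; split=> //= p; rewrite ltnS leq_eqVlt => /orP[/eqP-> a|/c3//].
        exact: d3.
    have -> : \sum_(a < n) (weight i a * 200 + 200 + 11) = \sum_(a < n) (weight i a * 200 + 211).
      by apply: eq_bigr => a _; rewrite -addnA.
    by set x := \sum_(a < n) _; lia.
rewrite /total_weight big_split /= sum_nat_const card_ord.
rewrite (eq_bigr (fun i : 'I_N => (\sum_(a < n) weight i a) * 200 + (n * 211 + 30))); last first.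
  by move=> i _; rewrite big_split /= -big_distrl /= sum_nat_const card_ord addnA.
rewrite big_split /= -big_distrl /= sum_nat_const card_ord.
have -> : N * n * 220 = N * (n * 220) by rewrite mulnA.
have : N * (n * 211 + 30) <= N * (n * 220) + N * 30 by rewrite -mulnDr leq_mul2l; lia.
lia.
Qed.

Lemma card_AP : #|AP G| = N.
Proof. by rewrite -(eq_card (arcs_AP esG)) (card_uniqP (uniq_arcs esG)) size_arcs. Qed.

Lemma sum_arcs (F : 'I_n * 'I_n -> nat) : \sum_(i < N) F (arcn i) = \sum_(p in AP G) F p.
Proof.
rewrite -size_arcs -(big_mkord predT (fun i => F (nth x0 (arcs es) i))) -(big_nth x0 predT F).
by rewrite -(eq_bigl _ _ (arcs_AP esG)) -big_uniq ?(uniq_arcs esG).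
Qed.

Definition degree (u : 'I_n) : nat := #|[pred v | adj G u v]|.

Lemma size_nbrs_degree u : size (nbrs u N) <= degree u.
Proof.
rewrite -(size_map (fun p => (arcn p).2)).
have uq : uniq [seq (arcn p).2 | p <- nbrs u N].
  rewrite map_inj_in_uniq ?filter_uniq ?iota_uniq // => p q.
  rewrite !mem_nbrs => /andP[pN /eqP pu] /andP[qN /eqP qu] E2.
  apply: (arcn_inj esG pN qN (x0 := x0)).
  rewrite [LHS]surjective_pairing [RHS]surjective_pairing E2; congr pair.
  by apply: val_inj; exact: etrans pu (esym qu).
rewrite -(card_uniqP uq); apply/subset_leq_card/subsetP => v /mapP[p].
rewrite mem_nbrs => /andP[pN /eqP/val_inj pu] ->.
by have := arcn_adj esG x0 pN; rewrite inE pu.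
Qed.

Lemma sum_degree : \sum_u degree u = N.
Proof.
rewrite -card_AP -sum1_card (eq_bigl (fun p => true && adj G p.1 p.2)); last by move=> p; rewrite inE.
rewrite -(pair_big_dep predT (fun u v => adj G u v) (fun _ _ => 1)) /=.
by apply: eq_bigr => u _; rewrite sum1_card.
Qed.

Definition triples : nat := #|[set t : 'I_n * 'I_n * 'I_n | mono_triangle G t.2 t.1.1 t.1.2]|.

Lemma total_weight_le : total_weight <=
  \sum_b \sum_c \sum_a mono_triangle G a b c * degree b.
Proof.
rewrite /total_weight.
have wE i (a : 'I_n) : weight i a =
    mono_triangle G a (arcn i).1 (arcn i).2 * size (nbrs (arcn i).1 N) by rewrite /weight valK.
pose F p := \sum_a mono_triangle G a p.1 p.2 * size (nbrs p.1 N).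
rewrite (eq_bigr (fun i : 'I_N => F (arcn i))); last by move=> i _; apply: eq_bigr => a _; rewrite wE.
rewrite (sum_arcs F) /F.
rewrite [leqRHS]pair_big /= [leqLHS]big_mkcond /=; apply: leq_sum => p _; case: ifP => // _.
by apply: leq_sum => a _; rewrite leq_mul2l size_nbrs_degree orbT.
Qed.

(** For fixed b and c, the vertex a is a neighbour of c and d is one of b, which leaves at most
    [degree b * degree c] trials; the degrees add up to N. *)
Lemma total_weight_le_square : total_weight <= N * N.
Proof.
apply: leq_trans total_weight_le _; rewrite -{1}sum_degree big_distrl /=.
apply: leq_sum => b _; rewrite -sum_degree big_distrr /=.
apply: leq_sum => c _; rewrite [leqRHS]mulnC [degree c]/degree -sum1_card big_distrl /= [leqRHS]big_mkcond /=.
apply: leq_sum => a _; rewrite inE adj_sym.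
case mo: (mono_triangle G a b c) => //.
by case/and3P: mo => _ _ /andP[-> _].
Qed.

(* At most [27 = 3 ^ 3] triples of vertices have a given set of 3 elements. *)
Lemma triples_le : triples <= #|mono_triangles G| * 27.
Proof.
pose f (t : 'I_n * 'I_n * 'I_n) := [set t.2; t.1.1; t.1.2].
rewrite /triples -sum1_card (partition_big f (mem (mono_triangles G))) /=; last first.
  move=> t; rewrite inE => mo; rewrite inE; apply/existsP; exists t.2.
  by apply/existsP; exists t.1.1; apply/existsP; exists t.1.2; rewrite eqxx.
rewrite -sum_nat_const; apply: leq_sum => S _; rewrite sum1_card.
have [cS|cS] := leqP #|S| 3; last first.
  rewrite leqNgt; apply/negP => lt.
  have /card_gt0P[t] := leq_trans (isT : 0 < 28) lt.
  rewrite unfold_in => /andP[_ /eqP fS]; move: cS; rewrite -fS /f ltnNge.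
  rewrite (leq_trans (leq_card_setU _ _)) // cards1 addn1 ltnS.
  by rewrite (leq_trans (leq_card_setU _ _)) // !cards1.
apply: (@leq_trans #|setX (setX S S) S|).
  apply/subset_leq_card/subsetP => -[[b c] a]; rewrite unfold_in => /andP[_ /eqP <-].
  by rewrite !in_setX /f /= !inE !eqxx !orbT.
rewrite !cardsX (@leq_trans (3 * 3 * 3)) // leq_mul // leq_mul //.
Qed.

Lemma total_weight_le_triangles : total_weight <= #|mono_triangles G| * 27 * n.
Proof.
apply: leq_trans total_weight_le _.
apply: (@leq_trans (triples * n)); last by rewrite leq_mul2r triples_le orbT.
have -> : triples = \sum_b \sum_c \sum_a mono_triangle G a b c.
  rewrite !pair_bigA /= /triples -sum1_card big_mkcond /=.
  by apply: eq_bigr => t _; rewrite inE; case: ifP.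
rewrite big_distrl /=; apply: leq_sum => b _; rewrite big_distrl /=.
apply: leq_sum => c _; rewrite big_distrl /=; apply: leq_sum => a _.
by rewrite leq_mul2l /degree -[leqRHS]card_ord max_card orbT.
Qed.

Lemma table_complete A : sound_cells A -> (forall p, p < N -> forall z, imp_filled A p z) ->
  (forall p, p < N -> forall a, corr_filled A p a) ->
  forall p q, p < N -> q < N -> aug_arc G (arcn p) (arcn q) -> exists2 k, k < K & A (p * K + k) = q.+1.
Proof.
move=> so im co p q pN qN /aug_arcP pq.
suff [k kK [nz sl]] : exists2 k, k < K & A (p * K + k) != 0 /\ slot p k q.
  exists k => //; have [E|[q' [q'N E sl' _]]] := so p k pN kK; first by rewrite E in nz.
  by rewrite E (slot_inj esG q'N qN sl' sl).
have tlE a b r : arcn r = (a, b) -> tl r = a by rewrite /tl => ->.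
have hdE a b r : arcn r = (a, b) -> hd r = b by rewrite /hd => ->.
suff H P Q : aug_spec G P Q -> arcn p = P -> arcn q = Q ->
    exists2 k, k < K & A (p * K + k) != 0 /\ slot p k q by exact: H pq erefl erefl.
case=> [a b c _ ic|a b c _ ic|a b c d T cr|a b c d T cr] pE qE.
- exists c; first by rewrite ltn_addr.
  have [h _] := im p pN c; split; first by apply: h; rewrite pE.
  by rewrite /slot ltn_ord (tlE _ _ _ qE) (hdE _ _ _ qE) (hdE _ _ _ pE) !eqxx.
- exists (n + a); first by rewrite ltn_add2l.
  have [_ h] := im p pN a; split; first by apply: h; rewrite pE.
  by rewrite /slot ltnNge leq_addr addKn (tlE _ _ _ qE) (hdE _ _ _ qE) (tlE _ _ _ pE) !eqxx.
- exists a; first by rewrite ltn_addr.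
  have [|h _] := co p pN a d T; first by rewrite pE.
  split=> //.
  by rewrite /slot ltn_ord (tlE _ _ _ qE) (hdE _ _ _ qE) (hdE _ _ _ pE) !eqxx.
(* The cell lies in the row of p = (c, a), but it was written when r = (b, c) was treated. *)
- exists (n + b); first by rewrite ltn_add2l.
  have bc : adj G b c by case: cr => [[_ [? ? ?] _] _].
  have [r rN [_ rE]] := eid_spec esG x0 bc.
  have [|_] := co r rN a d T; first by rewrite rE.
  have -> : (eid (arcn r).2 a).-1 = p.
    have := eid_arcn esG x0 pN; rewrite pE rE /= => -> //.
  rewrite rE /= => h; split=> //.
  by rewrite /slot ltnNge leq_addr addKn (tlE _ _ _ qE) (hdE _ _ _ qE) (tlE _ _ _ pE) !eqxx.
Qed.

End Correlations.

(** * Search, consistency check and sorting *)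

Definition search_node : cmd :=
  Assign 7 (Get 21 (pred_of (Reg 5))) ;; Assign 8 (Get 20 (Reg 7)) ;;
  If (ELt (Reg 8) (Reg 3))
    (Store 20 (Reg 7) (Add (Reg 8) (Const 1)) ;; Assign 9 (Get 16 (Add (Get 12 (Reg 7)) (Reg 8))) ;;
     If (EAnd (Reg 9) (ENot (Get 19 (pred_of (Reg 9)))))
       (Store 19 (pred_of (Reg 9)) (Const 1) ;; Store 21 (Reg 5) (pred_of (Reg 9)) ;;
        Assign 5 (Add (Reg 5) (Const 1)))
       Skip)
    (Store 22 (Reg 6) (Reg 7) ;; Assign 6 (Add (Reg 6) (Const 1)) ;; Assign 5 (pred_of (Reg 5))).

Definition search_root : cmd :=
  Assign 7 (Get 17 (Reg 4)) ;;
  If (EOr (Get 19 (Reg 7)) (Get 19 (Get 18 (Reg 7)))) Skip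
    (Store 19 (Reg 7) (Const 1) ;; Store 21 (Const 0) (Reg 7) ;; Assign 5 (Const 1)) ;;
  Assign 4 (Add (Reg 4) (Const 1)).

Definition search : cmd :=
  (Assign 4 (Const 0) ;; Assign 5 (Const 0) ;; Assign 6 (Const 0)) ;;
  While (EOr (ELt (Reg 4) (Reg 2)) (Reg 5)) (If (Reg 5) search_node search_root).

Section SearchProgram.
Variables (V : finType) (G : mtgraph V) (N K : nat) (arcn : nat -> V * V).
Variables (A : nat -> nat) (chk : nat -> nat) (chkP : V * V -> V * V).
Variable roots : seq nat.
Local Notation cell := (fun p k => A (p * K + k)).
Local Notation forc p q := (forces G (arcn p) (arcn q)).
Hypothesis arcn_AP : forall p, p < N -> arcn p \in AP G.
Hypothesis arcn_surj : forall x, x \in AP G -> exists2 p, p < N & arcn p = x.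
Hypothesis arcn_inj : forall p q, p < N -> q < N -> arcn p = arcn q -> p = q.
Hypothesis cell_sound : forall p k q, p < N -> k < K -> cell p k = q.+1 -> q < N /\ forc p q.
Hypothesis cell_complete : forall p q, p < N -> q < N -> aug_arc G (arcn p) (arcn q) ->
  exists2 k, k < K & cell p k = q.+1.
Hypothesis chk_arc : forall p, p < N -> chk p < N /\ arcn (chk p) = chkP (arcn p).
Hypothesis size_roots : size roots = N.
Hypothesis roots_lt : forall p, p \in roots -> p < N.

Record search_input s : Prop := SearchInput {
  si2 : regs s 2 = N;
  si3 : regs s 3 = K;
  siR2 : forall p, p < N -> arrays s 12 p = p * K;
  siA : arrays s 16 =1 A;
  siRT : forall i, i < N -> arrays s 17 i = nth 0 roots i;
  siCHK : forall p, p < N -> arrays s 18 p = chk p }.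

(** Arrays 21 and 22 grow at the end whereas the lists grow at the front, hence the reversals. *)
Record rep s c : Prop := Rep {
  rep4 : regs s 4 = rt c;
  rep5 : regs s 5 = size (stk c);
  rep6 : regs s 6 = size (fin c);
  repS : forall i, i < size (stk c) -> arrays s 21 i = nth 0 (rev (stk c)) i;
  repF : forall i, i < size (fin c) -> arrays s 22 i = nth 0 (rev (fin c)) i;
  repP : forall p, p < N -> arrays s 20 p = ptr c p;
  repV : forall p, p < N -> (arrays s 19 p != 0) = (p \in visited c) }.

Local Notation search_inv := (search_inv G N K arcn cell chkP roots).
Local Notation search_next := (search_next K cell chk roots).

Lemma nth_rev_cons (u : nat) s i : i < (size s).+1 ->
  nth 0 (rev (u :: s)) i = if i == size s then u else nth 0 (rev s) i.
Proof.
by move=> lt; rewrite rev_cons nth_rcons size_rev; case: ltngtP => // gt; exfalso; lia.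
Qed.

Lemma rep_node s c : search_input s -> rep s c -> search_inv c -> stk c != [::] ->
  rep (run search_node s) (search_next c).
Proof.
case=> i2 i3 iR iA _ _ [q4 q5 q6 qS qF qP qV] ic.
have Il := inv_lt ic.
rewrite /search_next; case stE: (stk c) => [//|u st] _.
rewrite stE in q5 qS.
have uN : u < N by apply: Il; rewrite /visited stE mem_head.
have top : arrays s 21 (regs s 5 - 1) = u.
  by rewrite q5 subn1 qS //= nth_rev_cons // eqxx.
have vE : visited c = u :: st ++ fin c by rewrite /visited stE.
rewrite /search_node /= !truthE /= top qP // i3 q5 q6 iR // iA.
case: ifP => lt /=; last first.
  have tailS i : i < size st -> arrays s 21 i = nth 0 (rev st) i.
    move=> lti; rewrite qS //=; last by rewrite ltnS ltnW.
    by rewrite nth_rev_cons ?ltnS 1?ltnW // ltn_eqF.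
  split; rewrite /= ?addn1 ?subn1 //.
    move=> i lti; rewrite nth_rev_cons //; case: eqP => // ne.
    by apply: qF; move: lti; rewrite ltnS leq_eqVlt => /orP[/eqP|].
  by move=> p pN; rewrite qV // vE /visited /= mem_cat !inE mem_cat orbCA.
have ptrE p : p < N -> (if p == u then (ptr c u).+1 else arrays s 20 p) = bump_ptr (ptr c) u p.
  by move=> pN; rewrite /bump_ptr qP.
have stay x : rep (set_reg (set_cell (set_reg (set_reg s 7 u) 8 (ptr c u)) 20 u (ptr c u + 1)) 9 x)
    (Config (rt c) (u :: st) (fin c) (bump_ptr (ptr c) u)).
  by split; rewrite /= ?addn1 // => p pN; rewrite qV // vE.
case E: (A (u * K + ptr c u)) => [|q] /=; rewrite ?truthE /= ?i3 ?E //=.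
have [qN _] := cell_sound uN lt E.
rewrite subn1 /= -[_ == 0]negbK qV //; case: ifP => // qv.
split; rewrite /= ?addn1 //.
- move=> i lti; rewrite nth_rev_cons //; case: eqP => // ne.
  by apply: qS; move: lti; rewrite ltnS leq_eqVlt => /orP[/eqP|].
- move=> p pN; rewrite /visited /= inE; case: (p == q) => //=.
  by rewrite qV // vE.
Qed.

Lemma rep_root s c : search_input s -> rep s c -> search_inv c -> stk c = [::] -> rt c < N ->
  rep (run search_root s) (search_next c).
Proof.
case=> i2 i3 iR iA iRT iC [q4 q5 q6 qS qF qP qV] ic stE lt.
rewrite /search_next stE; set r := nth 0 roots (rt c).
have rN : r < N by apply: roots_lt; rewrite mem_nth ?size_roots.
have [cN _] := chk_arc rN.
rewrite /search_root /= !truthE /= q4 iRT // -/r iC // !qV //.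
rewrite stE /= in q5.
have vE : visited c = fin c by rewrite /visited stE.
case: ifP => vr; split; rewrite /= ?q4 ?q5 ?addn1 //.
- by move=> p pN; rewrite qV // vE.
- by case.
- by move=> p pN; rewrite /visited /= inE; case: (p == r) => //=; rewrite qV // vE.
Qed.

Lemma search_input_frame c s s' :
  all (fun x => x \notin wregs c) [:: 2; 3] -> all (fun a => a \notin warrs c) [:: 12; 16; 17; 18] ->
  frame c s s' -> search_input s -> search_input s'.
Proof.
move=> /and3P[n2 n3 _] /and5P[m1 m2 m3 m4 _] [fr fa] [i2 i3 iR iA iRT iC].
split; rewrite ?fr //.
- by move=> p /iR; rewrite fa.
- by move=> j; rewrite fa.
- by move=> p /iRT; rewrite fa.
- by move=> p /iC; rewrite fa.
Qed.

(** The number of steps is at most the initial measure N + N * K + N. *)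
Lemma wp_search s : search_input s -> (forall p, p < N -> arrays s 19 p = 0) ->
  (forall p, p < N -> arrays s 20 p = 0) ->
  wp search s (N * (K + 2) * 300 + 100) (fun s' => exists c,
    [/\ rep s' c, search_inv c & ~~ active N c]).
Proof.
move=> si z19 z20; apply: wp_le.
  apply: wp_seq_frame.
    apply: (@wp_run _ _ 8 (fun s1 => rep s1 start)) => //.
    by split=> //= p pN; rewrite z19.
  move=> s1 re1 f1.
  have si1 : search_input s1 by apply: search_input_frame f1 si.
  have guard s2 c : search_input s2 -> rep s2 c ->
      (eval s2 (EOr (ELt (Reg 4) (Reg 2)) (Reg 5)) != 0) = active N c.
    by move=> [i2 _ _ _ _ _] [q4 q5 _ _ _ _ _]; rewrite !truthE /= q4 q5 i2 size_eq0.
  apply: (@wp_while_frame _ _ _ 200 (N * (K + 2)) (fun k s2 => exists c,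
     [/\ search_input s2, rep s2 c, search_inv c & measure N K c <= k])).
  - exists start; split=> //.
      apply: search_inv_start => //.
    have E : \sum_(p < N) (K - 0) = N * K by rewrite sum_nat_const card_ord subn0.
    by rewrite /measure /= E; lia.
  - move=> k s2 _ [c [si2 re2 ic le2]]; rewrite (guard s2 c) // => act.
    have mn : measure N K (search_next c) < measure N K c by apply: measure_next ic act.
    have icn : search_inv (search_next c) by apply: search_inv_next act.
    have si3 : search_input (run (If (Reg 5) search_node search_root) s2).
      by apply: (search_input_frame _ _ (@frame_run (If (Reg 5) search_node search_root) s2 isT) si2).
    have re3 : rep (run (If (Reg 5) search_node search_root) s2) (search_next c).
      rewrite /run -/run [eval _ _]/= (rep5 re2) size_eq0; case: ifPn => st0.
        exact: rep_node.
      move: st0 act; rewrite negbK /active => /eqP st0; rewrite st0 eqxx orbF => lt.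
      exact: rep_root.
    apply: wp_run => //.
    exists k.-1; first by lia.
    by exists (search_next c); split=> //; lia.
  - move=> k s2 [c [si2 re2 ic _]]; rewrite -[_ == 0]negbK (guard s2 c) // => nact.
    by exists c.
have -> : ecost (EOr (ELt (Reg 4) (Reg 2)) (Reg 5)) = 9 by vm_compute.
lia.
Qed.

End SearchProgram.

Definition reset : cmd := For 4 2 (Store 19 (Reg 4) (Const 0) ;; Store 20 (Reg 4) (Const 0)).

(** The arc finished first need not lie in a sink component, but the one finished last lies in a
    source component. Its reverse then lies in a sink component, and this is where greed has to
    start. *)
Definition reverse_roots : cmd :=
  For 4 2
    (Store 17 (Reg 4) (Get 10 (Get 22 (Defs.Sub (pred_of (Reg 2)) (Reg 4)))) ;;
     Store 18 (Reg 4) (Get 10 (Reg 4))).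

Definition check : cmd :=
  Assign 7 (Const 0) ;;
  For 4 1 (If (EAnd (Get 19 (Reg 4)) (Get 19 (Add (Reg 1) (Reg 4)))) (Assign 7 (Const 1)) Skip).

Definition triangle_test : cmd :=
  Assign 10 (Get 13 (Add (Get 11 (Reg 8)) (Reg 5))) ;;
  Assign 11 (Get 13 (Add (Get 11 (Reg 7)) (Reg 5))) ;;
  If (EAnd (Reg 10) (EAnd (Get 19 (pred_of (Reg 10))) (EAnd (Reg 11) (Get 19 (Get 10 (pred_of (Reg 11)))))))
     (Assign 9 (Const 0)) Skip.

Definition triangle_rows : cmd :=
  For 4 2
    ((Assign 7 (Get 6 (Reg 4)) ;; Assign 8 (Get 7 (Reg 4)) ;; Assign 9 (Get 19 (Reg 4))) ;;
     For 5 0 triangle_test ;; Store 23 (Reg 4) (Reg 9)).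

Definition output : cmd :=
  For 4 1
    (If (Get 19 (Reg 4))
       (Store 4 (Reg 4) (Get 6 (Reg 4)) ;; Store 5 (Reg 4) (Get 7 (Reg 4)))
       (Store 4 (Reg 4) (Get 7 (Reg 4)) ;; Store 5 (Reg 4) (Get 6 (Reg 4)))).

Lemma wp_reset s N : regs s 2 = N ->
  wp reset s (N * 30 + 9) (fun s' => forall p, p < N -> arrays s' 19 p = 0 /\ arrays s' 20 p = 0).
Proof.
move=> s2; apply: (@wp_for_const 4 2 _ N 19 _ (fun i s' => forall p, p < i ->
  arrays s' 19 p = 0 /\ arrays s' 20 p = 0)) => // i s1 iN s1i _ _ inv.
apply: wp_run => // p; rewrite ltnS leq_eqVlt /= s1i.
by case: eqP => //= _ /inv.
Qed.

(** * Reversed roots, consistency check, triangle detection and output *)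

Section Phases.
Variables (n : nat) (G : mtgraph 'I_n) (es : seq ('I_n * 'I_n)).
Hypothesis esG : edge_list G es.
Variable x0 : 'I_n * 'I_n.

Notation m := (size es).
Notation N := (m + m).
Notation arcn := (arcn es x0).
Notation eid := (eid es).
Notation neg := (neg es).
Notation base := (base G es x0).

Definition marks s (O : {set 'I_n * 'I_n}) : Prop :=
  forall p, p < N -> (arrays s 19 p != 0) = (arcn p \in O).

Lemma marks_frame c s s' O : 19 \notin warrs c -> frame c s s' -> marks s O -> marks s' O.
Proof. by move=> nc [_ fa] mk p pN; rewrite fa // mk. Qed.

Lemma wp_reverse_roots s L : base s -> size L = N -> (forall p, p \in L -> p < N) ->
  (forall i, i < N -> arrays s 22 i = nth 0 (rev L) i) ->
  wp reverse_roots s (N * 50 + 9) (fun s' =>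
    (forall i, i < N -> arrays s' 17 i = nth 0 [seq neg p | p <- L] i) /\
    (forall p, p < N -> arrays s' 18 p = neg p)).
Proof.
move=> bs szL Llt s22.
apply: (@wp_for_const 4 2 _ N 39 _ (fun i s' =>
    (forall j, j < i -> arrays s' 17 j = nth 0 [seq neg p | p <- L] j) /\
    (forall p, p < i -> arrays s' 18 p = neg p))) => //.
  exact: r2 bs.
move=> i s1 iN s1i s12 f1 [inv1 inv2].
have bs1 : base s1 by apply: base_frame f1 bs.
have E : arrays s1 10 (arrays s1 22 (N - 1 - i)) = nth 0 [seq neg p | p <- L] i.
  rewrite (f1.2 22 isT) s22; last by lia.
  rewrite nth_rev szL; last by lia.
  rewrite (_ : N - (N - 1 - i).+1 = i); last by lia.
  rewrite (nth_map 0) ?szL //; apply: fNEG; apply: (aAF bs1); apply: Llt.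
  by rewrite mem_nth ?szL.
apply: wp_run => //=; rewrite s1i s12 E (fNEG (aAF bs1 iN)).
by split=> j; rewrite ltnS leq_eqVlt; case: eqP => [-> //|_ /=]; [exact: inv1|exact: inv2].
Qed.

Lemma wp_check s O : base s -> marks s O -> O \subset AP G ->
  wp check s (m * 60 + 30) (fun s' => (regs s' 7 == 0) <-> consistent O).
Proof.
move=> bs mk sO; apply: wp_le.
  apply: wp_seq_frame; first by apply: (@wp_run _ _ 2 (fun s1 => regs s1 7 = 0)).
  move=> s1 s17 f1; have bs1 : base s1 by apply: base_frame f1 bs.
  have mk1 : marks s1 O by apply: marks_frame f1 mk.
  apply: (@wp_for_const 4 1 _ m 49 (m * 60 + 9) (fun i s' => (regs s' 7 == 0) <->
     forall p, p < i -> ~~ ((arcn p \in O) && (swap (arcn p) \in O)))) => //.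
  - exact: r1 bs1.
  - by rewrite /= s17.
  - move=> i s2 im s2i s21 f2 inv.
    have mk2 : marks s2 O by apply: marks_frame f2 mk1.
    have iN : i < N by lia.
    have miE : m + i = neg i by rewrite /neg im.
    apply: wp_run; [by []|by vm_compute|].
    rewrite /= !truthE /= s2i s21 miE !mk2 ?neg_lt // arcn_neg //.
    case: ifPn => /= [yes|no].
      by split=> // /(_ i (ltnSn i)); rewrite yes.
    split=> [/inv H p|H]; last by apply/inv => p pi; apply: H; rewrite ltnS ltnW.
    by rewrite ltnS leq_eqVlt => /orP[/eqP->|/H].
  - move=> s2 _ _ inv; split=> [/inv H p pO|co]; last first.
      apply/inv => p _; rewrite negb_and; case pO: (arcn p \in O) => //=.
      exact: co pO.
    have [q qN qE] := arcn_surj esG x0 (subsetP sO _ pO).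
    have [qm|qm] := ltnP q m; first by have := H q qm; rewrite qE pO.
    have im : q - m < m by lia.
    have := H (q - m) im.
    have -> : q - m = neg q by rewrite /neg ltnNge qm.
    by rewrite arcn_neg // qE swapK pO andbT.
lia.
Qed.

Lemma wp_triangle_rows s O : base s -> marks s O -> O \subset AP G ->
  wp triangle_rows s (N * (n * 100 + 100) + 9) (fun s' =>
    forall p, p < N -> (arrays s' 23 p != 0) = (arcn p \in off_triangles O)).
Proof.
move=> bs mk sO.
apply: (@wp_for_const 4 2 _ N (n * 100 + 80) _ (fun i s' => forall p, p < i ->
   (arrays s' 23 p != 0) = (arcn p \in off_triangles O))) => //.
- exact: r2 bs.
- move=> i s1 iN s1i _ f1 inv.
  have bs1 : base s1 by apply: base_frame f1 bs.
  have mk1 : marks s1 O by apply: marks_frame f1 mk.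
  have [fTL fHD _ _ _] := aAF bs1 iN.
  set x := (arcn i).1; set y := (arcn i).2.
  apply: wp_le.
    apply: wp_seq_frame.
      apply: (@wp_run _ _ 12 (fun s2 => [/\ regs s2 7 = x, regs s2 8 = y,
        (regs s2 9 != 0) = (arcn i \in O), regs s2 4 = i & arrays s2 = arrays s1])) => //=.
      by rewrite s1i fTL fHD mk1.
    move=> s2 [s2x s2y s29 s2i s2A] f2.
    have bs2 : base s2 by apply: base_frame f2 bs1.
    have mk2 : marks s2 O by apply: marks_frame f2 mk1.
    apply: wp_seq_frame.
      apply: (@wp_for_const 5 0 _ n 80 _ (fun j s' => (regs s' 9 != 0) = (arcn i \in O) &&
         [forall z : 'I_n, (z < j) ==> ~~ (((y, z) \in O) && ((z, x) \in O))])
         _ (fun s' => (regs s' 9 != 0) = (arcn i \in off_triangles O))) => //.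
      + exact: r0 bs2.
      + by rewrite /= s29 andbC; case: forallP => // -[].
      + move=> j s3 jn s3j _ f3 inv3.
        have bs3 : base s3 by apply: base_frame f3 bs2.
        have mk3 : marks s3 O by apply: marks_frame f3 mk2.
        pose z := Ordinal jn.
        have rowx : arrays s3 11 x = x * n by rewrite (aRB bs3).
        have rowy : arrays s3 11 y = y * n by rewrite (aRB bs3).
        have C : [&& eid y z != 0, arrays s3 19 (eid y z - 1) != 0, eid x z != 0 &
            arrays s3 19 (arrays s3 10 (eid x z - 1)) != 0] = ((y, z) \in O) && ((z, x) \in O).
          have yzE : (eid y z != 0) && (arrays s3 19 (eid y z - 1) != 0) = ((y, z) \in O).
            rewrite (eid_eq0 esG) negbK; case yz: (adj G y z) => /=.
              by rewrite subn1 mk3 ?(arcn_eid esG x0 yz) // (eid_lt esG x0 yz).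
            by apply/esym/negP => /(subsetP sO); rewrite inE /= yz.
          rewrite andbA yzE; congr andb.
          rewrite (eid_eq0 esG) negbK; case xz: (adj G x z) => /=.
            have eN := eid_lt esG x0 xz.
            rewrite subn1 (fNEG (aAF bs3 eN)) mk3 ?neg_lt //.
            by rewrite arcn_neg // (arcn_eid esG x0 xz).
          by apply/esym/negP => /(subsetP sO); rewrite inE /= adj_sym xz.
        apply: wp_run; [by []|by vm_compute|].
        rewrite /triangle_test /= !truthE /= (f3.1 7 isT) (f3.1 8 isT) s2x s2y s3j rowx rowy.
        rewrite -[j]/(nat_of_ord z) !(aID bs3) C.
        have E : [forall z' : 'I_n, (z' < z.+1) ==> ~~ (((y, z') \in O) && ((z', x) \in O))] =
           [forall z' : 'I_n, (z' < z) ==> ~~ (((y, z') \in O) && ((z', x) \in O))]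
           && ~~ (((y, z) \in O) && ((z, x) \in O)).
          apply/forallP/andP => [H|[/forallP H Hz] z'].
            split; last by have := H z; rewrite ltnSn.
            by apply/forallP => z'; apply/implyP => lt; have := H z'; rewrite ltnS ltnW.
          apply/implyP; rewrite ltnS leq_eqVlt => /orP[/eqP/val_inj->//|lt].
          by have := H z'; rewrite lt.
        rewrite E; case: ifP => H /=; first by rewrite !andbF.
        by rewrite andbT.
      + move=> s3 _ _ ->; rewrite inE; congr andb; rewrite /in_triangle negb_exists.
        by apply: eq_forallb => z; rewrite ltn_ord.
    move=> s3 s39 f3.
    apply: (@wp_run _ _ 3) => //= p; rewrite f3.1 // s2i.
    rewrite ltnS leq_eqVlt; case: eqP => [->|_ /=]; first by rewrite s39.
    by move=> pi; rewrite f3.2 // s2A inv.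
  lia.
- lia.
Qed.

Lemma wp_output s O : base s -> marks s O -> orientation G O ->
  wp output s (m * 60 + 9) (fun s' => output_arcs n m s' = O).
Proof.
move=> bs mk /orientationP[/subsetP sO co tot].
apply: (@wp_for_const 4 1 _ m 49 _ (fun i s' => forall p, p < i ->
   let a := if arcn p \in O then arcn p else swap (arcn p) in
   arrays s' 4 p = a.1 /\ arrays s' 5 p = a.2)) => //.
- exact: r1 bs.
- move=> i s1 im s1i _ f1 inv.
  have iN : i < N by lia.
  have bs1 : base s1 by apply: base_frame f1 bs.
  have mk1 : marks s1 O by apply: marks_frame f1 mk.
  have [fTL fHD _ _ _] := aAF bs1 iN.
  apply: wp_run => // p; rewrite /= s1i mk1 // fTL fHD.
  rewrite ltnS leq_eqVlt; case: (p =P i) => [-> _|ne /= pi].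
    by case: ifP => _; rewrite /= eqxx.
  by case: ifP => _ /=; rewrite (introF eqP ne); exact: inv.
move=> s1 _ _ inv; apply/setP => p; rewrite inE; apply/existsP/idP => [[i]|pO].
  have im := ltn_ord i; have iN : i < N by lia.
  have [-> ->] := inv i im; case: ifP => iO /andP[/eqP/val_inj E1 /eqP/val_inj E2].
    by rewrite [p]surjective_pairing -E1 -E2 -surjective_pairing.
  have := tot _ (arcn_AP esG x0 iN); rewrite iO /=.
  by rewrite [p]surjective_pairing -E1 -E2.
have [q qN qE] := arcn_surj esG x0 (sO _ pO).
have [qm|qm] := ltnP q m.
  by exists (Ordinal qm); have [-> ->] := inv q qm; rewrite /= qE pO !eqxx.
have im : q - m < m by lia.
exists (Ordinal im); have [-> ->] := inv _ im.
have -> : q - m = neg q by rewrite /neg ltnNge qm.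
rewrite /= arcn_neg // qE (negbTE (co _ pO)) swapK.
by rewrite !eqxx.
Qed.

End Phases.

(** * Sorting the arcs by tails, by repeated selection of a source *)

Definition clear_marks : cmd := For 5 2 (Store 25 (Get 6 (Reg 5)) (Const 0)).

Definition mark_heads : cmd :=
  For 5 2 (If (EAnd (Get 23 (Reg 5)) (ENot (Get 24 (Get 6 (Reg 5)))))
             (Store 25 (Get 7 (Reg 5)) (Const 1)) Skip).

(** Register 8 receives the selected vertex plus one, so that 0 means that none is left. *)
Definition find_source : cmd :=
  Assign 8 (Const 0) ;;
  For 5 2 (If (EAnd (ENot (Get 24 (Get 6 (Reg 5)))) (ENot (Get 25 (Get 6 (Reg 5)))))
             (Assign 8 (Add (Get 6 (Reg 5)) (Const 1))) Skip).

Definition emit_source : cmd :=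
  For 5 2 (If (EEq (Get 6 (Reg 5)) (pred_of (Reg 8)))
             (Store 17 (Reg 12) (Reg 5) ;; Assign 12 (Add (Reg 12) (Const 1))) Skip) ;;
  Store 24 (pred_of (Reg 8)) (Const 1).

(** Scanning all arcs in each of n rounds costs O(n m), which the bound allows. Vertices are met
    only as tails of arcs, and every endpoint of an edge is one. *)
Definition sort_round : cmd :=
  clear_marks ;; mark_heads ;; find_source ;; If (Reg 8) emit_source Skip.

Definition sort_arcs : cmd := Assign 12 (Const 0) ;; For 4 0 sort_round.

Section Sorting.
Variables (n : nat) (G : mtgraph 'I_n) (es : seq ('I_n * 'I_n)).
Hypothesis esG : edge_list G es.
Variable x0 : 'I_n * 'I_n.

Notation m := (size es).
Notation N := (m + m).
Notation arcn := (arcn es x0).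
Notation tl := (tl es x0).
Notation hd := (hd es x0).
Notation base := (base G es x0).
Notation nbrs := (nbrs es x0).

Variable D : {set 'I_n * 'I_n}.
Hypothesis D_AP : D \subset AP G.
Hypothesis acD : acyclic D.

Implicit Types (vs : seq 'I_n) (u v : 'I_n) (s : state).

Definition Dmarks s : Prop := forall p, p < N -> (arrays s 23 p != 0) = (arcn p \in D).
Definition done s vs : Prop := forall v, (arrays s 24 v != 0) = (v \in vs).
Definition blocked vs v : bool := [exists u, ((u, v) \in D) && (u \notin vs)].
Definition ids vs : seq nat := flatten [seq nbrs v N | v <- vs].

Lemma Dmarks_frame c s s' : 23 \notin warrs c -> frame c s s' -> Dmarks s -> Dmarks s'.
Proof. by move=> nc [_ fa] H p pN; rewrite fa // H. Qed.

Lemma done_frame c s s' vs : 24 \notin warrs c -> frame c s s' -> done s vs -> done s' vs.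
Proof. by move=> nc [_ fa] H v; rewrite fa // H. Qed.

Lemma tlE p : tl p = (arcn p).1. Proof. by []. Qed.
Lemma hdE p : hd p = (arcn p).2. Proof. by []. Qed.

Lemma wp_clear_marks s : base s ->
  wp clear_marks s (N * 30 + 9) (fun s' => forall p, p < N -> arrays s' 25 (tl p) = 0).
Proof.
move=> bs.
apply: (@wp_for_const 5 2 _ N 19 _ (fun i s' => forall p, p < i -> arrays s' 25 (tl p) = 0)) => //.
  exact: r2 bs.
move=> i s1 iN s1i _ f1 inv; have bs1 : base s1 by apply: base_frame f1 bs.
have [fTL _ _ _ _] := aAF bs1 iN.
apply: wp_run => // p; rewrite /= s1i fTL ltnS leq_eqVlt => /orP[/eqP->|/inv->].
  by rewrite eqxx.
by case: ifP.
Qed.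

Lemma wp_mark_heads s vs : base s -> Dmarks s -> done s vs ->
  (forall p, p < N -> arrays s 25 (tl p) = 0) ->
  wp mark_heads s (N * 60 + 9) (fun s' => forall p, p < N ->
     (arrays s' 25 (tl p) != 0) = blocked vs (arcn p).1).
Proof.
move=> bs dm dn z25.
apply: (@wp_for_const 5 2 _ N 49 _ (fun i s' => forall p, p < N ->
    (arrays s' 25 (tl p) != 0) =
    has (fun q => [&& arcn q \in D, (arcn q).1 \notin vs & (arcn q).2 == (arcn p).1]) (iota 0 i))) => //.
- exact: r2 bs.
- by move=> p pN; rewrite /= z25.
- move=> i s1 iN s1i _ f1 inv; have bs1 : base s1 by apply: base_frame f1 bs.
  have [fTL fHD _ _ _] := aAF bs1 iN.
  have dm1 : Dmarks s1 by apply: Dmarks_frame f1 dm.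
  have dn1 : done s1 vs by apply: done_frame f1 dn.
  apply: wp_run; [by []|by vm_compute|] => p pN.
  rewrite -[i.+1]addn1 iotaD has_cat -inv // add0n /= orbF !truthE /= s1i dm1 // fTL fHD.
  have -> : (arrays s1 24 (tl i) == 0) = ((arcn i).1 \notin vs) by rewrite -dn1 negbK.
  case: (arcn i \in D); last by rewrite orbF.
  case: ((arcn i).1 \in vs) => /=; first by rewrite orbF.
  have -> : (tl p == hd i) = ((arcn i).2 == (arcn p).1) by rewrite eq_sym.
  by case: ((arcn i).2 == (arcn p).1); rewrite ?orbT ?orbF.
- move=> s1 _ _ inv p pN; rewrite inv //; apply/hasP/existsP => [[q]|[u /andP[uD uvs]]].
    rewrite mem_iota add0n => /andP[_ qN] /and3P[qD qvs /eqP qp].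
    by exists (arcn q).1; rewrite -qp -surjective_pairing qD.
  have [q qN qE] := arcn_surj esG x0 (subsetP D_AP _ uD).
  by exists q; rewrite ?mem_iota ?add0n // qE uD uvs eqxx.
Qed.

Lemma wp_find_source s vs : base s -> done s vs ->
  (forall p, p < N -> (arrays s 25 (tl p) != 0) = blocked vs (arcn p).1) ->
  wp find_source s (N * 60 + 30) (fun s' =>
    if regs s' 8 is v.+1 then exists p, [/\ p < N, v = tl p, (arcn p).1 \notin vs & ~~ blocked vs (arcn p).1]
    else forall p, p < N -> ((arcn p).1 \in vs) || blocked vs (arcn p).1).
Proof.
move=> bs dn bl; apply: wp_le.
  apply: wp_seq_frame; first by apply: (@wp_run _ _ 2 (fun s1 => regs s1 8 = 0)).
  move=> s1 s18 f1; have bs1 : base s1 by apply: base_frame f1 bs.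
  have dn1 : done s1 vs by apply: done_frame f1 dn.
  have bl1 p : p < N -> (arrays s1 25 (tl p) != 0) = blocked vs (arcn p).1.
    by move=> pN; rewrite f1.2 // bl.
  apply: (@wp_for_const 5 2 _ N 49 (N * 60 + 9) (fun i s' =>
    if regs s' 8 is v.+1 then exists p, [/\ p < N, v = tl p, (arcn p).1 \notin vs & ~~ blocked vs (arcn p).1]
    else forall p, p < i -> ((arcn p).1 \in vs) || blocked vs (arcn p).1)) => //.
  - exact: r2 bs1.
  - by rewrite /= s18.
  - move=> i s2 iN s2i _ f2 inv; have bs2 : base s2 by apply: base_frame f2 bs1.
    have [fTL _ _ _ _] := aAF bs2 iN.
    have dn2 : done s2 vs by apply: done_frame f2 dn1.
    apply: wp_run; [by []|by vm_compute|].
    have E1 : (arrays s2 24 (tl i) == 0) = ((arcn i).1 \notin vs) by rewrite -dn2 negbK.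
    have E2 : (arrays s2 25 (tl i) == 0) = ~~ blocked vs (arcn i).1.
      by rewrite f2.2 // -bl1 // negbK.
    rewrite /= !truthE /= s2i fTL E1 E2.
    case: ifP => [/andP[nv nb]|no] /=; first by rewrite addn1; exists i.
    case E: (regs s2 8) inv => [|v] // inv p; rewrite ltnS leq_eqVlt => /orP[/eqP->|/inv//].
    by move/negbT: no; rewrite negb_and !negbK.
lia.
Qed.

Lemma wp_emit_source s vs v : base s -> done s vs -> regs s 8 = v.+1 ->
  regs s 12 = size (ids vs) -> (forall i, i < size (ids vs) -> arrays s 17 i = nth 0 (ids vs) i) ->
  wp emit_source s (N * 60 + 30) (fun s' => let vs' := rcons vs v in
    [/\ done s' vs', regs s' 12 = size (ids vs') &
        forall i, i < size (ids vs') -> arrays s' 17 i = nth 0 (ids vs') i]).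
Proof.
move=> bs dn s8 s12 s17.
have idsE : ids (rcons vs v) = ids vs ++ nbrs v N.
  by rewrite /ids map_rcons -cats1 flatten_cat /= cats0.
apply: wp_le.
  apply: wp_seq_frame.
    apply: (@wp_for_const 5 2 _ N 49 (N * 60 + 9) (fun i s' => let L := ids vs ++ nbrs v i in
      regs s' 12 = size L /\ forall j, j < size L -> arrays s' 17 j = nth 0 L j)
      _ (fun s' => let L := ids (rcons vs v) in
      regs s' 12 = size L /\ forall j, j < size L -> arrays s' 17 j = nth 0 L j)) => //.
    - exact: r2 bs.
    - by rewrite /= cats0; split.
    - move=> i s1 iN s1i _ f1 [inv1 inv2]; have bs1 : base s1 by apply: base_frame f1 bs.
      have [fTL _ _ _ _] := aAF bs1 iN.
      apply: wp_run; [by []|by vm_compute|].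
      rewrite nbrsS /= !truthE /= s1i fTL f1.1 // s8 subn1 /=.
      case: ifP => _ //=; rewrite -rcons_cat size_rcons inv1 addn1; split=> // j.
      rewrite ltnS nth_rcons; case: ltngtP => // lt _; exact: inv2.
    - by move=> s1 _ _; rewrite idsE.
  move=> s1 [s1c s1l] f1; apply: (@wp_run _ _ 6) => //.
  split=> // u; rewrite /= f1.1 // s8 subn1 /= mem_rcons inE -val_eqE /=.
  by case: (nat_of_ord u == nat_of_ord v) => //=; rewrite f1.2 // dn.
lia.
Qed.

Definition sorted_prefix s vs : Prop :=
  [/\ done s vs, regs s 12 = size (ids vs),
      forall i, i < size (ids vs) -> arrays s 17 i = nth 0 (ids vs) i,
      uniq vs & linear_extension D vs].

Lemma wp_sort_round s vs : base s -> Dmarks s -> sorted_prefix s vs ->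
  wp sort_round s (N * 250 + 150) (fun s' =>
    if [forall p in AP G, p.1 \in vs] then sorted_prefix s' vs
    else exists v, sorted_prefix s' (rcons vs v)).
Proof.
move=> bs dm [dn s12 s17 uq le_vs]; apply: wp_le.
  apply: wp_seq_frame; first exact: wp_clear_marks.
  move=> s1 z1 f1; have bs1 : base s1 by apply: base_frame f1 bs.
  have dm1 : Dmarks s1 by apply: Dmarks_frame f1 dm.
  have dn1 : done s1 vs by apply: done_frame f1 dn.
  apply: wp_seq_frame; first exact: wp_mark_heads bs1 dm1 dn1 z1.
  move=> s2 bl2 f2; have bs2 : base s2 by apply: base_frame f2 bs1.
  have dn2 : done s2 vs by apply: done_frame f2 dn1.
  apply: wp_seq_frame; first exact: wp_find_source bs2 dn2 bl2.
  move=> s3 src f3; have bs3 : base s3 by apply: base_frame f3 bs2.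
  have dn3 : done s3 vs by apply: done_frame f3 dn2.
  have s3c : regs s3 12 = size (ids vs) by rewrite f3.1 // f2.1 // f1.1.
  have s3l i : i < size (ids vs) -> arrays s3 17 i = nth 0 (ids vs) i.
    by move=> lt; rewrite f3.2 // f2.2 // f1.2 // s17.
  apply: (@wp_if _ _ _ _ (N * 60 + 30)) => /=; case E: (regs s3 8) src => [|v] // src _.
    have [p [pN vE pv pb]] := src.
    have s38 : regs s3 8 = (arcn p).1.+1 by rewrite E vE.
    apply: wp_weaken (wp_emit_source bs3 dn3 s38 s3c s3l) _ _ => // s4 [d4 c4 l4].
    case: ifPn => [/forallP/(_ (arcn p))|_].
      by rewrite (arcn_AP esG x0 pN) (negbTE pv).
    exists (arcn p).1; split=> //; first by rewrite rcons_uniq pv.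
    apply: linear_extension_rcons => // u uD; apply: contraNT pb => uvs.
    by apply/existsP; exists u; rewrite uD.
  apply: wp_run => //; first by rewrite /= addn_gt0 orbT.
  case: ifPn => //= /forallPn[q]; rewrite negb_imply => /andP[qA qv]; exfalso.
  (* Isolated vertices are never scanned and must be left out. A vertex blocking another one has an
     arc of D, hence an edge, so it belongs to U. *)
  pose U := [set v | (v \notin vs) && [exists u, adj G v u]].
  have qU : q.1 \in U by rewrite inE qv; apply/existsP; exists q.2; move: qA; rewrite inE.
  have [v] := acyclic_source acD qU; rewrite inE => /andP[vvs /existsP[w vw]] nv.
  have [p pN pE] : exists2 p, p < N & arcn p = (v, w) by apply: (arcn_surj esG); rewrite inE.
  have := src p pN; rewrite pE (negbTE vvs) /= => /existsP[u /andP[uD uvs]].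
  have uU : u \in U.
    by rewrite inE uvs; apply/existsP; exists v; have := subsetP D_AP _ uD; rewrite inE.
  by have := nv u uU; rewrite uD.
by rewrite /=; lia.
Qed.

(** Until all tails are covered, every round adds a vertex to a list without repetition, so n rounds
    suffice. *)
Lemma wp_sort_arcs s : base s -> Dmarks s -> (forall v, arrays s 24 v = 0) ->
  wp sort_arcs s (n * (N * 250 + 200) + 30) (fun s' => exists vs,
    [/\ linear_extension D vs, uniq vs, forall p, p \in AP G -> p.1 \in vs &
        forall i, i < size (ids vs) -> arrays s' 17 i = nth 0 (ids vs) i]).
Proof.
move=> bs dm z24; apply: wp_le.
  apply: wp_seq_frame; first by apply: (@wp_run _ _ 2 (fun s1 => regs s1 12 = 0)).
  move=> s1 s112 f1; have bs1 : base s1 by apply: base_frame f1 bs.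
  have dm1 : Dmarks s1 by apply: Dmarks_frame f1 dm.
  apply: (@wp_for_const 4 0 _ n (N * 250 + 150) _ (fun i s' => exists vs, sorted_prefix s' vs /\
     ([forall p in AP G, p.1 \in vs] || (i <= size vs)))) => //.
  - exact: r0 bs1.
  - exists [::]; split; last by rewrite orbT.
    split=> //=; last exact: linear_extension_nil.
    by move=> v; rewrite /= f1.2 // z24 in_nil.
  - move=> i s2 lt _ _ f2 [vs [sp szvs]].
    have bs2 : base s2 by apply: base_frame f2 bs1.
    have dm2 : Dmarks s2 by apply: Dmarks_frame f2 dm1.
    apply: wp_weaken (wp_sort_round bs2 dm2 sp) (leqnn _) _ => s3.
    case: ifPn => full.
      by move=> sp3; exists vs; rewrite full.
    case=> v sp3; exists (rcons vs v); split=> //.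
    by rewrite size_rcons ltnS; move: szvs; rewrite (negbTE full) /= => ->; rewrite orbT.
  - move=> s2 _ _ [vs [[dn c l uq le_vs] szvs]]; exists vs; split=> // p pA.
    case/orP: szvs => [/forallP/(_ p)|szvs]; first by rewrite pA.
    have /setP/(_ p.1) : [set v in vs] = setT.
      apply/eqP; rewrite eqEcard subsetT cardsT card_ord cardsE (card_uniqP uq) szvs //.
    by rewrite !inE.
lia.
Qed.

End Sorting.

(** * The algorithm *)

Definition build_mtto : cmd :=
  triangle_rows ;; sort_arcs ;; reset ;; search ;; output ;; Assign 0 (Const 1).

(** The first search checks each root against itself, hence visits every arc; only its finishing
    order is kept. The second checks against the reverse arc, and an MTTO exists exactly when its
    result is consistent. *)
Definition orient : cmd :=
  tables ;; imp_rows ;; corr_rows ;; search ;; reverse_roots ;; reset ;; search ;; check ;;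
  If (Reg 7) (Assign 0 (Const 0)) build_mtto.

(** Without edges n * m is 0 although n may be large, so the tables must not be built; the answer is
    immediate. *)
Definition program : cmd := If (Reg 1) orient (Assign 0 (Const 1)).

Lemma map_eq_cat_cons (T1 T2 : Type) (f : T1 -> T2) s a x b : map f s = a ++ x :: b ->
  exists s1 y s2, [/\ s = s1 ++ y :: s2, map f s1 = a & f y = x].
Proof.
elim: a s => [|a0 a IHa] [|y s] //= [].
  by move=> yx _; exists [::], y, s.
move=> <- /IHa[s1 [z [s2 [-> <- zx]]]].
by exists (y :: s1), z, s2.
Qed.

(** * Correctness and running time of the whole program *)

Section Main.
Variables (n : nat) (G : mtgraph 'I_n) (es : seq ('I_n * 'I_n)).
Hypothesis esG : edge_list G es.
Variable x0 : 'I_n * 'I_n.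

Notation m := (size es).
Notation N := (m + m).
Notation K := (n + n).
Notation arcn := (arcn es x0).
Notation neg := (neg es).
Notation base := (base G es x0).
Notation ids := (ids es x0).
Notation marks := (marks es x0).
Notation sound_cells := (sound_cells G es x0).
Notation forc p q := (forces G (arcn p) (arcn q)).

Lemma wp_search_arcs s A chk chkP roots : base s -> arrays s 16 =1 A -> sound_cells A ->
  (forall p q, p < N -> q < N -> aug_arc G (arcn p) (arcn q) -> exists2 k, k < K & A (p * K + k) = q.+1) ->
  (forall p, p < N -> chk p < N /\ arcn (chk p) = chkP (arcn p)) ->
  size roots = N -> (forall p, p \in roots -> p < N) ->
  (forall i, i < N -> arrays s 17 i = nth 0 roots i) -> (forall p, p < N -> arrays s 18 p = chk p) ->
  (forall p, p < N -> arrays s 19 p = 0 /\ arrays s 20 p = 0) ->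
  wp search s (N * (K + 2) * 300 + 100) (fun s' => marks s' (greedy G chkP [seq arcn p | p <- roots]) /\
    exists F : seq nat,
    [/\ forall i, i < size F -> arrays s' 22 i = nth 0 (rev F) i,
        uniq F,
        forall p, p \in F -> p < N,
        forall p, p < N -> (p \in F) = (arcn p \in greedy G chkP [seq arcn p | p <- roots]) &
        (forall p, p < N -> p \in F) -> forall F2 v F1, F = F2 ++ v :: F1 -> forall u, u < N -> forc u v ->
          forc v u \/ exists2 u', u' \in F2 & forc u u' /\ forc u' u]).
Proof.
move=> bs sA so co ch szr rlt s17 s18 z.
have cell_so p k q : p < N -> k < K -> A (p * K + k) = q.+1 -> q < N /\ forc p q.
  move=> pN kK E; case: (so p k pN kK); rewrite E //.
  case=> q' [q'N [->] _ st]; split=> //.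
  by case: st => [pq|->]; [exact: connect1|exact: connect0].
have si : search_input N K A chk roots s.
  split=> //; [exact: r2 bs|exact: r3 bs|exact: aR2 bs].
apply: wp_weaken (@wp_search _ G N K arcn A chk chkP roots _ _ _ cell_so co ch szr rlt s si _ _) (leqnn _) _.
- by move=> p; exact: (arcn_AP esG).
- by move=> x; exact: (arcn_surj esG).
- by move=> p q; exact: (arcn_inj esG).
- by move=> p /z[].
- by move=> p /z[].
move=> s' [c [re ic nact]].
have vis p : p < N -> (p \in fin c) = (arcn p \in greedy G chkP [seq arcn p | p <- roots]).
  by move=> pN; apply: (search_visited _ ic).
have stk0 : stk c = [::] by move: nact; rewrite negb_or negbK => /andP[_ /eqP].
split; first by move=> p pN; rewrite (repV re pN) /visited stk0 /= vis.
exists (fin c); split.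
- exact: repF re.
- by have := inv_uniq ic; rewrite /visited stk0.
- by move=> p pf; apply: (inv_lt ic); rewrite /visited stk0.
- exact: vis.
- by move=> full; apply: search_postorder ic nact full.
Qed.

Lemma mem_ids vs p : (p \in ids vs) = (p < N) && ((arcn p).1 \in vs).
Proof.
apply/flatten_mapP/andP => [[v vV]|[pN pV]].
  by rewrite mem_nbrs => /andP[-> /eqP/val_inj->].
by exists (arcn p).1; rewrite // mem_nbrs pN /=.
Qed.

Lemma uniq_ids vs : uniq vs -> uniq (ids vs).
Proof.
elim: vs => //= v vs IHvs /andP[vvs /IHvs uq].
rewrite /ids /= -/(ids vs) cat_uniq uq andbT filter_uniq ?iota_uniq //=.
apply/hasPn => p; rewrite mem_ids mem_nbrs => /andP[_ pvs].
by rewrite negb_and; apply/orP; right; apply: contraNneq vvs => /val_inj <-.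
Qed.

Lemma arcs_iota : arcs es = [seq arcn p | p <- iota 0 N].
Proof. by rewrite -[LHS](mkseq_nth x0) size_arcs. Qed.

Lemma map_ids vs : [seq arcn p | p <- ids vs] = by_tail (arcs es) vs.
Proof.
rewrite /ids /by_tail map_flatten -map_comp; congr flatten; apply: eq_map => v /=.
by rewrite arcs_iota filter_map.
Qed.

Definition decided (s : state) : Prop :=
  (regs s 0 = 1 /\ mtto G (output_arcs n m s)) \/ (regs s 0 = 0 /\ ~ exists O, mtto G O).

Lemma neg_chk p : p < N -> neg p < N /\ arcn (neg p) = swap (arcn p).
Proof. by move=> pN; rewrite neg_lt // arcn_neg. Qed.

Lemma wp_build_mtto s A O : base s -> arrays s 16 =1 A -> sound_cells A ->
  (forall p q, p < N -> q < N -> aug_arc G (arcn p) (arcn q) -> exists2 k, k < K & A (p * K + k) = q.+1) ->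
  marks s O -> amtto G O -> (forall p, p < N -> arrays s 18 p = neg p) ->
  (forall v, arrays s 24 v = 0) ->
  wp build_mtto s (N * (K + 2) * 300 + N * (n * 100 + 100) + n * (N * 250 + 200) + N * 100 + 300) decided.
Proof.
move=> bs sA so co mk am s18 z24.
have /amttoP[/orientationP[sO _ _] _] := am.
apply: wp_le.
  apply: wp_seq_frame; first exact: wp_triangle_rows bs mk sO.
  move=> s1 dm1 f1; have bs1 : base s1 by apply: base_frame f1 bs.
  apply: wp_seq_frame.
    apply: (@wp_sort_arcs n G es esG x0 (off_triangles O)) => //.
    - by apply/subsetP => p; rewrite inE => /andP[/(subsetP sO)].
    - exact: off_triangles_acyclic am.
    - by move=> v; rewrite f1.2.
  move=> s2 [vs [le_vs uq vsA s217]] f2; have bs2 : base s2 by apply: base_frame f2 bs1.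
  have size_ids : size (ids vs) = N.
    rewrite -(size_iota 0 N); apply/perm_size/uniq_perm; rewrite ?uniq_ids ?iota_uniq // => p.
    rewrite mem_ids mem_iota add0n; case pN: (p < N) => //=.
    by apply: vsA; exact: arcn_AP.
  apply: wp_seq_frame; first by apply: (@wp_reset s2 N); exact: r2 bs2.
  move=> s3 z3 f3; have bs3 : base s3 by apply: base_frame f3 bs2.
  apply: wp_seq_frame.
    apply: (@wp_search_arcs s3 A neg swap (ids vs)) => //.
    - by move=> j; rewrite f3.2 // f2.2 // f1.2.
    - exact: neg_chk.
    - by move=> p; rewrite mem_ids => /andP[].
    - by move=> i lt; rewrite f3.2 // s217 // size_ids.
    - by move=> p lt; rewrite f3.2 // f2.2 // f1.2 // s18.
  move=> s4 [mk4 _] f4; have bs4 : base s4 by apply: base_frame f4 bs3.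
  rewrite map_ids in mk4.
  have mO := by_tail_mtto (arcs_AP esG) am le_vs vsA.
  have amO := by_tail_amtto (arcs_AP esG) am le_vs vsA.
  apply: wp_seq_frame; first by apply: wp_output bs4 mk4 _; case/amttoP: amO.
  move=> s5 out5 f5; apply: (@wp_run _ _ 2) => //.
  by left; split=> //; move: mO; rewrite -out5.
lia.
Qed.

Lemma wp_orient : 0 < n -> 0 < m ->
  wp orient (input G es) (200 * 100 * (n * m + minn (#|mono_triangles G| * n) (m ^ 2))) decided.
Proof.
move=> n0 m0; apply: wp_le.
  apply: wp_seq_frame; first exact: wp_tables.
  move=> s1 [bs1 t1 z1] f1.
  apply: wp_seq_frame; first by apply: wp_imp_rows bs1 _ => //; exact: z1.
  move=> s2 [so2 im2] f2; have bs2 : base s2 by apply: base_frame f2 bs1.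
  apply: wp_seq_frame; first exact: (wp_corr_rows esG bs2).
  move=> s3 [g3 co3] f3; have bs3 : base s3 by apply: base_frame f3 bs2.
  set A := arrays s3 16.
  have so : sound_cells A by apply: (proj1 g3).
  have co : forall p q, p < N -> q < N -> aug_arc G (arcn p) (arcn q) ->
      exists2 k, k < K & A (p * K + k) = q.+1.
    apply: (table_complete esG so) => // p pN z; apply: imp_filled_mono (im2 p pN z).
    exact: (proj2 g3).
  apply: wp_seq_frame.
    apply: (@wp_search_arcs s3 A (fun p => p) (fun p => p) (iota 0 N)) => //.
    - by rewrite size_iota.
    - by move=> p; rewrite mem_iota add0n.
    - by move=> i lt; rewrite f3.2 // f2.2 // nth_iota //; case: (t1 i lt).
    - by move=> i lt; rewrite f3.2 // f2.2 //; case: (t1 i lt).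
    - by move=> p pN; rewrite !f3.2 // !f2.2 // !z1.
  move=> s4 [mk4 [F [F22 uF Flt Fg post]]] f4; have bs4 : base s4 by apply: base_frame f4 bs3.
  rewrite -arcs_iota in Fg.
  have Ffull p : p < N -> p \in F.
    move=> pN; rewrite Fg //; have := @greedy_cover _ G (fun p => p) (arcs es) (arcn p).
    by rewrite (arcs_AP esG) arcn_AP // orbb => /(_ isT).
  have FE : F =i iota 0 N.
    by move=> p; rewrite mem_iota add0n; apply/idP/idP => [/Flt|/Ffull].
  have szF : size F = N.
    by rewrite -(size_iota 0 N); apply/perm_size/uniq_perm; rewrite ?iota_uniq.
  pose roots := [seq neg p | p <- F].
  apply: wp_seq_frame.
    by apply: (@wp_reverse_roots n G es x0 s4 F) => // i lt; rewrite F22 // szF.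
  move=> s5 [s517 s518] f5; have bs5 : base s5 by apply: base_frame f5 bs4.
  apply: wp_seq_frame; first by apply: (@wp_reset s5 N); exact: r2 bs5.
  move=> s6 z6 f6; have bs6 : base s6 by apply: base_frame f6 bs5.
  have s618 p : p < N -> arrays s6 18 p = neg p by move=> pN; rewrite f6.2 // s518.
  have s6A : arrays s6 16 =1 A by move=> j; rewrite f6.2 // f5.2 // f4.2.
  apply: wp_seq_frame.
    apply: (@wp_search_arcs s6 A neg swap roots) => //.
    - exact: neg_chk.
    - by rewrite size_map.
    - by move=> _ /mapP[p /Flt pN ->]; exact: neg_lt.
    - by move=> i lt; rewrite f6.2 // s517.
  move=> s7 [mk7 _] f7; have bs7 : base s7 by apply: base_frame f7 bs6.
  pose L := rev [seq arcn p | p <- F].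
  have LE : [seq arcn p | p <- roots] = [seq swap x | x <- rev L].
    rewrite /L revK /roots -!map_comp; apply/eq_in_map => p /Flt pN /=.
    by rewrite arcn_neg.
  have LA : L =i AP G.
    move=> x; rewrite mem_rev; apply/mapP/idP => [[p /Flt pN ->]|/(arcn_surj esG x0)[p pN <-]].
      exact: arcn_AP.
    by exists p; rewrite // Ffull.
  have swLA : [seq swap x | x <- rev L] =i AP G.
    move=> x; rewrite -[x]swapK (mem_map (inv_inj (@swapK _))) mem_rev LA.
    by rewrite !swap_AP.
  rewrite LE in mk7; set O1 := greedy G swap _ in mk7.
  have sO1 : O1 \subset AP G.
    by apply/subsetP; apply: greedy_sub => x; rewrite swLA.
  apply: wp_seq_frame; first exact: wp_check bs7 mk7 sO1.
  move=> s8 ck8 f8; have bs8 : base s8 by apply: base_frame f8 bs7.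
  apply: (@wp_if _ _ _ _ (N * (K + 2) * 300 + N * (n * 100 + 100) + n * (N * 250 + 200) + N * 100 + 300));
    rewrite [eval _ _]/= => e7; last first.
    apply: (@wp_build_mtto s8 A O1) => //.
    - by move=> j; rewrite f8.2 // f7.2.
    - exact: marks_frame f8 mk7.
    - by apply: consistent_amtto => //; apply/ck8.
    - by move=> p pN; rewrite f8.2 // f7.2 // s618.
    - by move=> v; rewrite f8.2 // f7.2 // f6.2 // f5.2 // f4.2 // f3.2 // f2.2 // z1.
  apply: wp_run; [by []|by rewrite (leq_trans _ (leq_addl _ 300))|].
  (* An MTTO would make the reverse finishing order conflict-free, and the assignment that failed
     the check would be consistent. *)
  right; split=> //; case=> O /mtto_amtto amO.
  move/negP: e7; apply; apply/ck8; apply: greedy_consistent.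
  apply: postorder_conflict_free amO LA _ => F1 v F2 E u uA uv.
  have E' : [seq arcn p | p <- F] = rev F2 ++ v :: rev F1.
    by rewrite -[LHS]revK -/L E rev_cat rev_cons cat_rcons.
  have [F2' [y [F1' [FE' F2E yv]]]] := map_eq_cat_cons E'.
  have [u0 u0N u0E] := arcn_surj esG x0 uA.
  rewrite -u0E -yv in uv *.
  have [|[u' u'F mu]] := post Ffull _ _ _ FE' u0 u0N uv; first by left.
  right; exists (arcn u') => //.
  by rewrite -mem_rev -F2E map_f.
have W1 := total_weight_le_square esG x0; have W2 := total_weight_le_triangles esG x0.
move: (total_weight G es x0) W1 W2 => W W1 W2.
(* The factor 27 comes from [triples_le]; it also covers N * N, which is 4 m ^ 2. *)
have W3 : W <= 27 * minn (#|mono_triangles G| * n) (m ^ 2).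
  rewrite /minn; case: ifP => _; first by move: W2; lia.
  by apply: leq_trans W1 _; rewrite -mulnn; lia.
move: (minn _ _) W3 => B W3.
(* Since n and m are positive, n * m absorbs all lower-order terms. Once the products are expanded
   and n * m is abstracted, the goal is linear. *)
have h1 : n <= n * m by rewrite leq_pmulr.
have h2 : m <= n * m by rewrite leq_pmull.
clear -W3 h1 h2 n0 m0.
have h3 : 1 <= n * m by rewrite muln_gt0 n0.
have -> : ecost (Reg 7) = 1 by [].
have E1 : N * (n * 200 + 100) = n * m * 400 + m * 200 by lia.
have E2 : N * n * 220 = n * m * 440 by lia.
have E3 : N * (K + 2) * 300 = n * m * 1200 + m * 1200 by lia.
have E4 : N * (n * 100 + 100) = n * m * 200 + m * 200 by lia.
have E5 : n * (N * 250 + 200) = n * m * 500 + n * 200 by lia.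
rewrite E1 E2 E3 E4 E5; move: (n * m) h1 h2 h3 => P h1 h2 h3; clear E1 E2 E3 E4 E5.
lia.
Qed.

End Main.

Theorem theorem4 :
  (forall (V : finType) (G : mtgraph V),
     ((exists O : {set V * V}, mtto G O) <-> (exists O : {set V * V}, amtto G O)) /\
     ((exists O : {set V * V}, amtto G O) <-> acyclic (Ness G))) /\
  (exists (prog : cmd) (C : nat),
     forall (n : nat) (G : mtgraph 'I_n) (es : seq ('I_n * 'I_n)),
       edge_list G es ->
       let m := #|edges G| in
       let k := #|mono_triangles G| in
       exists (s : state) (t : nat),
         exec prog (input G es) s t /\
         correct_output G m s /\
         t <= C * (n * m + minn (k * n) (m ^ 2) + 1)).
Proof.
split; first by move=> V G; exact: mtto_amtto_Ness.
exists program, (200 * 100) => n G es esG m k.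
rewrite /m -(size_es_edges esG) -/m.
suff [s [t [ex le dec]]] : wp program (input G es)
    (200 * 100 * (n * size es + minn (k * n) (size es ^ 2) + 1)) (decided G es).
  by exists s, t.
case: es esG => [|x0 es0] esG.
  apply: wp_le.
    apply: (@wp_if _ _ _ _ 2) => //= _.
    apply: wp_run => //; left; split=> //.
    have noadj a b : adj G a b = false.
      by have := arcs_AP esG (a, b); rewrite [RHS]inE /= => <-.
    have -> : output_arcs n 0 (run (Assign 0 (Const 1)) (input G [::])) = set0.
      by apply/setP => p; rewrite !inE; apply/existsP => -[[]].
    apply/andP; split.
      apply/andP; split; first exact: sub0set.
      by apply/forallP => a; apply/forallP => b; rewrite noadj.
    by apply/forallP => a; apply/forallP => b; apply/forallP => c; rewrite inE.
  by rewrite mulnDr muln1 [ecost _]/=; apply: leq_trans (leq_addl _ _).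
set es := x0 :: es0 in esG *.
have n0 : 0 < n by apply: leq_ltn_trans (ltn_ord x0.1).
apply: wp_le.
  apply: (@wp_if _ _ _ _ (200 * 100 * (n * size es + minn (k * n) (size es ^ 2)))) => //= _.
  exact: wp_orient.
by rewrite [leqRHS]mulnDr muln1 [ecost _]/= add1n -addn2 leq_add2l.
Qed.
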